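(* Let $q$ be a prime power. (1) Fix $0<u<1$. Choose a random integer $N\ge0$ with $\Pr(N=n)=(1-u)u^n$, then choose $\alpha$ uniformly in $A(N,q)$. Then for any finite collection of distinct monic irreducible polynomials $\phi\neq z$ over $\mathbb{F}_q$, the random partitions $\lambda_\phi(\alpha)$ are independent, with $\lambda_{z-1}$ distributed according to $N_{u,q}$ and each other $\lambda_\phi$ distributed according to $M_{u^{\deg\phi},q^{\deg\phi}}$. (2) Choose $\alpha$ uniformly in $A(n,q)$. Then as $n\to\infty$, any finite collection of the random partitions $\lambda_\phi(\alpha)$ (distinct $\phi\ne z$) converges in distribution to independent random partitions, with $\lambda_{z-1}$ distributed according to $N_{1,q}$ and each other $\lambda_\phi$ according to $M_{1,q^{\deg\phi}}$. (3) Fix $0<u<1$, choose $N$ with $\Pr(N=n)=(1-u)u^n$ and $\alpha$ uniform in $P(N,q)$. Then for any finite collection of distinct monic irreducible $\phi$ of degree at least $2$, the $\lambda_\phi(\alpha)$ are independent with laws $M_{u^{\deg\phi},q^{\deg\phi}}$. The family $(\lambda_{z-a}(\alpha))_{a\in\mathbb{F}_q^*}$ is independent of the $\lambda_\phi$ with $\deg\phi\ge2$ (though the $\lambda_{z-a}$ depend on each other), and each individual $\lambda_{z-a}$ has distribution $\frac{1}{q-1}N_{u,q}+\frac{q-2}{q-1}M_{u,q}$. (4) Choose $\alpha$ uniformly in $P(n,q)$. Then as $n\to\infty$ the same statements as in (3) hold in the limit with $u=1$: any finite collection of $\lambda_\phi$ with $\deg\phi\ge2$ become independent with laws $M_{1,q^{\deg\phi}}$,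 the family $(\lambda_{z-a})_{a\in\mathbb{F}_q^*}$ is independent of these (though the $\lambda_{z-a}$ depend on each other), and each $\lambda_{z-a}$ has limiting distribution $\frac{1}{q-1}N_{1,q}+\frac{q-2}{q-1}M_{1,q}$.
   Context: $A(n,q)$: matrices $x\in GL(n+1,q)$ with $x_{11}=1$, $x_{j1}=0$ for $j\ge2$; $P(n,q)$: matrices $x\in GL(n+1,q)$ with $x_{11}\ne0$, $x_{j1}=0$ for $j\ge2$. For $\alpha\in GL(m,q)$ and monic irreducible $\phi\in\mathbb{F}_q[z]$, $\lambda_\phi(\alpha)$ is the partition of the rational canonical form: its parts are the dimensions of the cyclic subspaces in a decomposition under $\alpha$ of the $\phi$-primary component of $\mathbb{F}_q^m$. Partition notation: $|\lambda|$ size, $m_i(\lambda)$ multiplicity of part $i$, $\lambda'_i=\sum_{j\ge i}m_j(\lambda)$; $(\frac1q)_i=\prod_{j=1}^i(1-q^{-j})$. For $0<u\le1$, $q>1$: $M_{u,q}(\lambda)=\prod_{r\ge1}(1-u/q^r)\,\frac{u^{|\lambda|}}{\prod_i q^{(\lambda'_i)^2}(\frac1q)_{m_i(\lambda)}}$ on all partitions of all nonnegative integers, and $N_{u,q}(\lambda)=\prod_{r\ge1}(1-u/q^r)\,\frac{u^{|\lambda|-1}(q^{\lambda'_1}-1)}{\prod_i q^{(\lambda'_i)^2}(\frac1q)_{m_i(\lambda)}}$ on all partitions of positive integers.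
   Formalization: The parts of λ_φ(α) are taken to be the exponents e of the cyclic summands F_q[z]/(φ^e), i.e. the dimensions of the cyclic subspaces divided by deg φ; with the plain dimensions the stated laws fail when deg φ ≥ 2. The mutual dependence of the λ_{z-a} is asserted for q > 2. *)

(* Defs.v *)
From HB Require Import structures.
From mathcomp Require Import all_boot all_order all_algebra all_field.
From mathcomp Require Import all_classical all_reals all_analysis.
Set Implicit Arguments. Unset Strict Implicit. Unset Printing Implicit Defensive.
Import Order.TTheory GRing.Theory Num.Theory.
Local Open Scope ring_scope.

Definition is_partition (l : seq nat) : bool :=
  sorted geq l && all (fun x => 0 < x)%N l.

Definition psize (l : seq nat) : nat := sumn l.
Definition pmult (l : seq nat) (i : nat) : nat := count (pred1 i) l.
Definition pconj (l : seq nat) (i : nat) : nat := count (fun x => i <= x)%N l.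

Section Dists.
Variable R : realType.

Definition qpoch (q : R) (i : nat) : R := \prod_(1 <= j < i.+1) (1 - (q ^+ j)^-1).

Definition euler_prod (u q : R) : R :=
  limn (fun n : nat => \prod_(1 <= r < n.+1) (1 - u / q ^+ r)).

(* prod_i q^{(lambda'_i)^2} (1/q)_{m_i(lambda)}, i ranging over 1..|lambda|
   (all other factors are 1) *)
Definition pdenom (q : R) (l : seq nat) : R :=
  \prod_(1 <= i < (psize l).+1) (q ^+ ((pconj l i) ^ 2)%N * qpoch q (pmult l i)).

Definition Mdist (u q : R) (l : seq nat) : R :=
  euler_prod u q * u ^+ psize l / pdenom q l.

(* N_{u,q} is defined on partitions of positive integers; extended by 0. *)
Definition Ndist (u q : R) (l : seq nat) : R :=
  if psize l == 0%N then 0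
  else euler_prod u q * u ^+ (psize l).-1 * (q ^+ pconj l 1 - 1) / pdenom q l.

End Dists.

Section RCF.
Variable F : finFieldType.

(* matrices act on row vectors (v |-> v *m alpha), MathComp convention *)
Definition phi_at m (alpha : 'M[F]_m.+1) (phi : {poly F}) : 'M[F]_m.+1 :=
  horner_mx alpha phi.

Definition primary m (alpha : 'M[F]_m.+1) (phi : {poly F}) : 'M[F]_m.+1 :=
  kermx (phi_at alpha phi ^+ m.+1).

Definition cyclic_span m (alpha : 'M[F]_m.+1) (v : 'rV[F]_m.+1) : 'M[F]_m.+1 :=
  \matrix_(i < m.+1) (v *m alpha ^+ i).

(* [rcf_part alpha phi l] : l is the partition lambda_phi(alpha), i.e. the
   phi-primary component decomposes as a direct sum of alpha-cyclic subspaces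
   generated by vectors v_j whose alpha-annihilator is phi^(l_j). *)
Definition rcf_part m (alpha : 'M[F]_m.+1) (phi : {poly F}) (l : seq nat) : bool :=
  is_partition l &&
  [exists v : (size l).-tuple 'rV[F]_m.+1,
     [forall j : 'I_(size l),
        (tnth v j *m phi_at alpha phi ^+ (nth 0%N l j) == 0) &&
        (tnth v j *m phi_at alpha phi ^+ (nth 0%N l j).-1 != 0)]
     && (\sum_(j < size l) cyclic_span alpha (tnth v j) == primary alpha phi)%MS
     && (\sum_(j < size l) \rank (cyclic_span alpha (tnth v j))
           == \rank (primary alpha phi))%N].

End RCF.

Section Groups.
Variable F : finFieldType.

Definition inA n (x : 'M[F]_n.+1) : bool :=
  (x \in unitmx) && (x ord0 ord0 == 1) && [forall j : 'I_n.+1, (j != ord0) ==> (x j ord0 == 0)].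

Definition inP n (x : 'M[F]_n.+1) : bool :=
  (x \in unitmx) && (x ord0 ord0 != 0) && [forall j : 'I_n.+1, (j != ord0) ==> (x j ord0 == 0)].

Definition event := forall m, 'M[F]_m.+1 -> bool.

Variable R : realType.

Definition prob_unif (G : forall n, 'M[F]_n.+1 -> bool) (n : nat) (E : event) : R :=
  (#|[set x : 'M[F]_n.+1 | G n x && E n x]|%:R / #|[set x : 'M[F]_n.+1 | G n x]|%:R).

Definition prob_rand (G : forall n, 'M[F]_n.+1 -> bool) (u : R) (E : event) : R :=
  limn (fun N : nat => \sum_(n < N) (1 - u) * u ^+ n * prob_unif G n E).

Definition ev_joint (S : seq {poly F}) (L : {poly F} -> seq nat) : event :=
  fun m alpha => all (fun phi => rcf_part alpha phi (L phi)) S.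

Definition ev_lin (G : F -> seq nat) : event :=
  fun m alpha => [forall a : F, (a != 0) ==> rcf_part alpha ('X - a%:P) (G a)].

Definition ev_and (E1 E2 : event) : event := fun m alpha => E1 m alpha && E2 m alpha.

Definition good_coll (S : seq {poly F}) : Prop :=
  uniq S /\ forall phi, phi \in S ->
    [/\ phi \is monic, irreducible_poly phi & phi != 'X].

Definition good_coll2 (S : seq {poly F}) : Prop :=
  uniq S /\ forall phi, phi \in S ->
    [/\ phi \is monic, irreducible_poly phi & (2 <= (size phi).-1)%N].

End Groups.
Arguments prob_unif {F R} G n E.

Definition deg (F : fieldType) (phi : {poly F}) : nat := (size phi).-1.

(* Main.v *)
(* Let T be the matrix of 'X acting on a finite F['X]-module M of dimension D <= n on which 'X is
   invertible. Counting block triangular matrices shows that the expected number of embeddings of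
   M in (F^n, A), for A uniform in GL_n, is exactly 1, and that the embeddings onto the whole
   primary component for a set S of irreducible polynomials have expected number h(n - D), where
   h(k) is the probability that no p in S has a kernel at a uniform matrix of GL_k. The number of
   embeddings of a p-primary module of type l in itself is the denominator of M_{u,q}, so the
   probability of given types is a shift of h divided by these denominators.

   The first fact applied to the powers of F['X]/(p) gives all moments of the number of elements
   of ker p(A), hence h by inversion; its coefficients are those of Euler's expansion of
   prod_r (1 - u/q^r). Abel means (0 < u < 1) and limits (u = 1) both turn a shift by d into a
   multiplication by u^d, which yields the law of the types for GL_n without any classification of
   matrices. Counting pairs (matrix, eigenvector for a) relates matrices with first column a e_0 to
   GL_(n+1) with weight q^(number of parts of lambda_(z-a)) - 1 when z-a is among the prescribed
   polynomials, and their lower right block to GL_n otherwise; P(n,q) is the mixture over a. *)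
Require Import Defs.
From HB Require Import structures.
From mathcomp Require Import all_boot all_order all_algebra all_field.
From mathcomp Require Import all_classical all_reals all_analysis.
From mathcomp Require Import zify ring lra.
Set Implicit Arguments.
Unset Strict Implicit.
Unset Printing Implicit Defensive.
Import Order.TTheory GRing.Theory Num.Theory.
Import numFieldNormedType.Exports.
Local Open Scope ring_scope.

(** * Polynomials at square matrices and companion matrices *)

(** The mean number of embeddings is 1 because two counts agree: once the image of M is moved to the
    first D coordinates, a matrix inducing T there is given by a free lower left block and an
    element of GL_(n-D), and an injective map is completed to an invertible matrix in just as many
    ways. So n enters only through D <= n, and the inversion formula for h becomes a sum of delayed
    sequences. The number of its terms grows with n, so linearity of limits is not enough; the
    coefficients, products of 1/(1 - Q^j), are at most 2 * 2^-k in absolute value whatever n is, and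
    the tail is cut off uniformly in n. The worst case Q = 2 fixes these constants. The group A(n,q)
    consists of matrices of size n + 1 and is compared with GL_(n+1); undoing this shift by one
    produces the exponent |lambda| - 1 in N_{u,q}. The dependence of the linear components shows on
    empty partitions: the corner entry is always an eigenvalue, so they are never all empty, whereas
    for q > 2 each of them is empty with positive limiting probability. *)

Section PolyAtMatrix.
Variable F : fieldType.

(* [horner_mx] for matrices of any size: the quotient matrices below may be 0 x 0. *)
Definition hmx n : 'M[F]_n -> {poly F} -> 'M[F]_n :=
  match n with 0 => fun _ _ => 0 | n'.+1 => fun A p => horner_mx A p end.

Lemma hmxD n (A : 'M[F]_n) p r : hmx A (p + r) = hmx A p + hmx A r.
Proof. by case: n A => [|n] A /=; rewrite ?addr0 // rmorphD. Qed.

Lemma hmxM n (A : 'M[F]_n) p r : hmx A (p * r) = hmx A p *m hmx A r.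
Proof. by case: n A => [|n] A /=; rewrite ?mul0mx // rmorphM. Qed.

Lemma hmxC n (A : 'M[F]_n) c : hmx A c%:P = c%:M.
Proof. by case: n A => [|n] A /=; [rewrite [c%:M]flatmx0 | rewrite horner_mx_C]. Qed.

Lemma hmx1 n (A : 'M[F]_n) : hmx A 1 = 1%:M.
Proof. exact: hmxC. Qed.

Lemma hmx0 n (A : 'M[F]_n) : hmx A 0 = 0.
Proof. by rewrite hmxC raddf0. Qed.

Lemma hmxX n (A : 'M[F]_n) : hmx A 'X = A.
Proof. by case: n A => [|n] A /=; [rewrite [A]flatmx0 | rewrite horner_mx_X]. Qed.

Lemma hmxXn n (A : 'M[F]_n) i : hmx A 'X^i = A ^+ i.
Proof.
by elim: i => [|i IH]; rewrite ?expr0 ?hmx1 // !exprS hmxM hmxX IH.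
Qed.

Lemma hmxZ n (A : 'M[F]_n) c p : hmx A (c *: p) = c *: hmx A p.
Proof. by rewrite -mul_polyC hmxM hmxC mul_scalar_mx. Qed.

Lemma hmx_exp n (A : 'M[F]_n) p i : hmx A (p ^+ i) = hmx A p ^+ i.
Proof. by elim: i => [|i IH]; rewrite ?expr0 ?hmx1 // !exprS hmxM IH. Qed.

Lemma hmx_sum n (A : 'M[F]_n) (I : Type) (r : seq I) P (f : I -> {poly F}) :
  hmx A (\sum_(i <- r | P i) f i) = \sum_(i <- r | P i) hmx A (f i).
Proof. exact: (big_morph _ (@hmxD n A) (hmx0 A)). Qed.

Lemma hmx_comm n (A : 'M[F]_n) p r : hmx A p *m hmx A r = hmx A r *m hmx A p.
Proof. by rewrite -!hmxM mulrC. Qed.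

Lemma hmx_intertwine m n (X : 'M[F]_(m, n)) A B p :
  X *m A = B *m X -> X *m hmx A p = hmx B p *m X.
Proof.
move=> XA; elim/poly_ind: p => [|p c IH]; first by rewrite !hmx0 mulmx0 mul0mx.
rewrite !hmxD !hmxM !hmxX !hmxC mulmxDr mulmxDl mulmxA IH -!mulmxA XA.
by rewrite mul_scalar_mx mul_mx_scalar.
Qed.

Lemma hmx_ker_dvd n (A : 'M[F]_n) (v : 'rV_n) p r :
  p %| r -> v *m hmx A p = 0 -> v *m hmx A r = 0.
Proof.
by move=> /dvdpP[t ->] vp; rewrite mulrC hmxM mulmxA vp mul0mx.
Qed.

(** Matrices act on row vectors, so the first m coordinates span an invariant subspace of a lower
    triangular block matrix; [A] is the action there and [B], in the next lemma, the action on the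
    quotient. *)
Lemma hmx_ltri m n (A : 'M[F]_m) (B : 'M[F]_n) (W : 'M[F]_(n, m)) p :
  row_mx 1%:M 0 *m hmx (block_mx A 0 W B) p = hmx A p *m row_mx 1%:M 0.
Proof.
apply: hmx_intertwine; rewrite mul_row_block !mul_mx_row.
by rewrite !mul1mx !mul0mx ?mulmx1 ?mulmx0 ?addr0.
Qed.

Lemma hmx_ltri2 m n (A : 'M[F]_m) (B : 'M[F]_n) (W : 'M[F]_(n, m)) p :
  hmx (block_mx A 0 W B) p *m col_mx 0 1%:M = col_mx 0 1%:M *m hmx B p.
Proof.
apply/esym/hmx_intertwine; rewrite mul_block_col !mul_col_mx.
by rewrite !mul1mx !mul0mx ?mulmx1 ?mulmx0 ?addr0 ?add0r.
Qed.

Lemma hmx_block_diag m n (A : 'M[F]_m) (B : 'M[F]_n) (x : 'rV_m) (y : 'rV_n) p :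
  row_mx x y *m hmx (block_mx A 0 0 B) p = row_mx (x *m hmx A p) (y *m hmx B p).
Proof.
have -> : row_mx x y = x *m row_mx 1%:M 0 + y *m row_mx 0 1%:M.
  by rewrite !mul_mx_row !mulmx1 !mulmx0 add_row_mx addr0 add0r.
rewrite mulmxDl -!mulmxA hmx_ltri.
have -> : row_mx 0 1%:M *m hmx (block_mx A 0 0 B) p = hmx B p *m row_mx 0 1%:M.
  apply: hmx_intertwine; rewrite mul_row_block !mul_mx_row.
  by rewrite !mul1mx !mul0mx ?mulmx1 ?mulmx0 ?addr0 ?add0r.
by rewrite !mul_mx_row !mulmx1 !mulmx0 add_row_mx addr0 add0r.
Qed.

(** The number d of rows is left free: d = deg f gives the images of the monomial basis of
    F['X]/(f), and d = n gives [cyclic_span]. *)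
Definition cyc d n (A : 'M[F]_n) (v : 'rV_n) : 'M[F]_(d, n) :=
  \matrix_(i < d) (v *m A ^+ i).

Lemma mul_cyc d n (A : 'M[F]_n) (v : 'rV_n) (y : 'rV_d) :
  y *m cyc d A v = v *m hmx A (rVpoly y).
Proof.
have -> : rVpoly y = \sum_(i < d) y 0 i *: 'X^i.
  rewrite /rVpoly poly_def; apply: eq_bigr => i _.
  by rewrite valK.
rewrite hmx_sum mulmx_sum_row mulmx_sumr; apply: eq_bigr => i _.
by rewrite rowK hmxZ hmxXn scalemxAr.
Qed.

(* The matrix of multiplication by 'X on F['X]/(f), in the basis of monomials. *)
Definition comp_mx (f : {poly F}) : 'M[F]_((size f).-1) :=
  \matrix_i poly_rV ('X^(i.+1) %% f).

Lemma size_modp_pred (f p : {poly F}) : f != 0 -> (size (p %% f)%R <= (size f).-1)%N.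
Proof.
by move=> f0; rewrite -ltnS prednK ?size_poly_gt0 // ltn_modp.
Qed.

Lemma mul_comp_mx (f : {poly F}) (y : 'rV_((size f).-1)) :
  y *m comp_mx f = poly_rV ((rVpoly y * 'X) %% f).
Proof.
have -> : rVpoly y = \sum_(i < (size f).-1) y 0 i *: 'X^i.
  rewrite /rVpoly poly_def; apply: eq_bigr => i _.
  by rewrite valK.
rewrite mulmx_sum_row mulr_suml.
rewrite (big_morph (fun p => p %% f) (fun x y => modpD f x y) (mod0p f)) raddf_sum.
apply: eq_bigr => i _ /=.
by rewrite rowK -scalerAl -exprSr modpZl linearZ.
Qed.

Lemma mul_hmx_comp (f : {poly F}) (y : 'rV_((size f).-1)) h : f != 0 ->
  y *m hmx (comp_mx f) h = poly_rV ((rVpoly y * h) %% f).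
Proof.
move=> f0; elim/poly_ind: h => [|h c IH].
  by rewrite hmx0 mulmx0 mulr0 mod0p raddf0.
rewrite hmxD hmxM hmxX hmxC mulmxDr mulmxA IH mul_comp_mx.
rewrite poly_rV_K ?size_modp_pred // mulrDr modpD linearD /=; congr (_ + _).
  by rewrite mulrA; congr poly_rV; rewrite mulrC modp_mul mulrC.
rewrite mul_mx_scalar mulrC mul_polyC modpZl linearZ /= modp_small ?rVpolyK //.
by rewrite (leq_ltn_trans (size_poly _ _)) // prednK // size_poly_gt0.
Qed.

Lemma hmx_comp_eq0 (f : {poly F}) (y : 'rV_((size f).-1)) h : f != 0 ->
  (y *m hmx (comp_mx f) h == 0) = (f %| rVpoly y * h).
Proof.
move=> f0; rewrite mul_hmx_comp // /dvdp; apply/eqP/eqP => [e|->]; last exact: raddf0.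
by rewrite -[_ %% _](@poly_rV_K _ (size f).-1) ?size_modp_pred // e raddf0.
Qed.

Lemma cyc_intertwine n (A : 'M[F]_n) (v : 'rV_n) f :
  f != 0 -> v *m hmx A f = 0 ->
  cyc (size f).-1 A v *m A = comp_mx f *m cyc (size f).-1 A v.
Proof.
move=> f0 vf; apply/row_matrixP => i; rewrite !row_mul !rowK mul_cyc -mulmxA.
rewrite poly_rV_K ?size_modp_pred // -[A ^+ i *m A]/(A ^+ i * A) -exprSr -hmxXn.
rewrite {1}(divp_eq 'X^(i.+1) f) hmxD mulmxDr (hmx_ker_dvd _ vf) ?add0r //.
exact: dvdp_mull.
Qed.

(** A linear map out of F['X]/(f) is determined by the image v of 1. The bound on the size of f
    makes the quotient nonzero, so that 1 is a basis vector. *)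
Lemma comp_intertwine_cyc n (A : 'M[F]_n) (f : {poly F}) (X : 'M[F]_((size f).-1, n)) :
  (1 < size f)%N -> X *m A = comp_mx f *m X ->
  exists2 v, v *m hmx A f = 0 & X = cyc (size f).-1 A v.
Proof.
move=> sf XA; have f0 : f != 0 by rewrite -size_poly_gt0 ltnW.
exists (poly_rV 1 *m X).
  rewrite -mulmxA (hmx_intertwine f XA) mulmxA mul_hmx_comp // poly_rV_K.
    by rewrite mul1r modpp raddf0 mul0mx.
  by rewrite size_poly1 -subn1 subn_gt0.
apply/row_matrixP => i; rewrite rowK -mulmxA -hmxXn (hmx_intertwine _ XA).
rewrite mulmxA mul_hmx_comp // poly_rV_K; last first.
  by rewrite size_poly1 -subn1 subn_gt0.
rewrite mul1r modp_small; last first.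
  by rewrite size_polyXn -[ltnRHS](prednK (ltnW sf)) ltnS.
by rewrite -[poly_rV _](_ : delta_mx 0 i = _) ?rowE // -rVpoly_delta rVpolyK.
Qed.

Fixpoint dimT (fs : seq {poly F}) : nat :=
  if fs is f :: s then ((size f).-1 + dimT s)%N else 0%N.

Fixpoint Tmx (fs : seq {poly F}) : 'M[F]_(dimT fs) :=
  match fs with [::] => 0 | f :: s => block_mx (comp_mx f) 0 0 (Tmx s) end.

Lemma dimTE fs : dimT fs = (\sum_(f <- fs) (size f).-1)%N.
Proof. by elim: fs => [|f s IH] /=; rewrite ?big_nil // big_cons IH. Qed.

Lemma irredp_ndvd_coprime (p g : {poly F}) :
  irreducible_poly p -> ~~ (p %| g) -> coprimep p g.
Proof.
move=> [sp ip] ndv; rewrite /coprimep; apply/negPn/negP => s1.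
have := ip _ s1 (dvdp_gcdl p g) => /eqp_dvdl h.
by move: ndv; rewrite -h dvdp_gcdr.
Qed.

Lemma stable_hmx m n (A : 'M[F]_n) B (X : 'M[F]_(m, n)) (v : 'rV_n) g :
  X *m A = B *m X -> (v <= X)%MS -> (v *m hmx A g <= X)%MS.
Proof.
move=> XA /submxP[w ->]; rewrite -mulmxA (hmx_intertwine _ XA) mulmxA.
exact: submxMl.
Qed.

(* Every nonzero submodule of F['X]/(p^e) contains p^(e-1). *)
Lemma socle_sub m n (A : 'M[F]_n) B (X : 'M[F]_(m, n)) (v : 'rV_n) p e g :
  irreducible_poly p -> X *m A = B *m X ->
  v *m hmx A (p ^+ e) = 0 -> ~~ (p ^+ e %| g) -> (v *m hmx A g <= X)%MS ->
  (v *m hmx A (p ^+ e.-1) <= X)%MS.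
Proof.
move=> ip XA; elim: e v g => [|e IH] v g; first by rewrite expr0 dvd1p.
move=> ve ndv vg /=; have [/dvdpP[g' gE]|pg] := boolP (p %| g).
  case: e IH ve ndv => [|e] IH ve ndv.
    by move: ndv; rewrite gE expr1 dvdp_mulIr.
  rewrite exprS hmxM mulmxA; apply: (IH _ g').
  - by rewrite -mulmxA -hmxM -exprS.
  - by move: ndv; rewrite gE [p ^+ e.+2]exprSr dvdp_mul2r // irredp_neq0.
  - by rewrite -mulmxA -hmxM mulrC -gE.
have cop : coprimep (p ^+ e.+1) g by rewrite coprimep_expl ?irredp_ndvd_coprime.
have /Bezout_eq1_coprimepP[[a b] /= ab1] := cop.
have -> : v *m hmx A (p ^+ e) = v *m hmx A g *m hmx A (b * p ^+ e).
  rewrite -mulmxA -hmxM mulrA [g * b]mulrC.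
  have -> : b * g = 1 - a * p ^+ e.+1 by rewrite -ab1 addrC addKr.
  rewrite mulrBl mul1r hmxD mulmxDr -scaleN1r hmxZ -scalemxAr.
  rewrite [v *m hmx A (_ * _ * _)](hmx_ker_dvd _ ve) ?scaler0 ?addr0 //.
  by rewrite dvdp_mulr // dvdp_mull.
exact: stable_hmx XA _.
Qed.

(** A linear relation puts v g(A) in the invariant row space of X for some nonzero g of degree below
    that of p^e. By [socle_sub] that space then contains v p^(e-1)(A), so this single vector decides
    independence. *)
Lemma row_free_col_cyc m n (A : 'M[F]_n) B (X : 'M[F]_(m, n)) (v : 'rV_n) p e :
  irreducible_poly p -> (0 < e)%N -> X *m A = B *m X -> row_free X ->
  v *m hmx A (p ^+ e) = 0 ->
  row_free (col_mx (cyc (size (p ^+ e)).-1 A v) X) =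
  ~~ (v *m hmx A (p ^+ e.-1) <= X)%MS.
Proof.
move=> ip e0 XA fX ve; have p0 := irredp_neq0 ip.
have pe0 : p ^+ e != 0 by rewrite expf_neq0.
have szlt : (size (p ^+ e.-1) <= (size (p ^+ e)).-1)%N.
  rewrite -{2}(prednK e0) exprS size_mul ?expf_neq0 //.
  have [+ _] := ip; move: (size p) (size (p ^+ _)); lia.
apply/idP/idP => [free|nsub].
  apply/negP => /submxP[w wE].
  have : row_mx (poly_rV (p ^+ e.-1)) (- w) *m
         col_mx (cyc (size (p ^+ e)).-1 A v) X = 0.
    by rewrite mul_row_col mul_cyc poly_rV_K // mulNmx wE subrr.
  move/eqP; rewrite -(mul0mx _ (col_mx (cyc (size (p ^+ e)).-1 A v) X)).
  move/eqP/(row_free_inj free); rewrite -row_mx0 => /eq_row_mx[h _].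
  move: (congr1 rVpoly h); rewrite poly_rV_K // raddf0 => /eqP.
  by rewrite expf_eq0 (negPf p0) andbF.
rewrite -kermx_eq0; apply/rowV0P => z /sub_kermxP.
rewrite -[z]hsubmxK mul_row_col mul_cyc => /eqP; rewrite addr_eq0 => /eqP zE.
have vg : (v *m hmx A (rVpoly (lsubmx z)) <= X)%MS by rewrite zE -mulNmx submxMl.
have l0 : lsubmx z = 0.
  apply: contraNeq nsub => lz; apply: (socle_sub ip XA ve _ vg).
  apply/negP => /dvdp_leq; rewrite leqNgt => h.
  suff : (size (rVpoly (lsubmx z)) < size (p ^+ e))%N.
    by apply/negP; apply: h; apply: contra lz => /eqP e1;
       rewrite -[lsubmx z]rVpolyK e1 raddf0.
  by rewrite (leq_ltn_trans (size_poly _ _)) // prednK // size_poly_gt0.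
rewrite l0; move: zE; rewrite l0 raddf0 hmx0 mulmx0 => /esym/eqP.
rewrite oppr_eq0 => /eqP rz.
suff -> : rsubmx z = 0 by rewrite row_mx0.
by apply: (row_free_inj fX); rewrite /= rz mul0mx.
Qed.

End PolyAtMatrix.

(** * Counting module embeddings *)

Section Embeddings.
Variable F : finFieldType.

Definition kcard n (A : 'M[F]_n) p := #|[set v : 'rV[F]_n | v *m hmx A p == 0]|.

Lemma card_fiber_mulmx m n (B : 'M[F]_(m, n)) (v0 : 'rV_m) :
  #|[set v : 'rV_m | v *m B == v0 *m B]| = #|[set v : 'rV_m | v *m B == 0]|.
Proof.
rewrite -[RHS](card_imset _ (addIr v0)); apply: eq_card => v; rewrite inE.
apply/eqP/imsetP => [vB|[w + ->]]; last first.
  by rewrite inE => /eqP wB; rewrite mulmxDl wB add0r.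
by exists (v - v0); rewrite ?subrK // inE mulmxBl vB subrr.
Qed.

Lemma kcard_row_mx m n (A : 'M[F]_m) (B : 'M[F]_n) h :
  kcard (block_mx A 0 0 B) h = (kcard A h * kcard B h)%N.
Proof.
rewrite /kcard -cardsX.
have inj : injective (fun p : 'rV[F]_m * 'rV[F]_n => row_mx p.1 p.2).
  by move=> [a b] [c d] /= /eq_row_mx[-> ->].
rewrite -[RHS](card_imset _ inj); apply: eq_card => v; rewrite !inE.
apply/eqP/imsetP => [|[[a b]]].
  rewrite -[v]hsubmxK hmx_block_diag -row_mx0 => /eq_row_mx[va vb].
  by exists (lsubmx v, rsubmx v); rewrite // !inE va vb !eqxx.
by rewrite !inE /= => /andP[/eqP a0 /eqP b0] ->; rewrite hmx_block_diag a0 b0 row_mx0.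
Qed.

Lemma comp_coprime0 (f h : {poly F}) (y : 'rV_((size f).-1)) :
  f != 0 -> coprimep h f -> y *m hmx (comp_mx f) h = 0 -> y = 0.
Proof.
move=> f0 cop /eqP; rewrite hmx_comp_eq0 // mulrC Gauss_dvdpr 1?coprimep_sym //.
rewrite /dvdp modp_small => [/eqP y0|]; first by rewrite -[y]rVpolyK y0 raddf0.
by rewrite (leq_ltn_trans (size_poly _ _)) // prednK // size_poly_gt0.
Qed.

Lemma kcard_comp_coprime (f h : {poly F}) :
  f != 0 -> coprimep h f -> kcard (comp_mx f) h = 1%N.
Proof.
move=> f0 cop; apply: etrans (cards1 (0 : 'rV[F]_((size f).-1))).
apply: eq_card => y; rewrite !inE; apply/eqP/eqP => [|->]; last exact: mul0mx.
exact: comp_coprime0.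
Qed.

Lemma card_poly_dvd (g h : {poly F}) d : g != 0 -> h != 0 -> d = (size (g * h)).-1 ->
  #|[set y : 'rV[F]_d | g %| rVpoly y]| = (#|F| ^ (size h).-1)%N.
Proof.
move=> g0 h0 ->.
have sz : (size (g * h)).-1 = ((size g).-1 + (size h).-1)%N.
  rewrite size_mul //; move: g0 h0; rewrite -!size_poly_gt0.
  move: (size g) (size h); lia.
pose m (y : 'rV[F]_((size h).-1)) : 'rV[F]_((size (g * h)).-1) := poly_rV (rVpoly y * g).
have mK (y : 'rV[F]_((size h).-1)) : rVpoly (m y) = rVpoly y * g.
  rewrite poly_rV_K // (leq_trans (size_polyMleq _ _)) // sz.
  have := size_poly (size h).-1 (fun k => if insub k is Some i then y 0 i else 0).
  rewrite -/(rVpoly y); move: (size (rVpoly y)) => k.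
  by move: g0 h0; rewrite -!size_poly_gt0; move: (size g) (size h); lia.
have injm : injective m.
  move=> y z /(congr1 (@rVpoly _ _)); rewrite !mK => /(mulIf g0).
  exact: (can_inj (@rVpolyK _ _)).
have -> : (#|F| ^ (size h).-1)%N = #|[set: 'rV[F]_((size h).-1)]|.
  by rewrite cardsT card_mx mul1n.
rewrite -[RHS](card_imset _ injm).
apply: eq_card => y; rewrite inE; apply/idP/imsetP => [/dvdpP[t tE]|[z _ ->]]; last first.
  by rewrite mK dvdp_mull.
exists (poly_rV t) => //; rewrite /m poly_rV_K -?tE ?rVpolyK //.
have [->|t0] := eqVneq t 0; first by rewrite size_poly0.
have := size_poly (size (g * h)).-1 (fun k => if insub k is Some i then y 0 i else 0).
rewrite -/(rVpoly y) tE sz size_mul //; move: g0 t0; rewrite -!size_poly_gt0.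
by move: (size g) (size t) (size h); lia.
Qed.

Lemma kcard_comp_exp (p : {poly F}) e i : irreducible_poly p ->
  kcard (comp_mx (p ^+ e)) (p ^+ i) = (#|F| ^ ((size p).-1 * minn i e))%N.
Proof.
move=> ip; have p0 := irredp_neq0 ip.
have pX k : p ^+ k != 0 by rewrite expf_neq0.
have -> : ((size p).-1 * minn i e)%N = (size (p ^+ (minn i e))).-1.
  by rewrite size_exp.
rewrite -(@card_poly_dvd (p ^+ (e - minn i e)) (p ^+ minn i e) (size (p ^+ e)).-1) //.
  apply: eq_card => y; rewrite !inE hmx_comp_eq0 //.
  have [ie|ei] := leqP i e.
    by rewrite -{1}(subnK ie) exprD dvdp_mul2r.
  by rewrite subnn expr0 dvd1p dvdp_mull // dvdp_exp2l // ltnW.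
by rewrite -exprD subnK // geq_minr.
Qed.

(* The injective F['X]-linear maps from the sum of the F['X]/(f), f in fs, to F^n with 'X acting
   by A, given by the images of the monomial basis vectors. *)
Definition emb n fs (A : 'M[F]_n) :=
  [set X : 'M[F]_(dimT fs, n) | row_free X && (X *m A == Tmx fs *m X)].

(** This makes every p-torsion vector of F['X]/(f) a multiple of p^(e-1): either there is no
    p-torsion, or it is generated by p^(e'-1) with e' >= e. Hence summands must be adjoined in
    decreasing order of exponents. *)
Definition good_block (p : {poly F}) e (f : {poly F}) :=
  [/\ (1 < size f)%N & (coprimep p f \/ exists2 e', (e <= e')%N & f = p ^+ e')].

Lemma comp_im (p : {poly F}) e (f : {poly F}) (y : 'rV_((size f).-1)) :
  irreducible_poly p -> (0 < e)%N -> good_block p e f ->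
  y *m hmx (comp_mx f) p = 0 -> exists z, y = z *m hmx (comp_mx f) (p ^+ e.-1).
Proof.
move=> ip e0 [sf gf] yp; have f0 : f != 0 by rewrite -size_poly_gt0 ltnW.
case: gf => [cop|[e' le fE]].
  by exists 0; rewrite mul0mx; apply: comp_coprime0 yp.
move: yp => /eqP; rewrite hmx_comp_eq0 // {1}fE.
have e'0 := leq_trans e0 le.
rewrite -{1}(prednK e'0) exprSr dvdp_mul2r ?irredp_neq0 // => /dvdpP[g gE].
(* Being killed by p, y equals g p^(e'-1); splitting off p^(e-1) leaves g p^(e'-e). *)
exists (poly_rV ((g * p ^+ (e' - e)) %% f)).
rewrite mul_hmx_comp // poly_rV_K ?size_modp_pred // [_ * p ^+ _]mulrC modp_mul mulrC.
rewrite -mulrA -exprD.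
have -> : (e' - e + e.-1 = e'.-1)%N by lia.
rewrite -gE modp_small ?rVpolyK // (leq_ltn_trans (size_poly _ _)) // prednK //.
by rewrite size_poly_gt0.
Qed.

Lemma Tmx_im (p : {poly F}) e fs (x : 'rV_(dimT fs)) :
  irreducible_poly p -> (0 < e)%N -> (forall f, f \in fs -> good_block p e f) ->
  x *m hmx (Tmx fs) p = 0 -> exists z, x = z *m hmx (Tmx fs) (p ^+ e.-1).
Proof.
move=> ip e0; elim: fs x => [|f s IH] x gfs.
  by exists 0; rewrite mul0mx; apply/rowP => -[].
rewrite -[x]hsubmxK /= hmx_block_diag -row_mx0 => /eq_row_mx[x1 x2].
have [z1 z1E] := comp_im ip e0 (gfs f (mem_head _ _)) x1.
have [z2 z2E] := IH _ (fun g gs => gfs g (@mem_behead _ (f :: s) g gs)) x2.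
by exists (row_mx z1 z2); rewrite hmx_block_diag -z1E -z2E.
Qed.

Lemma mulmx_eq0_free m n (X : 'M[F]_(m, n)) (x : 'rV_m) :
  row_free X -> (x *m X == 0) = (x == 0).
Proof.
move=> fX; apply/eqP/eqP => [h|->]; last exact: mul0mx.
by apply: (row_free_inj fX); rewrite /= h mul0mx.
Qed.

(** Multiplication by p^(e-1) maps this set onto the p-torsion of the image of X, by divisibility
    inside that image ([Tmx_im]), and its fibres are cosets of the kernel of p^(e-1)(A). *)
Lemma card_socle_lift n fs (A : 'M[F]_n) X (p : {poly F}) e :
  irreducible_poly p -> (0 < e)%N -> (forall f, f \in fs -> good_block p e f) ->
  X \in emb fs A ->
  #|[set v : 'rV_n | (v *m hmx A (p ^+ e) == 0) && (v *m hmx A (p ^+ e.-1) <= X)%MS]| =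
  (kcard A (p ^+ e.-1) * kcard (Tmx fs) p)%N.
Proof.
move=> ip e0 gfs; rewrite inE => /andP[fX /eqP XA].
have ep v : v *m hmx A (p ^+ e) = v *m hmx A (p ^+ e.-1) *m hmx A p.
  by rewrite -mulmxA -hmxM -exprSr prednK.
have injX : injective (fun x : 'rV[F]_(dimT fs) => x *m X).
  by move=> x y; apply: row_free_inj.
pose B := [set w : 'rV_n | (w *m hmx A p == 0) && (w <= X)%MS].
have cB : #|B| = kcard (Tmx fs) p.
  rewrite /kcard -[RHS](card_imset _ injX); apply: eq_card => w; rewrite !inE.
  apply/andP/imsetP => [[/eqP wp /submxP[x xE]]|[x + ->]].
    exists x => //; rewrite inE -(mulmx_eq0_free _ fX) -mulmxA.
    by rewrite -(hmx_intertwine _ XA) mulmxA -xE wp.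
  rewrite inE => /eqP xp; split; last exact: submxMl.
  by rewrite -mulmxA (hmx_intertwine _ XA) mulmxA xp mul0mx.
rewrite mulnC -cB -sum1_card (partition_big (fun v => v *m hmx A (p ^+ e.-1)) (mem B)) /=.
  rewrite -sum_nat_const; apply: eq_bigr => w wB; move: (wB); rewrite inE => /andP[/eqP wp].
  case/submxP => x xE.
  have xp : x *m hmx (Tmx fs) p = 0.
    by apply/eqP; rewrite -(mulmx_eq0_free _ fX) -mulmxA -(hmx_intertwine _ XA) mulmxA -xE wp.
  have [z zE] := Tmx_im ip e0 gfs xp.
  have wE : w = (z *m X) *m hmx A (p ^+ e.-1).
    by rewrite xE zE -!mulmxA (hmx_intertwine _ XA).
  rewrite /kcard -(card_fiber_mulmx _ (z *m X)) -sum1dep_card; apply: eq_bigl => v.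
  rewrite inE ep -wE; apply/andP/idP => [[_ //]|/eqP ->].
  by rewrite wp xE submxMl !eqxx.
by move=> v; rewrite !inE ep.
Qed.

Lemma card_emb_cons n s (A : 'M[F]_n) (f : {poly F}) : (1 < size f)%N ->
  #|emb (f :: s) A| = (\sum_(X in emb s A)
    #|[set v : 'rV_n | (v *m hmx A f == 0%R) && row_free (col_mx (cyc (size f).-1 A v) X)]|)%N.
Proof.
move=> sf; have f0 : f != 0 by rewrite -size_poly_gt0 ltnW.
pose m (t : 'M[F]_(dimT s, n) * 'rV[F]_n) : 'M[F]_(dimT (f :: s), n) :=
  col_mx (cyc (size f).-1 A t.2) t.1.
have injm : injective m.
  move=> [X v] [Y w] /eq_col_mx[/= cE ->]; congr (_, _).
  have d0 : (0 < (size f).-1)%N by rewrite -subn1 subn_gt0.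
  by move/(congr1 (row (Ordinal d0))): cE; rewrite !rowK !expr0 !mulmx1.
under eq_bigr do rewrite -sum1dep_card.
rewrite pair_big_dep /= sum1dep_card -[RHS](card_imset _ injm); apply: eq_card => Y.
rewrite inE; apply/andP/imsetP => [[fY /eqP YA]|].
  move: fY YA; rewrite -[Y]vsubmxK; set X1 := usubmx Y; set X2 := dsubmx Y => fY.
  rewrite mul_col_mx mul_block_col !mul0mx addr0 add0r => /eq_col_mx[X1A X2A].
  have [v vf vE] := comp_intertwine_cyc sf X1A.
  have fX2 : row_free X2.
    rewrite -kermx_eq0; apply/rowV0P => z /sub_kermxP zX.
    have : row_mx 0 z *m col_mx X1 X2 = 0 by rewrite mul_row_col mul0mx zX addr0.
    move/eqP; rewrite (mulmx_eq0_free _ fY) -row_mx0 => /eqP /eq_row_mx[_ //].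
  exists (X2, v); last by rewrite /m /= -vE.
  by rewrite !inE /= fX2 X2A vf -vE fY !eqxx.
case=> -[X v]; rewrite !inE /= => /andP[/andP[fX /eqP XA] /andP[/eqP vf fc]] ->.
split; first by rewrite /m.
by rewrite /m /= mul_col_mx mul_block_col !mul0mx addr0 add0r XA cyc_intertwine.
Qed.

(* An embedding extends by a vector v killed by p^e iff v p^(e-1) avoids its image; as the
   exponents of p in fs are at least e, every p-torsion vector of the image is of that form. *)
Lemma card_emb_exp n fs (A : 'M[F]_n) (p : {poly F}) e :
  irreducible_poly p -> (0 < e)%N -> (forall f, f \in fs -> good_block p e f) ->
  (#|emb (p ^+ e :: fs) A| + #|emb fs A| * (kcard A (p ^+ e.-1) * kcard (Tmx fs) p) =
   #|emb fs A| * kcard A (p ^+ e))%N.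
Proof.
move=> ip e0 gfs; rewrite card_emb_cons; last first.
  by rewrite -subn_gt0 subn1 size_exp muln_gt0 e0 andbT -subn1 subn_gt0; case: ip.
rewrite -[(#|emb fs A| * (_ * _))%N]sum_nat_const -[RHS]sum_nat_const -big_split.
apply: eq_bigr => X XE /=.
rewrite -(card_socle_lift ip e0 gfs XE) /kcard.
move: (XE); rewrite inE => /andP[fX /eqP XA].
rewrite -[RHS](cardsID [set v : 'rV_n | (v *m hmx A (p ^+ e.-1) <= X)%MS]) addnC.
congr (_ + _)%N; apply: eq_card => v; rewrite !inE //.
rewrite andbC; apply: andb_id2r => /eqP ve.
exact: row_free_col_cyc XA _ _.
Qed.
End Embeddings.

(** * Double counting of embedded modules over the general linear group *)

Section CountPairs.
Variable F : finFieldType.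

Definition GLcard n := #|[set A : 'M[F]_n | A \in unitmx]|.

Lemma unitmx_block_ltri m n (A : 'M[F]_m) (B : 'M[F]_n) W :
  (block_mx A 0 W B \in unitmx) = (A \in unitmx) && (B \in unitmx).
Proof. by rewrite !unitmxE det_lblock unitrM. Qed.

Variables (D k : nat) (T : 'M[F]_D).
Hypothesis uT : T \in unitmx.

Let pid : 'M[F]_(D, D + k) := row_mx 1%:M 0.

Lemma usub_pid (Y : 'M[F]_(D + k)) : usubmx Y = pid *m Y.
Proof. by rewrite -{2}[Y]vsubmxK mul_row_col mul1mx mul0mx addr0. Qed.

(** The general linear group acts transitively on matrices of full row rank; every count over such X
    can thus be moved to the standard inclusion [pid]. *)
Lemma row_free_pid (X : 'M[F]_(D, D + k)) :
  row_free X -> exists2 g, g \in unitmx & X = pid *m g.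
Proof.
move=> /eqP rX; exists (block_mx (col_ebase X) 0 0 1%:M *m row_ebase X).
  by rewrite unitmx_mul unitmx_block_ltri col_ebase_unit unitmx1 row_ebase_unit.
rewrite mulmxA mul_row_block !mul1mx !mulmx0 ?mul0mx !addr0.
rewrite -{1}(mulmx_ebase X) rX pid_mx_row; congr (_ *m _).
by rewrite mul_mx_row mulmx1 mulmx0.
Qed.

Lemma unit_row_free (Y : 'M[F]_(D + k)) : Y \in unitmx -> row_free (usubmx Y).
Proof.
move=> uY; rewrite usub_pid -kermx_eq0; apply/rowV0P => z /sub_kermxP.
rewrite mulmxA => /(congr1 (mulmx^~ (invmx Y))); rewrite mulmxK // mul0mx.
by rewrite mul_mx_row mulmx1 mulmx0 -row_mx0 => /eq_row_mx[].
Qed.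

Lemma card_pid_ltri (B : 'M[F]_D) (Q : pred 'M[F]_(D + k)) :
  #|[set Y : 'M[F]_(D + k) | (pid *m Y == B *m pid) && Q Y]| =
  #|[set t : 'M[F]_(k, D) * 'M[F]_k | Q (block_mx B 0 t.1 t.2)]|.
Proof.
pose m (t : 'M[F]_(k, D) * 'M[F]_k) := block_mx B 0 t.1 t.2.
have injm : injective m by move=> [W C] [W' C'] /eq_block_mx[_ _ /= -> ->].
rewrite -[RHS](card_imset _ injm); apply: eq_card => Y; rewrite inE.
apply/andP/imsetP => [[/eqP pY QY]|[t + ->]]; last first.
  by rewrite inE /m => Qt; rewrite mul_row_block mul_mx_row !mul1mx !mul0mx mulmx1 mulmx0 !addr0.
have YE : Y = m (dlsubmx Y, drsubmx Y).
  rewrite /m /=; move: pY; rewrite -usub_pid mul_mx_row mulmx1 mulmx0 => pY.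
  by rewrite -{1}[Y]submxK /ulsubmx /ursubmx pY row_mxKl row_mxKr.
by exists (dlsubmx Y, drsubmx Y); rewrite // inE -/(m (_, _)) -YE.
Qed.

(** For the standard inclusion the completions are the lower triangular blocks with first diagonal
    block 1, an arbitrary corner and an invertible second block; right multiplication by g
    transports them to X. *)
Lemma card_complete (X : 'M[F]_(D, D + k)) : row_free X ->
  #|[set Y : 'M[F]_(D + k) | (Y \in unitmx) && (usubmx Y == X)]| =
  (#|F| ^ (k * D) * GLcard k)%N.
Proof.
move=> /row_free_pid[g ug ->].
have injg : injective (fun Y : 'M[F]_(D + k) => Y *m g) by move=> Y Z /(can_inj (mulmxK ug)).
have -> : (#|F| ^ (k * D) * GLcard k)%N =
  #|[set Y : 'M[F]_(D + k) | (pid *m Y == 1%:M *m pid) && (Y \in unitmx)]|.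
  rewrite card_pid_ltri -card_mx -cardsT -cardsX; apply: eq_card => t.
  by rewrite !inE unitmx_block_ltri unitmx1.
rewrite -[RHS](card_imset _ injg); apply: eq_card => Y; rewrite inE usub_pid.
apply/andP/imsetP => [[uY /eqP YE]|[Z + ->]].
  exists (Y *m invmx g); last by rewrite mulmxKV.
  by rewrite inE unitmx_mul uY unitmx_inv ug mulmxA YE mulmxK // mul1mx eqxx.
by rewrite inE mul1mx => /andP[/eqP pZ uZ]; rewrite unitmx_mul uZ ug mulmxA pZ.
Qed.

Variable P : 'M[F]_(D + k) -> 'M[F]_(D, D + k) -> bool.
Hypothesis invP : forall g A X, g \in unitmx -> P (invmx g *m A *m g) (X *m g) = P A X.

(* Double count of the pairs (A, Y) with Y invertible and upper block X = usubmx Y: conjugation by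
   Y reduces to X = pid, where A is block triangular. *)
Lemma count_pairs :
  ((\sum_(A : 'M[F]_(D + k) | A \in unitmx)
     #|[set X : 'M[F]_(D, D + k) | [&& row_free X, X *m A == T *m X & P A X]]|)
   * (#|F| ^ (k * D) * GLcard k) =
  GLcard (D + k) *
   #|[set t : 'M[F]_(k, D) * 'M[F]_k | (t.2 \in unitmx) && P (block_mx T 0 t.1 t.2) pid]|)%N.
Proof.
pose Q A X := (X *m A == T *m X) && P A X.
transitivity (\sum_(A : 'M[F]_(D + k) | A \in unitmx)
   \sum_(Y : 'M[F]_(D + k) | (Y \in unitmx) && Q A (usubmx Y)) 1)%N.
  rewrite big_distrl; apply: eq_bigr => A uA /=.
  rewrite [RHS](partition_big (fun Y : 'M[F]_(D + k) => usubmx Y)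
    (mem [set X : 'M[F]_(D, D + k) | [&& row_free X, X *m A == T *m X & P A X]])) /=.
    rewrite -sum_nat_const; apply: eq_bigr => X; rewrite inE => /and3P[fX XA PX].
    rewrite -(card_complete fX) -sum1dep_card; apply: eq_bigl => Y.
    rewrite -andbA; apply: andb_id2l => uY; apply/idP/andP => [/eqP ->|[] //].
    by rewrite /Q XA PX eqxx.
  by move=> Y /andP[uY QY]; rewrite inE unit_row_free.
transitivity (\sum_(Y : 'M[F]_(D + k) | Y \in unitmx)
   #|[set A : 'M[F]_(D + k) | (pid *m A == T *m pid) && ((A \in unitmx) && P A pid)]|)%N.
  rewrite [LHS](exchange_big_dep (fun Y : 'M[F]_(D + k) => Y \in unitmx)) /=; last first.
    by move=> ? ? _ /andP[].
  apply: eq_bigr => Y uY; rewrite sum1dep_card.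
  have injY : injective (fun A : 'M[F]_(D + k) => invmx Y *m A *m Y).
    move=> A B /(can_inj (mulmxK uY)) /(congr1 (mulmx Y)).
    by rewrite !mulKVmx.
  rewrite -[RHS](card_imset _ injY); apply: eq_card => A; rewrite inE.
  apply/and3P/imsetP => [[uA _ /andP[/eqP YA PA]]|[B + ->]].
    have AE : A = invmx Y *m (Y *m A *m invmx Y) *m Y by rewrite !mulmxA mulVmx // mul1mx mulmxKV.
    exists (Y *m A *m invmx Y) => //; rewrite inE !unitmx_mul uY uA unitmx_inv uY /=.
    apply/andP; split; last by rewrite -(invP _ _ uY) -AE -usub_pid.
    by rewrite !mulmxA -usub_pid YA usub_pid -!mulmxA mulmxV // mulmx1.
  rewrite inE => /and3P[/eqP pB uB PB]; rewrite !unitmx_mul unitmx_inv uY uB; split=> //.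
  rewrite /Q usub_pid invP // PB andbT !mulmxA mulmxK //.
  by rewrite pB.
rewrite sum_nat_const card_pid_ltri /GLcard; congr (_ * _)%N; apply: eq_card => t.
  by rewrite inE.
by rewrite !inE unitmx_block_ltri uT.
Qed.
End CountPairs.

(** * Embeddings onto a primary component *)

Section Types.
Variable F : finFieldType.

Lemma GLcard_gt0 n : (0 < GLcard F n)%N.
Proof. by apply/card_gt0P; exists 1%:M; rewrite inE unitmx1. Qed.

Lemma kermx_subP m n k (B : 'M[F]_(m, n)) (X : 'M[F]_(k, m)) :
  reflect (forall v : 'rV_m, v *m B = 0 -> (v <= X)%MS) (kermx B <= X)%MS.
Proof.
apply: (iffP rV_subP) => h v; last by move/sub_kermxP; apply: h.
by move=> vB; apply: h; apply/sub_kermxP.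
Qed.

(* The row space of X contains the psi-primary component of A. *)
Definition full m n (psi : {poly F}) (A : 'M[F]_n) (X : 'M[F]_(m, n)) :=
  (kermx (hmx A (psi ^+ n)) <= X)%MS.

Lemma full_conj m n psi (g A : 'M[F]_n) (X : 'M[F]_(m, n)) :
  g \in unitmx -> full psi A X -> full psi (invmx g *m A *m g) (X *m g).
Proof.
move=> ug /kermx_subP AX; apply/kermx_subP => v vA.
have gA : g *m (invmx g *m A *m g) = A *m g by rewrite !mulmxA mulmxV // mul1mx.
have : (v *m invmx g <= X)%MS.
  apply: AX; apply: (can_inj (mulmxK ug)); rewrite /= mul0mx.
  by rewrite -(mulmxA _ (hmx A _) g) -(hmx_intertwine _ gA) mulmxA mulmxKV.
by move/(submxMr g); rewrite mulmxKV.
Qed.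

Lemma full_conjE m n psi (g A : 'M[F]_n) (X : 'M[F]_(m, n)) :
  g \in unitmx -> full psi (invmx g *m A *m g) (X *m g) = full psi A X.
Proof.
move=> ug; apply/idP/idP; last exact: full_conj.
have ug' : invmx g \in unitmx by rewrite unitmx_inv.
move/(full_conj ug'); rewrite invmxK mulmxK // !mulmxA mulmxV // mul1mx.
by rewrite mulmxK.
Qed.

(** Since psi is nilpotent on T, the psi-primary component leaves the first D coordinates exactly
    when psi is singular on the quotient. A kernel vector of psi(B) lifts to a vector that psi moves
    into the first block, where a further psi^D kills it. *)
Lemma full_ltri D k psi (T : 'M[F]_D) (B : 'M[F]_k) W :
  hmx T (psi ^+ D) = 0 ->
  full psi (block_mx T 0 W B) (row_mx 1%:M 0 : 'M[F]_(D, D + k)) = (hmx B psi \in unitmx).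
Proof.
move=> T0; set M := block_mx _ _ _ _.
have pr (v : 'rV_(D + k)) : v *m col_mx 0 1%:M = rsubmx v.
  by rewrite -{1}[v]hsubmxK mul_row_col mulmx0 mulmx1 add0r.
have sub (v : 'rV_(D + k)) : (v <= (row_mx 1%:M 0 : 'M[F]_(D, D + k)))%MS = (rsubmx v == 0).
  apply/submxP/eqP => [[w ->]|v0]; first by rewrite mul_mx_row mulmx0 row_mxKr.
  by exists (lsubmx v); rewrite mul_mx_row mulmx1 mulmx0 -v0 hsubmxK.
apply/kermx_subP/idP => [h|uB v vM]; last first.
  have := congr1 (mulmx^~ (col_mx 0 1%:M)) vM.
  rewrite mul0mx -mulmxA hmx_ltri2 mulmxA pr hmx_exp sub => vB.
  have uBn : hmx B psi ^+ (D + k) \in unitmx.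
    by elim: (D + k)%N => [|i IH]; rewrite ?unitmx1 // exprS unitmx_mul uB.
  by apply/eqP; apply: (can_inj (mulmxK uBn)); rewrite mul0mx.
rewrite -row_free_unit -kermx_eq0; apply/rowV0P => v2 /sub_kermxP v2B.
have [//|v2n0] := eqVneq v2 0.
have k0 : (0 < k)%N.
  rewrite lt0n; apply: contra v2n0 => /eqP k0; apply/eqP/rowP => -[j jk].
  by suff: False by []; move: (jk); rewrite k0.
have := h (row_mx 0 v2); rewrite sub row_mxKr => hv; apply/eqP; apply: hv.
set w := row_mx 0 v2 *m hmx M psi.
have w0 : rsubmx w = 0 by rewrite -pr -mulmxA hmx_ltri2 mulmxA pr row_mxKr.
have wE : w = lsubmx w *m row_mx 1%:M 0.
  by rewrite -{1}[w]hsubmxK w0 mul_mx_row mulmx1 mulmx0.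
(* One factor to enter the first block, D factors to vanish there, k - 1 to spare; this is where k >
   0 is used. *)
have -> : psi ^+ (D + k) = psi * (psi ^+ D * psi ^+ k.-1).
  by rewrite -exprD -exprS -addnS prednK.
rewrite hmxM mulmxA -/w hmxM mulmxA.
by rewrite wE -(mulmxA (lsubmx w)) hmx_ltri T0 mul0mx !mulmx0 mul0mx.
Qed.

Lemma sum_emb n (fs : seq {poly F}) : Tmx fs \in unitmx ->
  (\sum_(A : 'M[F]_n | A \in unitmx) #|emb fs A| =
   if dimT fs <= n then GLcard F n else 0)%N.
Proof.
move=> uT; case: leqP => [le|lt]; last first.
  rewrite big1 // => A _; apply: eq_card0 => X; rewrite inE; apply/negP => /andP[].
  by rewrite /row_free => /eqP rX; have := rank_leq_col X; rewrite rX leqNgt lt.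
rewrite -(subnKC le); move: (n - dimT fs)%N => k {n le}.
have := @count_pairs F _ k _ uT (fun _ _ => true) (fun _ _ _ _ => erefl).
under eq_bigr do under eq_finset do rewrite andbT.
set a := (\sum_(_ | _) _)%N; set b := #|_| => /eqP ab.
have bE : b = (#|F| ^ (k * dimT fs) * GLcard F k)%N.
  rewrite -card_mx -cardsT -cardsX; apply: eq_card => t.
  by rewrite !inE andbT.
move: ab; rewrite bE eqn_pmul2r => [/eqP <- //|].
by rewrite muln_gt0 GLcard_gt0 expn_gt0 -cardsT (cardD1 0) inE.
Qed.

Definition nofactor n (psi : {poly F}) :=
  #|[set B : 'M[F]_n | (B \in unitmx) && (hmx B psi \in unitmx)]|.

Lemma sum_full k psi (fs : seq {poly F}) : Tmx fs \in unitmx ->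
  hmx (Tmx fs) (psi ^+ dimT fs) = 0 ->
  ((\sum_(A : 'M[F]_(dimT fs + k) | A \in unitmx) #|[set X in emb fs A | full psi A X]|)
    * GLcard F k = GLcard F (dimT fs + k) * nofactor k psi)%N.
Proof.
move=> uT T0.
have := @count_pairs F _ k _ uT (@full _ _ psi) (fun g A X ug => full_conjE psi A X ug).
set b := #|[set t | _]|.
have bE : b = (#|F| ^ (k * dimT fs) * nofactor k psi)%N.
  rewrite -card_mx -cardsT -cardsX; apply: eq_card => t.
  by rewrite !inE full_ltri.
rewrite bE mulnCA [RHS]mulnCA => /eqP; rewrite eqn_pmul2l; last first.
  by rewrite expn_gt0 -cardsT (cardD1 0) inE.
move/eqP <-; congr (_ * _)%N; apply: eq_bigr => A _; apply: eq_card => X.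
by rewrite !inE -andbA.
Qed.

(* For psi the product of the distinct p in S and fs = blocks S L, this says that the p-primary
   component of A has type L p for all p in S. *)
Definition has_type n (psi : {poly F}) fs (A : 'M[F]_n) := [exists X in emb fs A, full psi A X].

Lemma row_free_dim n fs (A : 'M[F]_n) X : X \in emb fs A -> (dimT fs <= n)%N.
Proof.
rewrite inE => /andP[/eqP rX _]; have := rank_leq_col X.
by rewrite rX.
Qed.

(** All embeddings land in the primary component and have the same rank, so if one of them fills it,
    all do. *)
Lemma has_type_full n psi fs (A : 'M[F]_n) : hmx (Tmx fs) (psi ^+ dimT fs) = 0 ->
  has_type psi fs A -> forall X, X \in emb fs A -> full psi A X.
Proof.
move=> T0 /existsP[Y /andP[Ye Yf]] X Xe; apply: (submx_trans Yf).
have XK : (X <= kermx (hmx A (psi ^+ n)))%MS.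
  apply/sub_kermxP; move: (Xe); rewrite inE => /andP[_ /eqP XA].
  have -> : psi ^+ n = psi ^+ dimT fs * psi ^+ (n - dimT fs).
    by rewrite -exprD subnKC // (row_free_dim Xe).
  by rewrite (hmx_intertwine _ XA) hmxM T0 !mul0mx.
have XY : (X <= Y)%MS := submx_trans XK Yf.
move: (Xe) (Ye); rewrite !inE => /andP[/eqP rX _] /andP[/eqP rY _].
by have [_] := mxrank_leqif_sup XY; rewrite rX rY eqxx => <-.
Qed.

Lemma card_full n psi fs (A : 'M[F]_n) : hmx (Tmx fs) (psi ^+ dimT fs) = 0 ->
  #|[set X in emb fs A | full psi A X]| = (has_type psi fs A * #|emb fs A|)%N.
Proof.
move=> T0; case: (boolP (has_type psi fs A)) => [ty|nty]; last first.
  rewrite mul0n; apply: eq_card0 => X; rewrite inE; apply/negP => XP.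
  by case/negP: nty; apply/existsP; exists X.
rewrite mul1n; apply: eq_card => X; rewrite !inE; apply: andb_idr => Xe.
by apply: (has_type_full T0 ty); rewrite inE.
Qed.

(** For i <= n a vector killed by p^i is killed by psi^n, hence lies in the image of the embedding,
    which carries the torsion of the model module to that of A. *)
Lemma kcard_full n psi fs (A : 'M[F]_n) p i : has_type psi fs A -> p %| psi -> (i <= n)%N ->
  kcard A (p ^+ i) = kcard (Tmx fs) (p ^+ i).
Proof.
move=> /existsP[X /andP[]]; rewrite inE => /andP[fX /eqP XA] /kermx_subP Xf pp le.
have injX : injective (fun x : 'rV[F]_(dimT fs) => x *m X).
  by move=> x y; apply: row_free_inj.
rewrite /kcard -[RHS](card_imset _ injX); apply: eq_card => w; rewrite !inE.
apply/eqP/imsetP => [wp|[x + ->]].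
  have /submxP[x xE] : (w <= X)%MS.
    apply: Xf; apply: hmx_ker_dvd wp.
    by apply: (dvdp_trans (dvdp_exp2l p le)); apply: dvdp_exp2r.
  exists x => //; rewrite inE -(mulmx_eq0_free _ fX) -mulmxA.
  by rewrite -(hmx_intertwine _ XA) mulmxA -xE wp.
by rewrite inE => /eqP xp; rewrite -mulmxA (hmx_intertwine _ XA) mulmxA xp mul0mx.
Qed.

Lemma emb_conj n fs (g A : 'M[F]_n) X : g \in unitmx ->
  X \in emb fs A -> X *m g \in emb fs (invmx g *m A *m g).
Proof.
move=> ug; rewrite !inE => /andP[fX /eqP XA]; rewrite !mulmxA mulmxK // XA eqxx andbT.
by rewrite /row_free mxrankMfree // row_free_unit.
Qed.

Lemma has_type_conj n psi fs (g A : 'M[F]_n) : g \in unitmx ->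
  has_type psi fs (invmx g *m A *m g) = has_type psi fs A.
Proof.
move=> ug.
have H h B : h \in unitmx -> has_type psi fs B -> has_type psi fs (invmx h *m B *m h).
  move=> uh /existsP[X /andP[Xe Xf]]; apply/existsP; exists (X *m h).
  by rewrite emb_conj ?full_conj.
apply/idP/idP; last exact: H.
have ug' : invmx g \in unitmx by rewrite unitmx_inv.
by move/(H _ _ _ ug'); rewrite invmxK !mulmxA mulmxV // mul1mx mulmxK.
Qed.
End Types.

(** * Modules of prescribed type and their torsion *)

Section Blocks.
Variable F : finFieldType.

(** Partitions are decreasing; [rev] puts small exponents first, so that each block is adjoined to
    blocks of at least its exponent, as [good_block] demands. *)
Definition blocks (S : seq {poly F}) (L : {poly F} -> seq nat) : seq {poly F} :=
  flatten [seq [seq p ^+ e | e <- rev (L p)] | p <- S].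

Lemma coprime_monic_irred (p r : {poly F}) : p \is monic -> r \is monic ->
  irreducible_poly p -> irreducible_poly r -> p != r -> coprimep p r.
Proof.
move=> mp mr ip ir pr; apply: irredp_ndvd_coprime => //.
apply: contra pr => pdr; rewrite -eqp_monic //; case: ir => _; apply=> //.
by case: ip => + _; case: (size p) => [|[]].
Qed.

Lemma coprimeX_irred (p : {poly F}) : p \is monic -> irreducible_poly p -> p != 'X ->
  coprimep 'X p.
Proof.
move=> mp ip pX; apply: coprime_monic_irred; rewrite ?monicX 1?eq_sym //.
by rewrite -[X in irreducible_poly X]subr0 -polyC0; apply: irredp_XsubC.
Qed.

Lemma Tmx_unit (fs : seq {poly F}) :
  (forall f, f \in fs -> (1 < size f)%N /\ coprimep 'X f) -> Tmx fs \in unitmx.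
Proof.
elim: fs => [|f s IH] h /=; first by rewrite unitmxE det_mx00 unitr1.
rewrite unitmx_block_ltri IH ?andbT => [|g gs]; last by apply: h; rewrite inE gs orbT.
have [sf cop] := h f (mem_head _ _).
rewrite -row_free_unit -kermx_eq0; apply/rowV0P => y /sub_kermxP yC.
apply: (@comp_coprime0 _ _ 'X) cop _; last by rewrite hmxX.
by rewrite -size_poly_gt0 ltnW.
Qed.

Lemma Tmx_root (fs : seq {poly F}) g :
  (forall f, f \in fs -> f != 0 /\ f %| g) -> hmx (Tmx fs) g = 0.
Proof.
move=> h; apply/row_matrixP => i; rewrite rowE row0; move: (delta_mx _ _) => x {i}.
elim: fs h x => [|f s IH] h x; first by apply/rowP => -[].
rewrite -[x]hsubmxK /= hmx_block_diag IH; last by move=> k ks; apply: h; rewrite inE ks orbT.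
have [f0 fg] := h f (mem_head _ _).
suff /eqP -> : lsubmx x *m hmx (comp_mx f) g == 0 by rewrite row_mx0.
by rewrite hmx_comp_eq0 // dvdp_mull.
Qed.

Lemma kcard_Tmx (fs : seq {poly F}) h :
  kcard (Tmx fs) h = (\prod_(f <- fs) kcard (comp_mx f) h)%N.
Proof.
elim: fs => [|f s IH]; last by rewrite big_cons -IH /= kcard_row_mx.
rewrite big_nil; apply: etrans (cards1 (0 : 'rV[F]_0)); apply: eq_card => x.
by rewrite !inE; apply/eqP/eqP => _; apply/rowP => -[].
Qed.

Lemma mem_blocks S L f : f \in blocks S L ->
  exists p e, [/\ p \in S, e \in L p & f = p ^+ e].
Proof.
move/flattenP => [t /mapP[p pS ->]] /mapP[e eL ->].
by exists p, e; split; rewrite // -mem_rev.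
Qed.

Lemma dimT_blocks S L : dimT (blocks S L) = (\sum_(p <- S) (size p).-1 * sumn (L p))%N.
Proof.
rewrite dimTE big_flatten big_map; apply: eq_bigr => p _.
rewrite big_map; under eq_bigr do rewrite size_exp.
by rewrite -big_distrr sumnE /=; congr (_ * _)%N; apply: perm_big; rewrite perm_rev.
Qed.

Section Good.
Variables (S : seq {poly F}) (L : {poly F} -> seq nat).
Hypothesis gS : good_coll S.
Hypothesis pL : forall p, p \in S -> is_partition (L p).

Lemma good_irr p : p \in S -> irreducible_poly p.
Proof. by case: gS => _ h /h[]. Qed.

Lemma part_gt0 p e : p \in S -> e \in L p -> (0 < e)%N.
Proof. by move=> /pL /andP[_ /allP h] /h. Qed.

Lemma size_block p e : p \in S -> e \in L p -> (1 < size (p ^+ e)%R)%N.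
Proof.
move=> pS eL; rewrite -subn_gt0 subn1 size_exp muln_gt0 (part_gt0 pS eL) andbT.
by rewrite -subn1 subn_gt0; case: (good_irr pS).
Qed.

Lemma blocks_unit : Tmx (blocks S L) \in unitmx.
Proof.
apply: Tmx_unit => f /mem_blocks[p [e [pS eL ->]]]; split; first exact: size_block.
by apply: coprimep_expr; case: gS => _ /(_ p pS)[]; apply: coprimeX_irred.
Qed.

Lemma blocks_coprime p r : p \in S -> r \in S -> p != r -> coprimep p r.
Proof.
by case: gS => _ h /h[mp ip _] /h[mr ir _]; apply: coprime_monic_irred.
Qed.

Lemma part_le_dim p e : p \in S -> e \in L p -> (e <= dimT (blocks S L))%N.
Proof.
move=> pS eL; rewrite dimT_blocks (big_rem p) //=; apply: leq_trans (leq_addr _ _).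
have d0 : (0 < (size p).-1)%N by rewrite -subn1 subn_gt0; case: (good_irr pS).
apply: leq_trans (leq_pmull _ d0); rewrite sumnE (big_rem e) //=; exact: leq_addr.
Qed.

Lemma blocks_root : hmx (Tmx (blocks S L)) ((\prod_(p <- S) p) ^+ dimT (blocks S L)) = 0.
Proof.
apply: Tmx_root => f /mem_blocks[p [e [pS eL ->]]]; split.
  by rewrite -size_poly_gt0 ltnW // size_block.
apply: (dvdp_trans (dvdp_exp2l p (part_le_dim pS eL))); apply: dvdp_exp2r.
by rewrite (big_rem p) //= dvdp_mulr.
Qed.

Lemma kcard_blocks p i : p \in S ->
  kcard (Tmx (blocks S L)) (p ^+ i) = (#|F| ^ ((size p).-1 * \sum_(e <- L p) minn i e))%N.
Proof.
move=> pS; rewrite kcard_Tmx big_flatten big_map (big_rem p) //=.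
rewrite [X in (_ * X)%N]big_seq [X in (_ * X)%N]big1 => [|r rS].
  rewrite muln1 big_map; under eq_bigr do rewrite (kcard_comp_exp _ _ (good_irr pS)).
  rewrite -expn_sum -big_distrr /=; congr (_ ^ (_ * _))%N; apply: perm_big.
  by rewrite perm_rev.
rewrite big_map big_seq big1 // => e; rewrite mem_rev => eL.
have uS : uniq S by case: gS.
move: rS; rewrite mem_rem_uniq // inE => /andP[rp rS].
apply: kcard_comp_coprime; first by rewrite -size_poly_gt0 ltnW // size_block.
by apply: coprimep_expl; apply: coprimep_expr; apply: blocks_coprime; rewrite 1?eq_sym.
Qed.

End Good.

Section Count.
Variable R : numDomainType.

(** Here x e stands for the number of vectors killed by p^e. A factor counts the images of a
    generator of order p^e: from all x e candidates are removed those whose multiple by p^(e-1)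
    falls into the summands already placed, whose p-torsion has Q^(size r') elements. *)
Fixpoint emb_count (Q : R) (x : nat -> R) (r : seq nat) : R :=
  if r is e :: r' then (x e - x e.-1 * Q ^+ size r') * emb_count Q x r' else 1.

Lemma card_emb_pblocks n (A : 'M[F]_n) (p : {poly F}) r (fs : seq {poly F}) :
  irreducible_poly p -> sorted leq r -> all (fun e => 0 < e)%N r ->
  (forall f, f \in fs -> (1 < size f)%N /\ coprimep p f) ->
  #|emb ([seq p ^+ e | e <- r] ++ fs) A|%:R =
  emb_count (#|F|%:R ^+ (size p).-1) (fun e => (kcard A (p ^+ e))%:R) r * #|emb fs A|%:R :> R.
Proof.
move=> ip; elim: r => [|e r IH] sr rpos copfs /=; first by rewrite mul1r.
move: rpos => /= /andP[e0 rpos].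
have gb f : f \in [seq p ^+ e | e <- r] ++ fs -> good_block p e f.
  rewrite mem_cat => /orP[/mapP[e' er ->]|/copfs[sf cop]]; last by split=> //; left.
  have le : (e <= e')%N.
    by move: sr; rewrite /= path_sortedE => [/andP[/allP /(_ _ er)]|]; last exact: leq_trans.
  split; last by right; exists e'.
  rewrite -subn_gt0 subn1 size_exp muln_gt0 (leq_trans e0 le) andbT.
  by rewrite -subn1 subn_gt0; case: ip.
have := congr1 (GRing.natmul (1 : R)) (card_emb_exp A ip e0 gb).
rewrite natrD !natrM => /(canRL (addrK _)) ->; rewrite -mulrBr.
rewrite IH ?(path_sorted sr) // -mulrA mulrC; congr (_ * _); congr (_ - _ * _).
rewrite -exprM -natrX; congr (_%:R).
rewrite kcard_Tmx big_cat /= [X in (_ * X)%N]big_seq [X in (_ * X)%N]big1 => [|f /copfs[sf cop]].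
  rewrite muln1 big_map; transitivity (\prod_(e' <- r) #|F| ^ (size p).-1)%N.
    apply: eq_big_seq => e' er; rewrite -[X in kcard _ X]expr1 kcard_comp_exp //.
    by rewrite (minn_idPl _) ?muln1 //; apply: (allP rpos).
  by rewrite big_const_seq count_predT iter_muln_1 -expnM.
by apply: kcard_comp_coprime => //; rewrite -size_poly_gt0 ltnW.
Qed.
End Count.
End Blocks.

Lemma eq_emb_count (R : numDomainType) (Q : R) x y r :
  {in r, x =1 y} -> {in r, forall e, x e.-1 = y e.-1} -> emb_count Q x r = emb_count Q y r.
Proof.
elim: r => //= e r IH xy xy1; rewrite xy ?mem_head // xy1 ?mem_head // IH //.
  by move=> f fr; apply: xy; rewrite inE fr orbT.
by move=> f fr; apply: xy1; rewrite inE fr orbT.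
Qed.

(** With all exponents 1 this counts the linearly independent k-tuples in the kernel of p(A), viewed
    as a vector space over the field F['X]/(p) of Q elements. *)
Lemma emb_count_nseq1 (R : numDomainType) (Q : R) x k :
  x 0%N = 1 -> emb_count Q x (nseq k 1%N) = \prod_(i < k) (x 1%N - Q ^+ i).
Proof.
move=> x0; elim: k => [|k IH]; first by rewrite big_ord0.
by rewrite big_ord_recr /= IH size_nseq x0 mul1r mulrC.
Qed.

(** * Random invertible matrices *)

Section GLLaw.
Variables (F : finFieldType) (R : realFieldType).

Local Notation Qp p := ((#|F|%:R : R) ^+ (size p).-1).

Lemma card_field_gt1 : (1 < #|F|)%N.
Proof. exact: finNzRing_gt1. Qed.

Lemma Qp_gt1 (p : {poly F}) : irreducible_poly p -> 1 < Qp p.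
Proof.
by case=> sp _; rewrite exprn_egt1 ?ltr1n ?card_field_gt1 // -lt0n -subn1 subn_gt0.
Qed.

Lemma good_coll_cons (p : {poly F}) S : good_coll (p :: S) ->
  [/\ good_coll S, p \notin S & irreducible_poly p].
Proof.
case=> /= /andP[pS uS] h; split=> //; last by have [] := h p (mem_head _ _).
by split=> // r rS; apply: h; rewrite inE rS orbT.
Qed.

Lemma rev_partition l : is_partition l ->
  sorted leq (rev l) /\ all (fun e => 0 < e)%N (rev l).
Proof. by move=> /andP[sl pl]; rewrite all_rev rev_sorted. Qed.

Lemma card_emb_nil n (A : 'M[F]_n) : #|emb [::] A| = 1%N.
Proof.
apply: etrans (cards1 (0 : 'M[F]_(0, n))); apply: eq_card => X.
by rewrite !inE [X]flatmx0 /row_free mxrank0 mul0mx mulmx0 !eqxx.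
Qed.

Lemma card_emb_blocks n (A : 'M[F]_n) S L : good_coll S ->
  (forall p, p \in S -> is_partition (L p)) ->
  #|emb (blocks S L) A|%:R =
  \prod_(p <- S) emb_count (Qp p) (fun e => (kcard A (p ^+ e))%:R) (rev (L p)).
Proof.
elim: S => [|p S IH] gS pL.
  by rewrite big_nil; apply: (congr1 (fun k => k%:R) (card_emb_nil A)).
have [gS' pS ip] := good_coll_cons gS.
have pL' r : r \in S -> is_partition (L r) by move=> rS; apply: pL; rewrite inE rS orbT.
rewrite big_cons -IH // /blocks /=.
have [sr ar] := rev_partition (pL p (mem_head _ _)).
apply: card_emb_pblocks => // f /mem_blocks[r [e [rS eL ->]]].
split; first exact: (size_block gS' pL').
apply: coprimep_expr; apply: (blocks_coprime gS); rewrite ?mem_head ?inE ?rS ?orbT //.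
by apply: contraNneq pS => ->.
Qed.

Definition EGL n (f : 'M[F]_n -> R) : R :=
  (\sum_(A : 'M[F]_n | A \in unitmx) f A) / (GLcard F n)%:R.

Lemma EGL_sum n (I : Type) (r : seq I) P (f : I -> 'M[F]_n -> R) :
  EGL (fun A => \sum_(i <- r | P i) f i A) = \sum_(i <- r | P i) EGL (f i).
Proof. by rewrite /EGL exchange_big mulr_suml. Qed.

Lemma EGLZ n c (f : 'M[F]_n -> R) : EGL (fun A => c * f A) = c * EGL f.
Proof. by rewrite /EGL -mulr_sumr mulrA. Qed.

Lemma eq_EGL n (f g : 'M[F]_n -> R) : (forall A, A \in unitmx -> f A = g A) -> EGL f = EGL g.
Proof. by move=> fg; rewrite /EGL; congr (_ / _); apply: eq_bigr. Qed.

Lemma GLcard_neq0 n : (GLcard F n)%:R != 0 :> R.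
Proof. by rewrite pnatr_eq0 -lt0n GLcard_gt0. Qed.

Lemma EGL_blocks n S L : good_coll S -> (forall p, p \in S -> is_partition (L p)) ->
  EGL (fun A : 'M[F]_n => #|emb (blocks S L) A|%:R) = (dimT (blocks S L) <= n)%:R.
Proof.
move=> gS pL; rewrite /EGL -natr_sum sum_emb ?blocks_unit //.
by case: leqP => _; rewrite ?mul0r // divff // GLcard_neq0.
Qed.

(** The coefficient of x^k in Euler's expansion of prod_(r >= 1) (1 - x/Q^r), written without signs;
    the same numbers invert the counts of independent tuples. *)
Definition bcoef (Q : R) k : R := \prod_(j < k) (1 - Q ^+ j.+1)^-1.

(* The partial sums telescope to a product that vanishes at Q, Q^2, ..., Q^K. *)
Lemma bcoef_tele Q x K : 1 < Q ->
  \sum_(k < K.+1) bcoef Q k * \prod_(i < k) (x - Q ^+ i) =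
  \prod_(i < K) ((x - Q ^+ i.+1) / (1 - Q ^+ i.+1)).
Proof.
move=> Q1; elim: K => [|K IH]; first by rewrite big_ord1 /bcoef !big_ord0 mulr1.
rewrite big_ord_recr [RHS]big_ord_recr IH /= {1}/bcoef big_ord_recr /=.
rewrite [X in _ + _ * X]big_ord_recl expr0 big_split /= -/(bcoef Q K).
have nz : 1 - Q ^+ K.+1 != 0 by rewrite subr_eq0 eq_sym gt_eqF // exprn_egt1.
rewrite /bump /=; under [X in _ * ((x - 1) * X)]eq_bigr do rewrite add1n.
move: (\prod_(i < K) _) (bcoef Q K) => a b; field.
exact: nz.
Qed.

Lemma bcoef_ind Q r K : 1 < Q -> (r <= K)%N ->
  \sum_(k < K.+1) bcoef Q k * \prod_(i < k) (Q ^+ r - Q ^+ i) = (r == 0%N)%:R.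
Proof.
move=> Q1 rK; rewrite bcoef_tele //; case: r rK => [|r] rK.
  rewrite big1 // => i _; rewrite expr0 divff //.
  by rewrite subr_eq0 eq_sym gt_eqF // exprn_egt1.
by rewrite (bigD1 (Ordinal rK)) //= subrr !mul0r.
Qed.

Lemma kcard0 n (A : 'M[F]_n) (p : {poly F}) : kcard A (p ^+ 0) = 1%N.
Proof.
apply: etrans (cards1 (0 : 'rV[F]_n)); apply: eq_card => x.
by rewrite !inE expr0 hmx1 mulmx1.
Qed.

(* There is no room for n + 1 copies of F['X]/(p) in F^n, so the count of such embeddings,
   a product of the factors kcard A p - Q^i, vanishes. *)
Lemma kcard_pow n (A : 'M[F]_n) (p : {poly F}) : irreducible_poly p ->
  exists2 r, (r <= n)%N & (kcard A p = (#|F| ^ (size p).-1) ^ r)%N.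
Proof.
move=> ip; pose fs := [seq p ^+ e | e <- nseq n.+1 1%N] ++ [::].
have fs0 : #|emb fs A| = 0%N.
  apply: eq_card0 => X; apply/negP => /row_free_dim; rewrite /fs cats0 dimTE big_map.
  rewrite big_nseq iter_addn_0 expr1 leqNgt => /negP; apply.
  by rewrite mulnC leq_pmulr // -subn1 subn_gt0; case: ip.
have sn m : sorted leq (nseq m 1%N) by elim: m => [|[|m]].
have an : all (fun e => 0 < e)%N (nseq n.+1 1%N) by rewrite all_nseq orbT.
have := @card_emb_pblocks F R n A p (nseq n.+1 1%N) [::] ip (sn _) an (fun f h => ltac:(by [])).
rewrite -/fs fs0 emb_count_nseq1 ?kcard0 // => /esym/eqP.
rewrite card_emb_nil mulr1 prodf_seq_eq0 => /hasP[i _ /=].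
rewrite subr_eq0 expr1 -exprM -natrX eqr_nat => /eqP ->.
by exists i; [rewrite -ltnS ltn_ord | exact: expnM].
Qed.

Lemma kcard_unit n (A : 'M[F]_n) p : (kcard A p == 1%N) = (hmx A p \in unitmx).
Proof.
rewrite -row_free_unit -kermx_eq0; apply/eqP/eqP => [c1|k0].
  apply/eqP/rowV0P => v /sub_kermxP vp; apply/eqP; have /eqP/cards1P[x xE] := c1.
  have : v \in [set v : 'rV_n | v *m hmx A p == 0] by rewrite inE vp.
  have : 0 \in [set v : 'rV_n | v *m hmx A p == 0] by rewrite inE mul0mx.
  by rewrite xE !inE => /eqP ->.
apply: etrans (cards1 (0 : 'rV[F]_n)); apply: eq_card => x; rewrite !inE.
apply/eqP/eqP => [xp|->]; last by rewrite mul0mx.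
by apply/eqP; rewrite -submx0 -k0; apply/sub_kermxP.
Qed.

Lemma hmx_prod_unit n (A : 'M[F]_n) S :
  (hmx A (\prod_(p <- S) p) \in unitmx) = all (fun p => kcard A p == 1%N) S.
Proof.
elim: S => [|p S IH]; first by rewrite big_nil hmx1 unitmx1.
by rewrite big_cons hmxM unitmx_mul IH /= kcard_unit.
Qed.

(* The probability that p(A) is invertible for all p in S, for A uniform in GL_n
   ([nofactor_probP]): inclusion-exclusion over the number of embedded copies of F['X]/(p). *)
Fixpoint nofactor_prob (S : seq {poly F}) (n : nat) : R :=
  if S is p :: S' then
    \sum_(k < n.+1 | ((size p).-1 * k <= n)%N)
      bcoef (Qp p) k * nofactor_prob S' (n - (size p).-1 * k)
  else 1.

(** Invertibility of p(A) becomes a linear combination of embedding counts, whose means are known.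
    Stopping at k = n is exact because the kernel has dimension at most n over F['X]/(p). *)
Lemma kcard_ind n (A : 'M[F]_n) (p : {poly F}) : irreducible_poly p ->
  (kcard A p == 1%N)%:R = \sum_(k < n.+1)
    bcoef (Qp p) k * emb_count (Qp p) (fun e => (kcard A (p ^+ e))%:R) (nseq k 1%N).
Proof.
move=> ip; have [r rn rE] := kcard_pow A ip.
under eq_bigr do rewrite emb_count_nseq1 ?kcard0 // expr1 rE !natrX.
rewrite bcoef_ind ?Qp_gt1 // rE; congr (_%:R).
case: r rn rE => [|r] _ _ //; rewrite gtn_eqF //.
rewrite -expnM -[ltnLHS](exp1n ((size p).-1 * r.+1)) ltn_exp2r ?card_field_gt1 //.
by rewrite muln_gt0 /= -subn1 subn_gt0; case: ip => ->.
Qed.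

(** The prescribed types on [S0] are what makes the induction on S work: [kcard_ind] trades the
    condition at p for embeddings of k copies of F['X]/(p), so p moves to [S0] with the partition
    1^k. *)
Lemma EGL_nofactor_prob n S0 S L : good_coll (S0 ++ S) ->
  (forall p, p \in S0 -> is_partition (L p)) ->
  EGL (fun A : 'M[F]_n => #|emb (blocks S0 L) A|%:R *
        (all (fun p => kcard A p == 1%N) S)%:R) =
  if (dimT (blocks S0 L) <= n)%N then nofactor_prob S (n - dimT (blocks S0 L)) else 0.
Proof.
elim: S S0 L => [|p S IH] S0 L gS pL.
  under eq_EGL => A _ do rewrite mulr1.
  by move: gS; rewrite cats0 => gS; rewrite EGL_blocks //; case: leqP.
have [uS hS] := gS.
have pS0 : p \notin S0.
  by move: uS; rewrite cat_uniq => /and3P[_ /hasPn /(_ p (mem_head _ _))].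
have ip : irreducible_poly p by have [] := hS p; rewrite // mem_cat mem_head orbT.
pose Lk k := fun r => if r == p then nseq k 1%N else L r.
have gS' : good_coll ((p :: S0) ++ S).
  have pm : perm_eq ((p :: S0) ++ S) (S0 ++ p :: S).
    by rewrite perm_sym -cat1s perm_catCA.
  by split; [rewrite (perm_uniq pm)|move=> r; rewrite (perm_mem pm); apply: hS].
have gS0 : good_coll (p :: S0).
  split; first by move: gS'.1; rewrite cat_uniq => /and3P[].
  by move=> r rS; apply: gS'.2; rewrite mem_cat rS.
have sn m : sorted geq (nseq m 1%N) by elim: m => [|[|m]].
have pLk k r : r \in p :: S0 -> is_partition (Lk k r).
  rewrite inE /Lk; case: eqVneq => [_ _|_ /= rS]; last exact: pL.
  by rewrite /is_partition sn all_nseq orbT.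
have eqL k : blocks S0 (Lk k) = blocks S0 L.
  congr flatten; apply/eq_in_map => r rS; rewrite /Lk; case: eqVneq => // rp.
  by move: pS0; rewrite -rp rS.
have step (A : 'M[F]_n) : #|emb (blocks S0 L) A|%:R *
        (all (fun p => kcard A p == 1%N) (p :: S))%:R =
   \sum_(k < n.+1) bcoef (Qp p) k * (#|emb (blocks (p :: S0) (Lk k)) A|%:R *
        (all (fun p => kcard A p == 1%N) S)%:R) :> R.
  rewrite /= -mulnb natrM kcard_ind // mulrA mulr_sumr mulr_suml.
  apply: eq_bigr => k _; rewrite (card_emb_blocks A gS0 (pLk k)) big_cons.
  have [gS0' _ _] := good_coll_cons gS0.
  have pLk' r : r \in S0 -> is_partition (Lk k r).
    by move=> rS; apply: pLk; rewrite inE rS orbT.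
  rewrite -(card_emb_blocks A gS0' pLk') eqL /Lk eqxx rev_nseq.
  by rewrite -!mulrA mulrCA; congr (_ * _); rewrite mulrCA.
rewrite (eq_EGL (fun A _ => step A)) EGL_sum.
under eq_bigr => k _ do rewrite EGLZ (IH (p :: S0) (Lk k) gS' (pLk k)).
have dE k : dimT (blocks (p :: S0) (Lk k)) = ((size p).-1 * k + dimT (blocks S0 L))%N.
  rewrite -(eqL k) !dimT_blocks big_cons; congr (_ * _ + _)%N.
  by rewrite /Lk eqxx sumn_nseq mul1n.
set D := dimT (blocks S0 L).
have d0 : (0 < (size p).-1)%N by rewrite -subn1 subn_gt0; case: ip.
case: leqP => [Dn|nD]; last first.
  rewrite big1 // => k _; rewrite dE leqNgt (leq_trans nD) ?leq_addl //=.
  by rewrite mulr0.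
rewrite /= (big_ord_widen_cond n.+1 (fun k => ((size p).-1 * k <= n - D)%N)
   (fun k => bcoef (Qp p) k * nofactor_prob S (n - D - (size p).-1 * k))) ?ltnS ?leq_subr //.
rewrite [RHS]big_mkcond; apply: eq_bigr => k _; rewrite dE -/D.
have -> : ((size p).-1 * k + D <= n)%N = ((size p).-1 * k <= n - D)%N by lia.
case: (leqP ((size p).-1 * k) (n - D)) => h; last by rewrite mulr0.
have -> : (k < (n - D).+1)%N by rewrite ltnS (leq_trans _ h) // leq_pmull.
by congr (_ * nofactor_prob S _); lia.
Qed.

Lemma nofactor_probP n S : good_coll S ->
  (nofactor n (\prod_(p <- S) p))%:R / (GLcard F n)%:R = nofactor_prob S n :> R.
Proof.
move=> gS; have := @EGL_nofactor_prob n [::] S (fun _ => [::]) gS (fun p (h : p \in [::]) => isT).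
rewrite /= subn0 => <-; rewrite /EGL /nofactor -sum1dep_card natr_sum big_mkcondr /=.
congr (_ / _); apply: eq_bigr => A uA; rewrite hmx_prod_unit.
rewrite (_ : #|_|%:R = 1) ?mul1r; first by case: all.
exact: (congr1 (fun k => k%:R) (card_emb_nil A)).
Qed.

Lemma nofactor_prob_bound n S : good_coll S -> 0 <= nofactor_prob S n <= 1.
Proof.
move=> gS; rewrite -nofactor_probP // divr_ge0 ?ler0n //=.
rewrite ler_pdivrMr ?ltr0n ?GLcard_gt0 // mul1r ler_nat.
by apply: subset_leq_card; apply/fintype.subsetP => A; rewrite !inE => /andP[].
Qed.

(** The number of embeddings of the model module in itself: the torsion counts of [kcard_blocks] are
    inserted in [emb_count]. *)
Definition cent_size (S : seq {poly F}) (L : {poly F} -> seq nat) : R :=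
  \prod_(p <- S) emb_count (Qp p) (fun i => Qp p ^+ (\sum_(e <- L p) minn i e)) (rev (L p)).

(** On the event the number of embeddings is the constant [cent_size], and all of them fill the
    primary component; off the event none does. So the count in [sum_full] is this constant times
    the number of matrices of the given type. *)
Lemma EGL_has_type n S L : good_coll S -> (forall p, p \in S -> is_partition (L p)) ->
  EGL (fun A : 'M[F]_n => (has_type (\prod_(p <- S) p) (blocks S L) A)%:R) * cent_size S L =
  if (dimT (blocks S L) <= n)%N then nofactor_prob S (n - dimT (blocks S L)) else 0.
Proof.
move=> gS pL; case: leqP => [|lt]; last first.
  rewrite /EGL big1 ?mul0r // => A _.
  case: (boolP (has_type _ _ _)) => // /existsP[X /andP[/row_free_dim]].
  by rewrite leqNgt lt.
have ce (A : 'M[F]_n) : has_type (\prod_(p <- S) p) (blocks S L) A ->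
    #|emb (blocks S L) A|%:R = cent_size S L.
  move=> ty; rewrite card_emb_blocks // /cent_size; apply: eq_big_seq => p pS.
  have Dn : (dimT (blocks S L) <= n)%N.
    by case/existsP: ty => X /andP[/row_free_dim].
  have kE i : (i <= n)%N -> (kcard A (p ^+ i))%:R = Qp p ^+ (\sum_(e <- L p) minn i e) :> R.
    move=> le; rewrite (kcard_full ty) ?(kcard_blocks gS pL) //.
      by rewrite -exprM natrX.
    by rewrite (big_rem p) //= dvdp_mulr.
  by apply: eq_emb_count => e; rewrite mem_rev => eL; apply: kE;
    have := leq_trans (part_le_dim gS pS eL) Dn; lia.
move=> /subnKC; move: (n - _)%N => k nE; subst n.
rewrite -nofactor_probP //.
have := sum_full k (blocks_unit gS pL) (blocks_root gS pL).
rewrite (eq_bigr _ (fun A _ => card_full A (blocks_root gS pL))).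
move/(congr1 (GRing.natmul (1 : R))); rewrite !natrM natr_sum => e.
rewrite /EGL mulrAC mulr_suml.
apply: (mulIf (GLcard_neq0 k)); rewrite divfK ?GLcard_neq0 //.
apply: (mulIf (GLcard_neq0 (dimT (blocks S L) + k))).
rewrite mulrAC divfK ?GLcard_neq0 // [RHS]mulrC -e; congr (_ * _).
apply: eq_bigr => A _; rewrite natrM; case: (boolP (has_type _ _ A)) => [/ce ->|_] //.
by rewrite !mul0r.
Qed.

End GLLaw.

(** * Self-embeddings and the denominators of the limit laws *)

Section CentralizerSize.
Variable R : realType.
Implicit Types (Q : R) (l : seq nat).

Lemma emb_count_prod Q x (r : seq nat) : emb_count Q x r =
  \prod_(j < size r) (x (nth 0%N r j) - x (nth 0%N r j).-1 * Q ^+ (size r - j.+1)).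
Proof.
elim: r => [|e r IH]; first by rewrite big_ord0.
by rewrite /= big_ord_recl /= IH subn1.
Qed.

Lemma emb_count_rev Q x l : emb_count Q x (rev l) =
  \prod_(j < size l) (x (nth 0%N l j) - x (nth 0%N l j).-1 * Q ^+ j).
Proof.
rewrite emb_count_prod size_rev (reindex_inj rev_ord_inj) /=; apply: eq_bigr => j _.
have jl : (size l - j.+1 < size l)%N by rewrite ltn_subrL (leq_trans _ (ltn_ord j)).
rewrite nth_rev ?jl //.
have -> : (size l - (size l - j.+1).+1 = j)%N by have := ltn_ord j; lia.
by [].
Qed.

Lemma minn_pred e a : (0 < e)%N -> minn e a = (minn e.-1 a + (e <= a))%N.
Proof. by move=> e0; case: (leqP e a) => h; rewrite ?addn1 ?addn0; lia. Qed.

Lemma sum_minn_pred l e : (0 < e)%N ->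
  (\sum_(a <- l) minn e a = \sum_(a <- l) minn e.-1 a + pconj l e)%N.
Proof.
move=> e0; rewrite /pconj -sum1_count [X in (_ + X)%N]big_mkcond -big_split.
apply: eq_bigr => a _; rewrite minn_pred //=.
Qed.

Lemma minn_sum N a b : (a <= N)%N ->
  minn a b = (\sum_(1 <= t < N.+1) (t <= a) * (t <= b))%N.
Proof.
elim: N a => [|N IH] a aN.
  by rewrite big_geq //; move: aN; rewrite leqn0 => /eqP ->; rewrite min0n.
rewrite big_nat_recr //=; case: (leqP a N) => aN1; first by rewrite mul0n addn0 -IH.
have -> : a = N.+1 by apply/eqP; rewrite eqn_leq aN.
rewrite minn_pred //= (IH N) // mul1n; congr (_ + _)%N.
by apply: eq_big_nat => t /andP[_ tN]; rewrite -ltnS tN (ltnW tN).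
Qed.

Lemma pconjE l t : pconj l t = (\sum_(e <- l) (t <= e))%N.
Proof.
by rewrite /pconj -sum1_count big_mkcond; apply: eq_bigr => e _; case: leqP.
Qed.

(** The parts equal to t sit at the last m_t positions j below lambda'_t, so their factors are 1 -
    Q^-1, ..., 1 - Q^(-m_t). In the induction, prepending a largest part raises both j and lambda'
    by one at all other parts, and the ratios stay the same. *)
Lemma prod_qpoch Q l N : Q != 0 -> sorted geq l -> all (fun a => 0 < a <= N)%N l ->
  \prod_(j < size l) (1 - Q ^+ j / Q ^+ pconj l (nth 0%N l j)) =
  \prod_(1 <= t < N.+1) qpoch Q (pmult l t).
Proof.
move=> Q0; elim: l => [|e l IH] sl al.
  by rewrite big_ord0 big1 // => t _; rewrite /qpoch /pmult /= big_geq.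
have tr : transitive geq by move=> a b c /= ab bc; apply: leq_trans bc ab.
move: (sl); rewrite /= path_sortedE // => /andP[/allP le _].
move: al => /= /andP[/andP[e0 eN] al].
rewrite big_ord_recl /= expr0.
have -> : \prod_(i < size l) (1 - Q ^+ bump 0 i / Q ^+ pconj (e :: l) (nth 0%N l i)) =
  \prod_(i < size l) (1 - Q ^+ i / Q ^+ pconj l (nth 0%N l i)).
  apply: eq_bigr => i _; rewrite {1}/pconj /= -/(pconj l _).
  have -> : (nth 0%N l i <= e)%N by apply: le; apply: mem_nth.
  by rewrite add1n !exprS -mulf_div divff // mul1r.
rewrite IH ?(path_sorted sl) //.
have ein : e \in index_iota 1 N.+1 by rewrite mem_index_iota e0 ltnS.
rewrite (bigD1_seq e) ?iota_uniq //= [RHS](bigD1_seq e) ?iota_uniq //= mulrA.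
congr (_ * _); last first.
  by apply: eq_bigr => t te; rewrite /pmult /= eq_sym (negPf te).
rewrite /pmult /= eqxx add1n {2}/qpoch big_nat_recr //= -/(qpoch _ _) mulrC.
rewrite /pconj /= leqnn add1n mul1r; congr (_ * (1 - (Q ^+ _.+1)^-1)).
by apply: eq_in_count => a /le /=; rewrite eqn_leq => ->.
Qed.

(** Passing from e to e - 1 lowers the sum of the minima by lambda'_e, so each factor is a power of
    Q times 1 - Q^(j - lambda'_e); the latter give the [qpoch] factors. *)
Lemma emb_count_pdenom Q l : 0 < Q -> is_partition l ->
  emb_count Q (fun i => Q ^+ (\sum_(e <- l) minn i e)) (rev l) = pdenom Q l.
Proof.
move=> Q0 pl; have Qn : Q != 0 by rewrite gt_eqF.
have /andP[sl /allP lpos] := pl.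
have lN a : a \in l -> (a <= psize l)%N.
  by move=> al; rewrite /psize sumnE (big_rem a) //= leq_addr.
rewrite emb_count_rev /pdenom big_split /= -(prod_qpoch Qn sl); last first.
  by apply/allP => a al; rewrite lpos ?lN.
transitivity (\prod_(j < size l) (Q ^+ (\sum_(e <- l) minn (nth 0%N l j) e) *
   (1 - Q ^+ j / Q ^+ pconj l (nth 0%N l j)))).
  apply: eq_bigr => j _; rewrite mulrBr mulr1; congr (_ - _).
  rewrite [in RHS]sum_minn_pred; last by rewrite lpos ?mem_nth.
  rewrite exprD -mulrA; congr (_ * _).
  by rewrite mulrCA divff ?mulr1 // expf_neq0.
rewrite big_split /= !prodrXr; congr (_ ^+ _ * _).
(* The exponent is the sum of min(a, e) over all pairs of parts; writing min(a, e) as the number of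
   t below both turns it into the sum of the squares of the lambda'_t. *)
transitivity (\sum_(a <- l) \sum_(e <- l) minn a e)%N.
  by rewrite [RHS](big_nth 0%N) big_mkord.
transitivity (\sum_(a <- l) \sum_(e <- l) \sum_(1 <= t < (psize l).+1) (t <= a) * (t <= e))%N.
  by apply: eq_big_seq => a al; apply: eq_bigr => e _; apply/minn_sum/lN.
transitivity (\sum_(a <- l) \sum_(1 <= t < (psize l).+1) (t <= a) * pconj l t)%N.
  apply: eq_bigr => a _; rewrite exchange_big; apply: eq_bigr => t _ /=.
  by rewrite -big_distrr pconjE.
rewrite exchange_big; apply: eq_bigr => t _ /=.
by rewrite -big_distrl -mulnn pconjE.
Qed.

Lemma qpoch_gt0 Q i : 1 < Q -> 0 < qpoch Q i.
Proof.
move=> Q1; rewrite /qpoch big_seq prodr_gt0 // => j.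
rewrite mem_index_iota => /andP[j0 _]; rewrite subr_gt0 invf_lt1.
  by rewrite exprn_egt1 // -lt0n.
by rewrite exprn_gt0 // (lt_trans ltr01).
Qed.

Lemma pdenom_gt0 Q l : 1 < Q -> 0 < pdenom Q l.
Proof.
move=> Q1; rewrite /pdenom prodr_gt0 // => i _.
by rewrite mulr_gt0 ?qpoch_gt0 // exprn_gt0 // (lt_trans ltr01).
Qed.
End CentralizerSize.

(** * Limits and Abel means *)

Section Mean.
Local Open Scope classical_set_scope.
Variable R : realType.
Implicit Types (u l a b : R) (f g h : nat -> R).

Definition abel_sum u h (N : nat) : R := \sum_(n < N) (1 - u) * u ^+ n * h n.

(* Abel mean for u < 1, limit for u = 1: the two kinds of statements of the theorem share all
   the properties of this averaging operation that are used. *)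
Definition mean u h l : Prop :=
  (u = 1 /\ h @ \oo --> l) \/ (0 < u < 1 /\ abel_sum u h @ \oo --> l).

Definition mean_param u : Prop := u = 1 \/ 0 < u < 1.

Lemma mean_paramW u h l : mean u h l -> mean_param u.
Proof. by case=> -[? _]; [left|right]. Qed.

Lemma mean_param01 u : mean_param u -> 0 < u <= 1.
Proof. by case=> [->|/andP[u0 u1]]; [rewrite ltr01 lexx | rewrite u0 ltW]. Qed.

Lemma abel_sumD u c f g N :
  abel_sum u (fun n => c * f n + g n) N = c * abel_sum u f N + abel_sum u g N.
Proof.
rewrite /abel_sum mulr_sumr -big_split; apply: eq_bigr => n _ /=.
by rewrite mulrDr mulrCA.
Qed.

Lemma mean_linear u c f g a b : mean u f a -> mean u g b ->
  mean u (fun n => c * f n + g n) (c * a + b).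
Proof.
case=> -[uE fa] [[uE' gb]|[uE' gb]].
- by left; split=> //; apply: cvgD => //; apply: cvgMr.
- by move: uE'; rewrite uE ltxx andbF.
- by move: uE; rewrite uE' ltxx andbF.
right; split=> //.
rewrite (_ : abel_sum _ _ = fun N => c * abel_sum u f N + abel_sum u g N); last first.
  by apply/funext => N; rewrite abel_sumD.
by apply: cvgD => //; apply: cvgMr.
Qed.

Lemma eq_mean u f g l : f =1 g -> mean u f l -> mean u g l.
Proof. by move=> /funext ->. Qed.

Lemma mean0 u : mean_param u -> mean u (fun=> 0) 0.
Proof.
case=> u1; [left|right]; split=> //; first exact: cvg_cst.
rewrite (_ : abel_sum _ _ = fun=> 0); first exact: cvg_cst.
by apply/funext => N; rewrite /abel_sum big1 // => i _; rewrite mulr0.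
Qed.

Lemma meanZ u c f a : mean u f a -> mean u (fun n => c * f n) (c * a).
Proof.
move=> fa; rewrite -[c * a]addr0; apply: eq_mean (mean_linear c fa (mean0 (mean_paramW fa))).
by move=> n; rewrite addr0.
Qed.

Lemma mean_sum u (I : Type) (r : seq I) (P : pred I) (c : I -> R) (f : I -> nat -> R) (a : I -> R) :
  mean_param u -> (forall i, P i -> mean u (f i) (a i)) ->
  mean u (fun n => \sum_(i <- r | P i) c i * f i n) (\sum_(i <- r | P i) c i * a i).
Proof.
move=> up fa; elim: r => [|i r IH].
  by rewrite big_nil; apply: eq_mean (mean0 up) => n; rewrite big_nil.
rewrite big_cons; case: ifPn => Pi; last first.
  by apply: eq_mean IH => n; rewrite big_cons (negPf Pi).
by apply: eq_mean (mean_linear (c i) (fa i Pi) IH) => n; rewrite big_cons Pi.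
Qed.

Lemma sum_geom u N : u != 1 -> \sum_(n < N) (1 - u) * u ^+ n = 1 - u ^+ N.
Proof.
move=> u1; elim: N => [|N IH]; first by rewrite big_ord0 expr0 subrr.
by rewrite big_ord_recr IH /= exprS; ring.
Qed.

Lemma mean1 u : mean_param u -> mean u (fun=> 1) 1.
Proof.
case=> u1; [left|right]; split=> //; first exact: cvg_cst.
rewrite (_ : abel_sum _ _ = fun N => 1 - u ^+ N); last first.
  apply/funext => N; rewrite -sum_geom; first by apply: eq_bigr => i _; rewrite mulr1.
  by case/andP: u1 => _ /lt_eqF ->.
rewrite -[X in _ --> X]subr0; apply: cvgB; first exact: cvg_cst.
by apply: cvg_expr; case/andP: u1 => u0 u1; rewrite gtr0_norm.
Qed.

Definition delay d h (n : nat) : R := if (d <= n)%N then h (n - d)%N else 0.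

Lemma delayS d h n : delay d.+1 h n = delay 1 (delay d h) n.
Proof.
rewrite /delay; case: n => [|n] //=; rewrite subn1 /= ltnS subSS.
by [].
Qed.

Lemma mean_delay1 u h l : mean u h l -> mean u (delay 1 h) (u * l).
Proof.
case=> -[uE hl]; [left|right]; split=> //.
  rewrite uE mul1r; rewrite -cvg_shiftS (_ : (fun n => _) = h) //.
  by apply/funext => n; rewrite /delay /= subn1.
rewrite -cvg_shiftS (_ : (fun n => _) = fun N => u * abel_sum u h N).
  exact: cvgMr.
apply/funext => N; rewrite /abel_sum big_ord_recl /= /delay /= mulr0 add0r mulr_sumr.
by apply: eq_bigr => i _; rewrite /bump /= add1n subn1 /= exprS; ring.
Qed.

Lemma mean_delay u d h l : mean u h l -> mean u (delay d h) (u ^+ d * l).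
Proof.
move=> hl; elim: d => [|d IH].
  by rewrite mul1r; apply: eq_mean hl => n; rewrite /delay subn0.
by rewrite exprS -mulrA; apply: eq_mean (mean_delay1 IH) => n; rewrite -delayS.
Qed.

(** An e/3 argument. The Abel weights are nonnegative with sum at most 1, so an error uniform in n
    is not amplified. *)
Lemma mean_approx u h l : mean_param u ->
  (forall e, 0 < e -> exists f a, [/\ mean u f a, (forall n, `|h n - f n| <= e) & `|l - a| <= e]) ->
  mean u h l.
Proof.
case=> up H; [left|right]; split=> //; apply/cvgrPdist_le => e e0.
  have e3 : 0 < e / 3 by rewrite divr_gt0.
  have [f [a [fa hf la]]] := H _ e3.
  case: fa => -[uE fa]; last by move: uE; rewrite up ltxx andbF.
  move/cvgrPdist_le: fa => /(_ _ e3); apply: filterS => n fan.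
  have -> : l - h n = (l - a) + (a - f n) - (h n - f n) by ring.
  have := ler_normB ((l - a) + (a - f n)) (h n - f n); have := ler_normD (l - a) (a - f n).
  have := hf n; lra.
have e3 : 0 < e / 3 by rewrite divr_gt0.
have [f [a [fa hf la]]] := H _ e3.
case: fa => -[uE fa]; first by move: up; rewrite uE ltxx andbF.
move/cvgrPdist_le: fa => /(_ _ e3); apply: filterS => N fan.
have key : `|abel_sum u h N - abel_sum u f N| <= e / 3.
  case/andP: up => u0 u1; rewrite /abel_sum -sumrB.
  apply: (le_trans (ler_norm_sum _ _ _)).
  apply: (@le_trans _ _ (\sum_(n < N) (1 - u) * u ^+ n * (e / 3))).
    apply: ler_sum => n _; rewrite -mulrBr normrM ger0_norm; last first.
      by rewrite mulr_ge0 ?exprn_ge0 // ?ltW // subr_gt0.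
    by rewrite ler_wpM2l // mulr_ge0 ?exprn_ge0 // ?ltW // subr_gt0.
  rewrite -mulr_suml sum_geom ?lt_eqF //; apply: ler_piMl; first exact: ltW.
  by rewrite lerBlDr lerDl exprn_ge0 // ltW.
have -> : l - abel_sum u h N =
    (l - a) + (a - abel_sum u f N) - (abel_sum u h N - abel_sum u f N) by ring.
have := ler_normB ((l - a) + (a - abel_sum u f N)) (abel_sum u h N - abel_sum u f N).
have := ler_normD (l - a) (a - abel_sum u f N); lra.
Qed.

End Mean.

(** * Euler's expansion of the infinite product *)

Section Euler.
Local Open Scope classical_set_scope.
Variable R : realType.
Implicit Types (Q U x : R).

Lemma bcoefS Q k : bcoef Q k.+1 = bcoef Q k / (1 - Q ^+ k.+1).
Proof. by rewrite /bcoef big_ord_recr. Qed.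

(** The factors 1/(Q^j - 1) with j >= 2 are at most 1/2, but for Q = 2 the factor with j = 1 equals
    1; the constant 2 pays for it. *)
Lemma bcoef_bound Q k : 2 <= Q -> `|bcoef Q k| <= 2 * 2^-1 ^+ k.
Proof.
move=> Q2; have Q1 : 1 <= Q by lra.
have Qk j : 2 ^+ j <= Q ^+ j by rewrite lerXn2r ?nnegrE //; lra.
elim: k => [|k IH]; first by rewrite /bcoef big_ord0 normr1; lra.
rewrite bcoefS normrM normfV distrC.
have nz : 0 < Q ^+ k.+1 - 1 by rewrite subr_gt0 exprn_egt1 // lt_neqAle Q1 andbT; apply/eqP; lra.
rewrite (gtr0_norm nz) ler_pdivrMr //.
case: k IH nz => [|k] IH nz.
  by rewrite /bcoef big_ord0 normr1 !expr1; lra.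
apply: (le_trans IH); rewrite [_ ^+ k.+2]exprS.
have h : 2 <= Q ^+ k.+2 - 1.
  have := Qk k.+2; have : 4 <= (2 : R) ^+ k.+2; last by lra.
  by rewrite !exprS; have := exprn_ege1 k (_ : 1 <= (2 : R)); lra.
have : 0 <= (2^-1 : R) ^+ k.+1 by rewrite exprn_ge0.
move: (2^-1 ^+ k.+1) (Q ^+ k.+2 - 1) h => a b h a0; nra.
Qed.

Definition Gpart Q x K := \sum_(k < K) bcoef Q k * x ^+ k.

(** The truncated form of the functional equation G(U) = (1 - U/Q) G(U/Q); the last summand is the
    top term that truncation leaves over. *)
Lemma Gpart_fun Q U K : 1 < Q ->
  Gpart Q U K.+1 = (1 - U / Q) * Gpart Q (U / Q) K.+1 + (U / Q) ^+ K.+1 * bcoef Q K.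
Proof.
move=> Q1; have Q0 : Q != 0 by rewrite gt_eqF // (lt_trans ltr01).
elim: K => [|K IH].
  by rewrite /Gpart !big_ord1 /bcoef big_ord0 !expr0 expr1; ring.
rewrite /Gpart big_ord_recr -/(Gpart Q U K.+1) IH [in RHS]big_ord_recr -/(Gpart Q _ K.+1) /=.
have nz : 1 - Q ^+ K.+1 != 0 by rewrite subr_eq0 eq_sym gt_eqF // exprn_egt1.
have -> : bcoef Q K = bcoef Q K.+1 * (1 - Q ^+ K.+1) by rewrite bcoefS divfK.
have -> : U ^+ K.+1 = (U / Q) ^+ K.+1 * Q ^+ K.+1 by rewrite -exprMn divfK.
rewrite [_ ^+ K.+2]exprS.
move: (Gpart _ _ _) ((U / Q) ^+ K.+1) (Q ^+ K.+1) (bcoef _ _) => a b c d.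
by move: (U / Q) => e; ring.
Qed.

Lemma sum_half m M : \sum_(m <= k < M) 2 * (2^-1 : R) ^+ k <= 4 * 2^-1 ^+ m.
Proof.
have h0 n : 0 <= (2^-1 : R) ^+ n by rewrite exprn_ge0.
case: (leqP M m) => [le|lt]; first by rewrite big_geq // mulr_ge0.
suff : \sum_(m <= k < M) 2 * (2^-1 : R) ^+ k <= 4 * 2^-1 ^+ m - 4 * 2^-1 ^+ M.
  by have := h0 M; lra.
move: (ltnW lt); elim: M {lt} => [|M IH].
  by rewrite leqn0 => /eqP ->; rewrite big_geq // subrr.
rewrite leq_eqVlt => /orP[/eqP ->|]; first by rewrite big_geq // subrr.
rewrite ltnS => le; rewrite big_nat_recr //= [_ ^+ M.+1]exprS; have := IH le; lra.
Qed.

Lemma cvg_half : (fun K => 2 * 2^-1 ^+ K : R) @ \oo --> (0 : R).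
Proof.
have h : (fun K => 2 * 2^-1 ^+ K : R) @ \oo --> (2 * 0 : R).
  by apply: cvgMr; apply: cvg_expr; rewrite ger0_norm //; lra.
by rewrite mulr0 in h.
Qed.

Lemma Gpart_cvgn Q x : 2 <= Q -> 0 <= x <= 1 -> cvgn (Gpart Q x).
Proof.
move=> Q2 /andP[x0 x1].
rewrite (_ : Gpart Q x = series (fun k => bcoef Q k * x ^+ k)); last first.
  by apply/funext => n; rewrite /series /= big_mkord.
apply: normed_cvg; apply: (@series_le_cvg _ _ (geometric 2 2^-1)).
- by move=> n; rewrite /= normr_ge0.
- by move=> n; rewrite /geometric /= mulr_ge0 // exprn_ge0.
- move=> n; rewrite /geometric /= normrM normrX (ger0_norm x0).
  apply: (le_trans _ (bcoef_bound n Q2)); apply: ler_piMr => //.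
  exact: exprn_ile1.
- by apply: is_cvg_geometric_series; rewrite ger0_norm //; lra.
Qed.

Lemma Gpart_near1 Q x K : 2 <= Q -> 0 <= x <= 1 -> `|Gpart Q x K.+1 - 1| <= 2 * x.
Proof.
move=> Q2 /andP[x0 x1]; rewrite /Gpart big_ord_recl /bcoef big_ord0 mul1r expr0.
rewrite addrC addKr; apply: (le_trans (ler_norm_sum _ _ _)).
apply: (@le_trans _ _ (\sum_(0 <= k < K) 2^-1 * (2 * 2^-1 ^+ k) * x)); last first.
  rewrite -mulr_suml -mulr_sumr ler_wpM2r //.
  by have := sum_half 0 K; rewrite expr0; lra.
rewrite big_mkord; apply: ler_sum => k _; rewrite -/(bcoef Q (bump 0 k)) /bump /= add1n.
rewrite normrM normrX (ger0_norm x0) [x ^+ _]exprS.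
apply: ler_pM => //; first by rewrite mulr_ge0 // exprn_ge0.
  by apply: (le_trans (bcoef_bound _ Q2)); rewrite exprS; lra.
by rewrite ler_piMr // exprn_ile1.
Qed.

(** The functional equation in the limit, where the leftover term vanishes, iterated n times. *)
Lemma euler_partE Q U n : 2 <= Q -> 0 <= U <= 1 ->
  limn (Gpart Q U) =
  (\prod_(1 <= r < n.+1) (1 - U / Q ^+ r)) * limn (Gpart Q (U / Q ^+ n)).
Proof.
move=> Q2 U01; have Q1 : 1 < Q by lra.
have Q0 : Q != 0 by rewrite gt_eqF //; lra.
have UQ m : 0 <= U / Q ^+ m <= 1.
  have Qm : 1 <= Q ^+ m by rewrite exprn_ege1 // ltW.
  have Qp : 0 < Q ^+ m by lra.
  case/andP: U01 => U0 U1; rewrite divr_ge0 //; last exact: ltW.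
  by rewrite ler_pdivrMr // mul1r; lra.
have step x : 0 <= x <= 1 -> 0 <= x / Q <= 1 ->
    limn (Gpart Q x) = (1 - x / Q) * limn (Gpart Q (x / Q)).
  move=> x01 y01; apply/cvg_lim => //; rewrite -cvg_shiftS.
  rewrite (_ : (fun n => _) = fun K => (1 - x / Q) * Gpart Q (x / Q) K.+1 +
     (x / Q) ^+ K.+1 * bcoef Q K); last by apply/funext => K; rewrite /= Gpart_fun.
  rewrite -[(1 - x / Q) * _]addr0; apply: cvgD.
    apply: cvgMr; rewrite (cvg_shiftS (Gpart Q (x / Q))); exact: Gpart_cvgn.
  apply: norm_cvg0; apply: (@squeeze_cvgr _ _ _ _ (fun=> 0) (fun K => 2 * 2^-1 ^+ K)).
  - apply: nearW => K; rewrite normr_ge0 /= normrM normrX.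
    apply: (le_trans _ (bcoef_bound K Q2)); apply: ler_piMl => //.
    case/andP: y01 => y0 y1; rewrite (ger0_norm y0); exact: exprn_ile1.
  - exact: cvg_cst.
  - exact: cvg_half.
elim: n => [|n IH]; first by rewrite big_geq // mul1r expr0 divr1.
have qE : U / Q ^+ n / Q = U / Q ^+ n.+1 by rewrite -mulrA -invfM -exprSr.
rewrite IH [in RHS]big_nat_recr //= -mulrA (step (U / Q ^+ n)) ?qE //.
Qed.

(** The finite product is G(U) / G(U/Q^n), and the denominator tends to G(0) = 1 because G(x)
    differs from 1 by at most 2 x. *)
Lemma Gpart_cvg Q U : 2 <= Q -> 0 <= U <= 1 -> Gpart Q U @ \oo --> euler_prod U Q.
Proof.
move=> Q2 U01; have UQ m : 0 <= U / Q ^+ m <= 2^-1 ^+ m.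
  have Qm : (2 : R) ^+ m <= Q ^+ m by rewrite lerXn2r ?nnegrE //; lra.
  have tm : 0 < (2 : R) ^+ m by rewrite exprn_gt0.
  have Qp : 0 < Q ^+ m by lra.
  case/andP: U01 => U0 U1; rewrite divr_ge0 //=; last exact: ltW.
  rewrite ler_pdivrMr // exprVn mulrC ler_pdivlMr //.
  by apply: (le_trans _ Qm); rewrite ler_piMl // ltW.
have UQ1 m : 0 <= U / Q ^+ m <= 1.
  case/andP: (UQ m) => -> h /=; apply: (le_trans h); apply: exprn_ile1 => //; lra.
have near1 m : `|limn (Gpart Q (U / Q ^+ m)) - 1| <= 2 * 2^-1 ^+ m.
  have c : (fun K => `|Gpart Q (U / Q ^+ m) K.+1 - 1|) @ \oo --> `|limn (Gpart Q (U / Q ^+ m)) - 1|.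
    apply: cvg_norm; apply: cvgB; last exact: cvg_cst.
    rewrite (cvg_shiftS (Gpart Q (U / Q ^+ m))); exact: Gpart_cvgn.
  rewrite -(cvg_lim _ c) //; apply: limr_le.
    by apply/cvg_ex; exists (`|limn (Gpart Q (U / Q ^+ m)) - 1|).
  apply: nearW => K; apply: (le_trans (Gpart_near1 K Q2 (UQ1 m))).
  by rewrite ler_pM2l //; case/andP: (UQ m).
have c0 : (fun m => limn (Gpart Q (U / Q ^+ m))) @ \oo --> (1 : R).
  apply/subr_cvg0; apply: norm_cvg0.
  apply: (@squeeze_cvgr _ _ _ _ (fun=> 0) (fun K => 2 * 2^-1 ^+ K)).
  - by apply: nearW => K; rewrite normr_ge0 near1.
  - exact: cvg_cst.
  - exact: cvg_half.
suff -> : euler_prod U Q = limn (Gpart Q U) by apply: Gpart_cvgn.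
apply/cvg_lim => //.
have cV : (fun m => limn (Gpart Q U) * (limn (Gpart Q (U / Q ^+ m)))^-1) @ \oo -->
    limn (Gpart Q U) * 1^-1.
  by apply: cvgMr; apply: cvgV => //; apply: oner_neq0.
rewrite invr1 mulr1 in cV.
apply: cvg_trans cV; apply: near_eq_cvg.
have : \forall m \near \oo, limn (Gpart Q (U / Q ^+ m)) != 0.
  move/cvgrPdist_lt: c0 => /(_ _ ltr01); apply: filterS => m.
  by apply: contraTneq => ->; rewrite subr0 normr1 ltxx.
apply: filterS => m nz; rewrite (euler_partE m Q2 U01) mulfK //.
Qed.

(** The invariant of the induction is 1 minus the sum of 3^-r for r <= n, in closed form, which
    never drops below 1/2. With 2 in place of 3 this bound would tend to 0; positivity is wanted
    only for q > 2. *)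
Lemma euler_prod_gt0 Q U : 3 <= Q -> 0 <= U <= 1 -> 0 < euler_prod U Q.
Proof.
move=> Q3 /andP[U0 U1].
have Qm m : 0 <= U / Q ^+ m <= 3^-1 ^+ m.
  have Qm : (3 : R) ^+ m <= Q ^+ m by rewrite lerXn2r ?nnegrE //; lra.
  have tm : 0 < (3 : R) ^+ m by rewrite exprn_gt0.
  have Qp : 0 < Q ^+ m by lra.
  rewrite divr_ge0 //=; last exact: ltW.
  rewrite ler_pdivrMr // exprVn mulrC ler_pdivlMr //.
  by apply: (le_trans _ Qm); rewrite ler_piMl // ltW.
have lb n : 2^-1 + 2^-1 * 3^-1 ^+ n <= \prod_(1 <= r < n.+1) (1 - U / Q ^+ r).
  elim: n => [|n IH]; first by rewrite big_geq // expr0; lra.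
  rewrite big_nat_recr //=; have := Qm n.+1; rewrite [3^-1 ^+ n.+1]exprS.
  have t0 : 0 <= (3^-1 : R) ^+ n by rewrite exprn_ge0.
  have t1 : (3^-1 : R) ^+ n <= 1 by apply: exprn_ile1; lra.
  move: (\prod_(1 <= r < n.+1) _) (3^-1 ^+ n) (U / Q ^+ n.+1) IH t0 t1.
  move=> P t s IH t0 t1 /andP[s0 s1].
  nra.
suff : 2^-1 <= euler_prod U Q by lra.
apply: limr_ge; last first.
  by apply: nearW => n; apply: (le_trans _ (lb n)); rewrite lerDl mulr_ge0 // exprn_ge0.
apply: nonincreasing_is_cvgn; last first.
  exists 0 => _ [n _ <-]; apply: (le_trans _ (lb n)); rewrite addr_ge0 // mulr_ge0 // exprn_ge0 //.
apply/nonincreasing_seqP => n; rewrite big_nat_recr //= ler_piMr //.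
  by apply: (le_trans _ (lb n)); rewrite addr_ge0 // mulr_ge0 // exprn_ge0.
by case/andP: (Qm n.+1); lra.
Qed.

End Euler.

(** * Law of the types for the general linear group *)

Section GLMean.
Local Open Scope classical_set_scope.
Variables (R : realType) (F : finFieldType).

Local Notation q := (#|F|%:R : R).
Local Notation Qp p := (q ^+ (size p).-1).

Lemma Qp_ge2 (p : {poly F}) : irreducible_poly p -> 2 <= Qp p.
Proof.
case=> sp _; rewrite -natrX ler_nat.
apply: (@leq_trans (2 ^ (size p).-1)).
  by rewrite -{1}[2%N]expn1 leq_exp2l // -subn1 subn_gt0.
by rewrite leq_exp2r ?card_field_gt1 // -subn1 subn_gt0.
Qed.

(** Delayed terms vanish as soon as deg p * k > n, so any upper limit beyond n serves; this allows
    cutting the sum at a place independent of n. *)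
Lemma nofactor_probE (p : {poly F}) S n M : irreducible_poly p -> (n < M)%N ->
  nofactor_prob R (p :: S) n =
  \sum_(0 <= k < M) bcoef (Qp p) k * delay ((size p).-1 * k) (nofactor_prob R S) n.
Proof.
move=> [sp _] nM; rewrite big_mkord /=.
rewrite (big_ord_widen_cond M (fun k => ((size p).-1 * k <= n)%N)
  (fun k => bcoef (Qp p) k * nofactor_prob R S (n - (size p).-1 * k))) // big_mkcond.
apply: eq_bigr => k _; rewrite /delay.
case: (leqP ((size p).-1 * k) n) => h; last by rewrite mulr0.
by rewrite ltnS (leq_trans _ h) // leq_pmull // -subn1 subn_gt0.
Qed.

Lemma mean_nofactor_prob u (S : seq {poly F}) : mean_param u -> good_coll S ->
  mean u (nofactor_prob R S) (\prod_(p <- S) euler_prod (u ^+ (size p).-1) (Qp p)).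
Proof.
move=> up; elim: S => [|p S IH] gS; first by rewrite big_nil; apply: mean1.
have [gS' pS ip] := good_coll_cons gS.
rewrite big_cons; set E := euler_prod _ _; set l := \prod_(_ <- _) _ in IH *.
have /andP[u0 u1] := mean_param01 up.
have Ud : 0 <= u ^+ (size p).-1 <= 1.
  by apply/andP; split; [apply: exprn_ge0 | apply: exprn_ile1]; rewrite ?u1 ?ltW.
apply: mean_approx => // e e0.
have l1 : 0 < `|l| + 1 by rewrite ltr_wpDl.
(* The first bound makes the partial Euler series accurate after multiplication by l, with + 1 in
   case l = 0; the second makes the tail, at most 4 * 2^-K, at most e. *)
have /filter_ex[K [K1 K2]] : \forall K \near \oo,
    `|E - Gpart (Qp p) (u ^+ (size p).-1) K| <= e / (`|l| + 1) /\
    `|0 - 2 * 2^-1 ^+ K| <= e / 2.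
  apply: filterI.
    have /cvgrPdist_le := Gpart_cvg (Qp_ge2 ip) Ud; apply; exact: divr_gt0.
  by have /cvgrPdist_le := @cvg_half R; apply; rewrite divr_gt0.
exists (fun n => \sum_(k < K) bcoef (Qp p) k * delay ((size p).-1 * k) (nofactor_prob R S) n).
exists (\sum_(k < K) bcoef (Qp p) k * (u ^+ ((size p).-1 * k) * l)); split.
- by apply: mean_sum => // k _; apply: mean_delay; apply: IH.
(* The upper limit has to exceed n for the formula and to reach K for splitting off the first K
   terms. *)
- move=> n; rewrite (nofactor_probE S (M := maxn n.+1 K)) ?leq_max ?leqnn //.
  rewrite (big_cat_nat (n := K)) ?leq_max ?leqnn ?orbT //= big_mkord addrAC subrr add0r.
  apply: (le_trans (ler_norm_sum _ _ _)).
  apply: (@le_trans _ _ (\sum_(K <= k < maxn n.+1 K) 2 * 2^-1 ^+ k)).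
    apply: ler_sum => k _; rewrite normrM -[leRHS]mulr1.
    apply: ler_pM => //; first exact: bcoef_bound (Qp_ge2 ip).
    rewrite /delay; case: ifP => _; last by rewrite normr0.
    by have /andP[h0 h1] := @nofactor_prob_bound F R (n - (size p).-1 * k) S gS'; rewrite ger0_norm.
  apply: (le_trans (sum_half _ _ _)); move: K2; rewrite sub0r normrN ger0_norm; first by lra.
  by rewrite mulr_ge0 // exprn_ge0.
- have -> : \sum_(k < K) bcoef (Qp p) k * (u ^+ ((size p).-1 * k) * l) =
      Gpart (Qp p) (u ^+ (size p).-1) K * l.
    by rewrite /Gpart mulr_suml; apply: eq_bigr => k _; rewrite exprM mulrA.
  rewrite -mulrBl normrM; apply: (@le_trans _ _ (e / (`|l| + 1) * `|l|)).
    by rewrite ler_wpM2r.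
  by rewrite mulrAC ler_pdivrMr // ler_pM2l // lerDl.
Qed.

Definition type_event S L n (A : 'M[F]_n) := has_type (\prod_(p <- S) p) (blocks S L) A.

(** Independence appears as a factorization: the delay by the total dimension gives u to a sum over
    p, and the Euler factors and the self-embedding counts are products over p as well. *)
Lemma mean_EGL u S L : mean_param u -> good_coll S ->
  (forall p, p \in S -> is_partition (L p)) ->
  mean u (fun n => EGL (fun A : 'M[F]_n => (type_event S L A)%:R))
    (\prod_(p <- S) Mdist (u ^+ (size p).-1) (Qp p) (L p)).
Proof.
move=> up gS pL.
have cE : cent_size R S L = \prod_(p <- S) pdenom (Qp p) (L p).
  rewrite /cent_size; apply: eq_big_seq => p pS; apply: emb_count_pdenom; last exact: pL.
  by apply: lt_le_trans (Qp_ge2 (good_irr gS pS)).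
have c0 : cent_size R S L != 0.
  rewrite cE prodf_seq_neq0; apply/allP => p pS; rewrite /= gt_eqF //.
  by apply: pdenom_gt0; apply: Qp_gt1; apply: good_irr pS.
have -> : \prod_(p <- S) Mdist (u ^+ (size p).-1) (Qp p) (L p) =
  (cent_size R S L)^-1 * (u ^+ dimT (blocks S L) *
    \prod_(p <- S) euler_prod (u ^+ (size p).-1) (Qp p)).
  rewrite cE dimT_blocks -prodfV -prodrXr -!big_split /=; apply: eq_bigr => p _.
  by rewrite /Mdist /psize -exprM; ring.
apply: eq_mean (meanZ (cent_size R S L)^-1
   (mean_delay (dimT (blocks S L)) (mean_nofactor_prob up gS))) => n.
by rewrite /delay -EGL_has_type // mulrC mulfK.
Qed.

End GLMean.

(** Ranks are bounded in one direction block by block, and in the other only in total; this recovers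
    equality in each block. *)
Lemma eq_of_sum_geq (I : eqType) (r : seq I) (a b : I -> nat) :
  (forall i, i \in r -> a i <= b i)%N -> (\sum_(i <- r) b i <= \sum_(i <- r) a i)%N ->
  {in r, a =1 b}.
Proof.
elim: r => [|i r IH] ab; first by move=> _ j.
rewrite !big_cons => le j; rewrite inE.
have ai := ab i (mem_head _ _).
have ab' k : k \in r -> (a k <= b k)%N by move=> kr; apply: ab; rewrite inE kr orbT.
have sr : (\sum_(i <- r) a i <= \sum_(i <- r) b i)%N.
  by rewrite big_seq [leqRHS]big_seq; apply: leq_sum.
case/predU1P => [->|jr]; first by apply/eqP; rewrite eqn_leq ai /=; lia.
by apply: IH jr => //; lia.
Qed.

(** * Rational canonical forms as embeddings *)

Section Spans.
Variables (F : finFieldType) (m : nat).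
Local Notation n := m.+1.
Variable A : 'M[F]_n.
Implicit Types (zs : seq ({poly F} * 'rV[F]_n)).

(* A list of pairs (f, v), with v killed by f(A), encodes a map from the sum of the F['X]/(f). *)
Definition zspan zs : 'M[F]_n :=
  (\sum_(t <- zs) <<cyc (size t.1).-1 A t.2>>)%MS.

Definition zann zs := all (fun t => t.2 *m hmx A t.1 == 0) zs.

Definition primary_ker (p : {poly F}) : 'M[F]_n := kermx (hmx A (p ^+ n)).

Lemma zspan_cons t zs : (zspan (t :: zs) :=: cyc (size t.1).-1 A t.2 + zspan zs)%MS.
Proof.
rewrite /zspan big_cons; apply: adds_eqmx; [exact: genmxE | exact: eqmx_refl].
Qed.

Lemma zspan_rank zs : (\rank (zspan zs) <= dimT (unzip1 zs))%N.
Proof.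
elim: zs => [|t zs IH]; first by rewrite /zspan big_nil mxrank0.
rewrite zspan_cons /=; apply: leq_trans (mxrank_adds_leqif _ _) _.
by apply: leq_add => //; apply: rank_leq_row.
Qed.

Lemma intertwine_zs (fs : seq {poly F}) (X : 'M[F]_(dimT fs, n)) :
  (forall f, f \in fs -> (1 < size f)%N) -> X *m A = Tmx fs *m X ->
  exists zs, [/\ unzip1 zs = fs, zann zs & (X :=: zspan zs)%MS].
Proof.
elim: fs X => [|f fs IH] X sfs.
  move=> _; exists [::]; split=> //; rewrite /zspan big_nil.
  by apply/eqmxP; rewrite !sub0mx andbT; apply/rV_subP => v /submxP[w ->];
     rewrite [w]thinmx0 mul0mx sub0mx.
rewrite -[X]vsubmxK; set X1 := usubmx X; set X2 := dsubmx X.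
rewrite mul_col_mx mul_block_col !mul0mx addr0 add0r => /eq_col_mx[X1A X2A].
have [v vf vE] := comp_intertwine_cyc (sfs f (mem_head _ _)) X1A.
have [|zs [zE za zX]] := IH X2 _ X2A; first by move=> g gs; apply: sfs; rewrite inE gs orbT.
exists ((f, v) :: zs); split; first by rewrite /= zE.
  by rewrite /zann /= vf eqxx.
apply: eqmx_trans (eqmx_sym (addsmxE _ _)) _; apply: eqmx_sym.
apply: eqmx_trans (zspan_cons _ _) _; rewrite /= -vE.
by apply: adds_eqmx; [exact: eqmx_refl | exact: eqmx_sym].
Qed.

Lemma zs_intertwine zs : zann zs -> (forall f, f \in unzip1 zs -> f != 0) ->
  exists2 X : 'M[F]_(dimT (unzip1 zs), n), X *m A = Tmx (unzip1 zs) *m X &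
    (X :=: zspan zs)%MS.
Proof.
elim: zs => [|[f v] zs IH] /= za sf.
  exists 0; first by rewrite mul0mx mulmx0.
  by rewrite /zspan big_nil; apply/eqmxP; rewrite !sub0mx.
case/andP: za => /eqP vf za; case: (IH za) => [g gs|X XA Xz].
  by apply: sf; rewrite inE gs orbT.
exists (col_mx (cyc (size f).-1 A v) X).
  rewrite mul_col_mx mul_block_col !mul0mx addr0 add0r XA cyc_intertwine //.
  by apply: sf; rewrite mem_head.
apply: eqmx_trans (eqmx_sym (addsmxE _ _)) _; apply: eqmx_sym.
apply: eqmx_trans (zspan_cons _ _) _ => /=.
by apply: adds_eqmx; [exact: eqmx_refl | exact: eqmx_sym].
Qed.

(** Injectivity is replaced by a dimension count: as many vectors as the dimension of the space they
    span must be independent. *)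
Lemma has_typeP psi (fs : seq {poly F}) : (forall f, f \in fs -> (1 < size f)%N) ->
  hmx (Tmx fs) (psi ^+ dimT fs) = 0 ->
  has_type psi fs A <-> exists zs, [/\ unzip1 zs = fs, zann zs, (primary_ker psi <= zspan zs)%MS &
    dimT fs = \rank (primary_ker psi)].
Proof.
move=> sfs T0; split=> [ty|[zs [zE za Kz dE]]].
  case/existsP: (ty) => X /andP[Xe Xf]; move: (Xe); rewrite inE => /andP[fX /eqP XA].
  have [zs [zE za zX]] := intertwine_zs sfs XA.
  exists zs; split=> //; first by rewrite -zX.
  have XK : (X <= primary_ker psi)%MS.
    apply/sub_kermxP; have -> : psi ^+ n = psi ^+ dimT fs * psi ^+ (n - dimT fs).
      by rewrite -exprD subnKC // (row_free_dim Xe).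
    by rewrite (hmx_intertwine _ XA) hmxM T0 !mul0mx.
  by apply/eqP; rewrite eqn_leq -{1}(eqP fX) (mxrankS XK) -(eqP fX) (mxrankS Xf).
subst fs.
case: (zs_intertwine za) => [f /sfs sf|X XA Xz]; first by rewrite -size_poly_gt0 ltnW.
apply/existsP; exists X; rewrite inE XA eqxx andbT; apply/andP; split; last by rewrite /full Xz.
by have := mxrankS Kz; rewrite -dE -Xz => h; rewrite /row_free eqn_leq rank_leq_row.
Qed.

(** By Cayley-Hamilton the first n powers of A already span the cyclic subspace of v. *)
Lemma cyc_sub_span d (v : 'rV[F]_n) : (cyc d A v <= cyc n A v)%MS.
Proof.
apply/row_subP => i; rewrite rowK -hmxXn.
have c0 : char_poly A != 0 by rewrite monic_neq0 ?char_poly_monic.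
rewrite (divp_eq 'X^i (char_poly A)) hmxD hmxM [hmx A (char_poly A)]Cayley_Hamilton.
rewrite mulmx0 add0r -(@poly_rV_K _ n (_ %% _)).
  by rewrite -mul_cyc submxMl.
by rewrite -ltnS -(size_char_poly A) ltn_modp.
Qed.

Lemma span_sub_cyc (f : {poly F}) (v : 'rV[F]_n) : f != 0 -> v *m hmx A f = 0 ->
  (cyc n A v <= cyc (size f).-1 A v)%MS.
Proof.
move=> f0 vf; apply/row_subP => i; rewrite rowK -hmxXn.
rewrite (divp_eq 'X^i f) hmxD mulmxDr (hmx_ker_dvd _ vf) ?dvdp_mull // add0r.
by rewrite -(@poly_rV_K _ (size f).-1 (_ %% _)) ?size_modp_pred // -mul_cyc submxMl.
Qed.

(** The case of an empty X: the annihilator condition of [rcf_part] says that the first deg p^e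
    images of v are independent. *)
Lemma cyc_row_free (p : {poly F}) e (v : 'rV[F]_n) : irreducible_poly p -> (0 < e)%N ->
  v *m hmx A (p ^+ e) = 0 ->
  row_free (cyc (size (p ^+ e)).-1 A v) = (v *m hmx A (p ^+ e.-1) != 0).
Proof.
move=> ip e0 ve.
have fX0 : row_free (0 : 'M[F]_(0, n)) by rewrite /row_free mxrank0.
have XA : (0 : 'M[F]_(0, n)) *m A = (0 : 'M[F]_0) *m (0 : 'M[F]_(0, n)).
  by rewrite !mul0mx.
have sub0 (w : 'rV[F]_n) : (w <= (0 : 'M[F]_(0, n)))%MS = (w == 0).
  by apply/idP/eqP => [/submxP[x ->]|->]; rewrite ?mulmx0 ?sub0mx.
have := row_free_col_cyc ip e0 XA fX0 ve; rewrite sub0 => <-.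
rewrite /row_free; have -> : \rank (col_mx (cyc (size (p ^+ e)).-1 A v) (0 : 'M[F]_(0, n))) =
   \rank (cyc (size (p ^+ e)).-1 A v).
  by rewrite -addsmxE addsmx0.
by rewrite addn0.
Qed.

Lemma primary_ker_ann (p : {poly F}) e (v : 'rV[F]_n) : (e <= n)%N -> v *m hmx A (p ^+ e) = 0 ->
  (cyc n A v <= primary_ker p)%MS.
Proof.
move=> le ve; apply/row_subP => i; rewrite rowK; apply/sub_kermxP.
rewrite -hmxXn -mulmxA hmx_comm mulmxA (hmx_ker_dvd _ ve) ?mul0mx //.
exact: dvdp_exp2l.
Qed.

Definition pwr_blocks (p : {poly F}) (l : seq nat) := [seq p ^+ e | e <- rev l].

Lemma dimT_pwr_blocks (p : {poly F}) l : dimT (pwr_blocks p l) = ((size p).-1 * sumn l)%N.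
Proof.
have := dimT_blocks [:: p] (fun=> l).
by rewrite big_cons big_nil addn0 /blocks /= cats0.
Qed.

Lemma rcf_partP (p : {poly F}) l : irreducible_poly p -> is_partition l ->
  rcf_part A p l <-> exists zs, [/\ unzip1 zs = pwr_blocks p l, zann zs,
    (primary_ker p <= zspan zs)%MS & ((size p).-1 * sumn l)%N = \rank (primary_ker p)].
Proof.
move=> ip pl; have /andP[_ /allP lpos] := pl.
have p0 := irredp_neq0 ip.
have KE : primary A p = primary_ker p by rewrite /primary /primary_ker hmx_exp.
have phE i : phi_at A p ^+ i = hmx A (p ^+ i) by rewrite hmx_exp.
have d0 : (0 < (size p).-1)%N by rewrite -subn1 subn_gt0; case: ip.
(* Reversed, since [pwr_blocks] lists the parts in increasing order and [rcf_part] in decreasing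
   order. *)
pose zof (v : (size l).-tuple 'rV[F]_n) := rev (zip [seq p ^+ e | e <- l] v).
have zof1 v : unzip1 (zof v) = pwr_blocks p l.
  rewrite /zof /unzip1 map_rev -/(unzip1 _) unzip1_zip ?size_map ?size_tuple //.
  by rewrite /pwr_blocks map_rev.
have zspanE v : (zspan (zof v) :=:
    \sum_(j < size l) <<cyc (size (p ^+ nth 0%N l j)).-1 A (tnth v j)>>)%MS.
  rewrite /zspan /zof (perm_big (zip [seq p ^+ e | e <- l] v)) ?perm_rev //=.
  rewrite (big_nth (0, 0)) size_zip size_map size_tuple minnn big_mkord.
  rewrite (eq_bigr (fun j : 'I_(size l) =>
    <<cyc (size (p ^+ nth 0%N l j)).-1 A (tnth v j)>>%MS)) //.
  move=> j _; rewrite nth_zip ?size_map ?size_tuple //= (nth_map 0%N) //.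
  by rewrite (tnth_nth 0).
have zannE v : zann (zof v) = [forall j : 'I_(size l), tnth v j *m hmx A (p ^+ nth 0%N l j) == 0].
  rewrite /zann /zof all_rev; apply/allP/forallP => [h j|h t tz].
    have := h (p ^+ nth 0%N l j, tnth v j); apply.
    apply/(nthP (0, 0)); exists j; first by rewrite size_zip size_map size_tuple minnn.
    by rewrite nth_zip ?size_map ?size_tuple //= (nth_map 0%N) // (tnth_nth 0).
  case/(nthP (0, 0)): tz => j; rewrite size_zip size_map size_tuple minnn => jl <-.
  rewrite nth_zip ?size_map ?size_tuple //= (nth_map 0%N) //.
  by have := h (Ordinal jl); rewrite (tnth_nth 0).
have sumlE : (\sum_(j < size l) (size (p ^+ nth 0%N l j)).-1)%N = ((size p).-1 * sumn l)%N.
  by under eq_bigr do rewrite size_exp; rewrite -big_distrr sumnE (big_nth 0%N) big_mkord.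
split.
  case/andP=> _ /existsP[v /andP[/andP[/forallP vann /eqmxP vK] /eqP vr]].
  have ann j : tnth v j *m hmx A (p ^+ nth 0%N l j) = 0.
    by have /andP[/eqP + _] := vann j; rewrite phE.
  have nann j : tnth v j *m hmx A (p ^+ (nth 0%N l j).-1) != 0.
    by have /andP[_] := vann j; rewrite phE.
  have lj (j : 'I_(size l)) : (0 < nth 0%N l j)%N by apply: lpos; apply: mem_nth.
  exists (zof v); split=> //; first by rewrite zannE; apply/forallP => j; rewrite ann.
    rewrite zspanE -KE -vK; apply/sumsmx_subP => j _.
    apply: (sumsmx_sup j) => //; rewrite genmxE.
    by apply: span_sub_cyc => //; rewrite expf_neq0.
  rewrite -KE -vr -sumlE; apply: eq_bigr => j _.
  have /eqP <- : row_free (cyc (size (p ^+ nth 0%N l j)).-1 A (tnth v j)) by rewrite cyc_row_free.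
  apply/eqP; rewrite eqn_leq mxrankS ?cyc_sub_span //=.
  by rewrite mxrankS // span_sub_cyc // expf_neq0.
case=> zs [zE za zK rE].
pose vl : seq 'rV[F]_n := rev (unzip2 zs).
have svl : size vl == size l.
  by rewrite size_rev size_map -(size_map fst) -/(unzip1 zs) zE size_map size_rev.
pose v : (size l).-tuple 'rV[F]_n := Tuple svl.
have zsE : zs = zof v.
  rewrite /zof /= /vl rev_zip ?revK; last first.
    by rewrite size_rev !size_map -(size_map fst) -/(unzip1 zs) zE size_map size_rev.
  by rewrite -map_rev -/(pwr_blocks p l) -zE zip_unzip.
have ann j : tnth v j *m hmx A (p ^+ nth 0%N l j) = 0.
  by move: za; rewrite zsE zannE => /forallP /(_ j) /eqP.
have lj (j : 'I_(size l)) : (0 < nth 0%N l j)%N by apply: lpos; apply: mem_nth.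
pose c (j : 'I_(size l)) := cyc (size (p ^+ nth 0%N l j)).-1 A (tnth v j).
(* Each cyclic space has at most the expected dimension, and together they span a space of the total
   dimension. *)
have rc (j : 'I_(size l)) : \rank (c j) = (size (p ^+ nth 0%N l j)).-1.
  apply: (@eq_of_sum_geq _ (index_enum 'I_(size l)) (fun j => \rank (c j))
    (fun j => (size (p ^+ nth 0%N l j)).-1)); last exact: mem_index_enum.
    by move=> i _; apply: rank_leq_row.
  rewrite sumlE rE; apply: leq_trans (mxrankS zK) _; rewrite zsE zspanE.
  apply: leq_trans (mxrank_sum_leqif _) _ => /=.
  by apply: leq_sum => i _; rewrite mxrank_gen.
have rcs (j : 'I_(size l)) : \rank (cyclic_span A (tnth v j)) = \rank (c j).
  apply/eqP; rewrite eqn_leq [X in _ && X]mxrankS ?cyc_sub_span // andbT.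
  by rewrite mxrankS // span_sub_cyc // expf_neq0.
rewrite /rcf_part pl; apply/existsP; exists v; apply/andP; split; [apply/andP; split|].
- apply/forallP => j; rewrite !phE ann eqxx /= -cyc_row_free //.
  by rewrite /row_free -/(c j) rc.
- apply/andP; split; last first.
    rewrite KE; apply: submx_trans zK _; rewrite zsE zspanE; apply/sumsmx_subP => j _.
    by apply: (sumsmx_sup j) => //; rewrite genmxE; apply: cyc_sub_span.
  rewrite KE; apply/sumsmx_subP => j _; apply: primary_ker_ann (ann j).
  apply: leq_trans (rank_leq_col (c j)); rewrite rc size_exp.
  exact: leq_pmull.
- rewrite KE -rE -sumlE; apply/eqP; apply: eq_bigr => j _.
  by rewrite rcs rc.
Qed.
End Spans.

Section TypeIsRcf.
Variables (F : finFieldType) (m : nat).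
Local Notation n := m.+1.
Variable A : 'M[F]_n.

Lemma primary_ker_prod (S : seq {poly F}) : good_coll S ->
  (primary_ker A (\prod_(p <- S) p) :=: \sum_(p <- S) primary_ker A p)%MS /\
  \rank (primary_ker A (\prod_(p <- S) p)) = (\sum_(p <- S) \rank (primary_ker A p))%N.
Proof.
elim: S => [|p S IH] gS.
  rewrite !big_nil; have -> : primary_ker A 1 = 0.
    by apply/eqP; rewrite /primary_ker expr1n hmx1 kermx_eq0 row_free_unit unitmx1.
  by rewrite mxrank0.
have [gS' pS ip] := good_coll_cons gS; have [E1 E2] := IH gS'.
rewrite !big_cons.
have cop : coprimep (p ^+ n) ((\prod_(r <- S) r) ^+ n).
  apply: coprimep_expl; apply: coprimep_expr; rewrite big_seq.
  elim/big_rec: _ => [|r x rS cx]; rewrite ?coprimep1 // coprimepMr cx andbT.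
  apply: (blocks_coprime gS); rewrite ?mem_head ?inE ?rS ?orbT //.
  by apply: contraNneq pS => ->.
have EM : (primary_ker A (p * \prod_(r <- S) r) :=:
    primary_ker A p + primary_ker A (\prod_(r <- S) r))%MS.
  by rewrite /primary_ker exprMn; apply: (kermxpolyM A cop).
split.
  by apply: eqmx_trans EM _; apply: adds_eqmx => //; apply: eqmx_refl.
rewrite EM mxrank_disjoint_sum ?E2 //.
exact: (mxdirect_kermxpoly A cop).
Qed.

Lemma zspan_sub k (K : 'M[F]_(k, n)) (zs : seq ({poly F} * 'rV[F]_n)) :
  (forall t, t \in zs -> (cyc (size t.1).-1 A t.2 <= K)%MS) -> (zspan A zs <= K)%MS.
Proof.
elim: zs => [|t zs IH] h; first by rewrite /zspan big_nil sub0mx.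
rewrite zspan_cons addsmx_sub h ?mem_head //= IH // => s sz.
by apply: h; rewrite inE sz orbT.
Qed.

Lemma mxrank_sum_seq (I : Type) (r : seq I) (B : I -> 'M[F]_n) :
  (\rank (\sum_(i <- r) B i)%MS <= \sum_(i <- r) \rank (B i))%N.
Proof.
elim: r => [|i r IH]; first by rewrite !big_nil mxrank0.
rewrite !big_cons; apply: leq_trans (mxrank_adds_leqif _ _) _.
by rewrite leq_add2l.
Qed.

Lemma sumsmx_seqS (I : eqType) (r : seq I) (B C : I -> 'M[F]_n) :
  (forall i, i \in r -> (B i <= C i)%MS) ->
  (\sum_(i <- r) B i <= \sum_(i <- r) C i)%MS.
Proof.
elim: r => [|i r IH] BC; first by rewrite !big_nil.
rewrite !big_cons addsmxS ?BC ?mem_head // IH // => j jr.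
by apply: BC; rewrite inE jr orbT.
Qed.

Lemma zann_cat (z1 z2 : seq ({poly F} * 'rV[F]_n)) : zann A (z1 ++ z2) = zann A z1 && zann A z2.
Proof. exact: all_cat. Qed.

Lemma zspan_cat (z1 z2 : seq ({poly F} * 'rV[F]_n)) :
  zspan A (z1 ++ z2) = (zspan A z1 + zspan A z2)%MS.
Proof. exact: big_cat. Qed.

Lemma split_zs (S : seq {poly F}) (L : {poly F} -> seq nat) zs : uniq S ->
  unzip1 zs = blocks S L -> zann A zs ->
  exists2 Z : {poly F} -> seq ({poly F} * 'rV[F]_n),
    (forall p, p \in S -> unzip1 (Z p) = pwr_blocks p (L p) /\ zann A (Z p)) &
    zspan A zs = (\sum_(p <- S) zspan A (Z p))%MS.
Proof.
elim: S zs => [|p S IH] zs /=.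
  move=> _; case: zs => // _ _; exists (fun=> [::]) => //.
  by rewrite /zspan !big_nil.
case/andP=> pS uS zE; rewrite -(cat_take_drop (size (L p)) zs) zann_cat => /andP[za1 za2].
have e1 : unzip1 (take (size (L p)) zs) = pwr_blocks p (L p).
  rewrite /unzip1 map_take -/(unzip1 zs) zE take_size_cat //.
  by rewrite size_map size_rev.
have e2 : unzip1 (drop (size (L p)) zs) = blocks S L.
  rewrite /unzip1 map_drop -/(unzip1 zs) zE drop_size_cat //.
  by rewrite size_map size_rev.
have [Z ZP ZE] := IH _ uS e2 za2.
exists (fun r => if r == p then take (size (L p)) zs else Z r).
  move=> r; rewrite inE; case: eqVneq => [->|_] //=; exact: ZP.
rewrite zspan_cat ZE big_cons eqxx; congr (_ + _)%MS; apply: eq_big_seq => r rS.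
by case: eqVneq => // rp; rewrite rp (negPf pS) in rS.
Qed.

(** [has_type] treats all of S through the product of its members, [rcf_part] one p at a time;
    primary components for distinct p being in direct sum, spans and ranks can be compared
    separately. *)
Lemma has_type_rcf (S : seq {poly F}) (L : {poly F} -> seq nat) : good_coll S ->
  (forall p, p \in S -> is_partition (L p)) -> type_event S L A = ev_joint S L A.
Proof.
move=> gS pL.
have sb f : f \in blocks S L -> (1 < size f)%N.
  by move=> /mem_blocks[p [e [pS eL ->]]]; apply: (size_block gS pL).
have [KE rK] := primary_ker_prod gS.
have dE : dimT (blocks S L) = (\sum_(p <- S) (size p).-1 * sumn (L p))%N := dimT_blocks S L.
apply/idP/allP.
  case/(has_typeP _ sb (blocks_root gS pL)) => zs [zE za zK rE].
  have uS : uniq S by case: gS.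
  have [Z ZP ZE] := split_zs uS zE za.
  (* The span attached to p lies in the p-primary component; as the ranks add up to the whole, each
     span fills its component. *)
  have le1 : (\rank (primary_ker A (\prod_(p <- S) p)) <= \sum_(p <- S) \rank (zspan A (Z p)))%N.
    by apply: leq_trans (mxrankS zK) _; rewrite ZE; apply: mxrank_sum_seq.
  have ZK p : p \in S -> (zspan A (Z p) <= primary_ker A p)%MS.
    move=> pS; have [z1 z2] := ZP p pS; apply: zspan_sub => t tz.
    have : t.1 \in pwr_blocks p (L p) by rewrite -z1 map_f.
    case/mapP => e; rewrite mem_rev => eL tE.
    apply: submx_trans (cyc_sub_span _ _ _) _; apply: (@primary_ker_ann _ _ _ _ e).
      by apply: leq_trans (part_le_dim gS pS eL) _; rewrite rE rank_leq_row.
    by rewrite -tE; apply/eqP; apply: (allP z2).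
  have r1 := @eq_of_sum_geq _ S (fun p => \rank (zspan A (Z p))) (fun p => \rank (primary_ker A p))
     (fun p pS => mxrankS (ZK p pS)).
  rewrite -rK in r1; have {}r1 := r1 le1.
  (* The same comparison, now between the rank of each span and the number of vectors generating
     it. *)
  have r2 := @eq_of_sum_geq _ S (fun p => \rank (zspan A (Z p)))
    (fun p => ((size p).-1 * sumn (L p))%N).
  rewrite -dE rE in r2.
  move=> p pS; apply/rcf_partP; [exact: good_irr pS | exact: pL |].
  exists (Z p); have [z1 z2] := ZP p pS; split=> //.
    by have [_] := mxrank_leqif_sup (ZK p pS); rewrite r1 // eqxx.
  rewrite -r1 // r2 // => r rS; rewrite -dimT_pwr_blocks.
  by have [<- _] := ZP r rS; apply: zspan_rank.
move=> H; apply/(has_typeP _ sb (blocks_root gS pL)).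
have {}H p : p \in S -> exists zs, [/\ unzip1 zs = pwr_blocks p (L p), zann A zs,
    (primary_ker A p <= zspan A zs)%MS & ((size p).-1 * sumn (L p))%N = \rank (primary_ker A p)].
  by move=> pS; apply/rcf_partP; [exact: good_irr pS | exact: pL | exact: H].
have /choice[Z ZP] : forall p : {poly F}, exists zs, p \in S ->
   [/\ unzip1 zs = pwr_blocks p (L p), zann A zs,
    (primary_ker A p <= zspan A zs)%MS & ((size p).-1 * sumn (L p))%N = \rank (primary_ker A p)].
  by move=> p; case: (boolP (p \in S)) => [/H[zs zP]|_]; [exists zs | exists [::]].
exists (flatten [seq Z p | p <- S]); split.
- rewrite /unzip1 map_flatten -map_comp; congr flatten; apply/eq_in_map => p pS /=.
  by have [] := ZP p pS.
- apply/allP => t /flattenP[z /mapP[p pS ->]] tz.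
  by have [_ /allP h _ _] := ZP p pS; apply: h.
- rewrite KE.
  have -> : zspan A (flatten [seq Z p | p <- S]) = (\sum_(p <- S) zspan A (Z p))%MS.
    by rewrite /zspan big_flatten big_map.
  by apply: sumsmx_seqS => p pS; have [] := ZP p pS.
- rewrite dE rK; apply: eq_big_seq => p pS; by have [] := ZP p pS.
Qed.
End TypeIsRcf.

(** * Affine and parabolic groups *)

Section Affine.
Variable F : finFieldType.

(* The group A(n,q) is the case a = 1, and P(n,q) is the union over nonzero a. *)
Definition inAff (a : F) n (x : 'M[F]_n.+1) : bool :=
  (x \in unitmx) && (x ord0 ord0 == a) &&
  [forall j : 'I_n.+1, (j != ord0) ==> (x j ord0 == 0)].

(** A vector killed by B^(m+1) but not by B^m yields m + 1 independent vectors v, v B, ..., v B^m,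
    which is impossible for m >= n. *)
Lemma ker_stab n (B : 'M[F]_n) (v : 'rV_n) i : v *m B ^+ (n + i) = 0 -> v *m B ^+ n = 0.
Proof.
elim: i => [|i IH]; first by rewrite addn0.
rewrite addnS => vB; apply: IH; apply/eqP; apply: contraT => nz.
have iX : irreducible_poly ('X : {poly F}).
  by rewrite -[X in irreducible_poly X]subr0 -polyC0; apply: irredp_XsubC.
have fX0 : row_free (0 : 'M[F]_(0, n)) by rewrite /row_free mxrank0.
have XA : (0 : 'M[F]_(0, n)) *m B = (0 : 'M[F]_0) *m (0 : 'M[F]_(0, n)) by rewrite !mul0mx.
have ve : v *m hmx B ('X ^+ (n + i).+1) = 0 by rewrite hmxXn.
have := row_free_col_cyc iX (ltn0Sn _) XA fX0 ve.
have -> : (v *m hmx B ('X ^+ (n + i).+1.-1) <= (0 : 'M[F]_(0, n)))%MS = false.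
  apply: contraNF nz; rewrite hmxXn => /submxP[x ->]; by rewrite mulmx0.
rewrite /row_free => /eqP rk.
have := rank_leq_col
  (col_mx (cyc (size (('X : {poly F}) ^+ (n + i).+1)).-1 B v) (0 : 'M[F]_(0, n))).
by rewrite rk size_polyXn /= addn0 -addSn; lia.
Qed.

Section Block.
Variables (n : nat) (a : F) (w : 'rV[F]_n) (B : 'M[F]_n).
Let x : 'M[F]_(1 + n) := block_mx a%:M w 0 B.

Lemma hmx_scalar1 g : hmx (a%:M : 'M[F]_1) g = (g.[a])%:M.
Proof.
elim/poly_ind: g => [|g c IH]; first by rewrite hmx0 horner0 raddf0.
by rewrite hmxD hmxM hmxX hmxC IH hornerMXaddC raddfD /= scalar_mxM.
Qed.

(** The rows (0, v) form an invariant subspace on which x acts as B, and x acts as a on the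
    quotient. As psi(a) is nonzero, the psi-primary component and every embedding of the model
    module have first coordinate 0. *)
Lemma has_type_utri psi fs : psi.[a] != 0 -> hmx (Tmx fs) (psi ^+ dimT fs) = 0 ->
  has_type psi fs x = has_type psi fs B.
Proof.
move=> pa T0.
have bot g (v : 'rV[F]_n) : row_mx (0 : 'rV_1) v *m hmx x g = row_mx 0 (v *m hmx B g).
  have E : (row_mx 0 1%:M : 'M[F]_(n, 1 + n)) *m x = B *m row_mx 0 1%:M.
    by rewrite mul_row_block !mul0mx !mul1mx !add0r mul_mx_row mulmx0 mulmx1.
  have -> : row_mx (0 : 'rV_1) v = v *m row_mx 0 1%:M by rewrite mul_mx_row mulmx0 mulmx1.
  by rewrite -mulmxA (hmx_intertwine _ E) mulmxA mul_mx_row mulmx0 mulmx1.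
have lft g (v : 'rV[F]_(1 + n)) : v *m hmx x g *m col_mx 1%:M 0 = lsubmx v *m (g.[a])%:M.
  have E : (col_mx 1%:M 0 : 'M[F]_(1 + n, 1)) *m a%:M = x *m col_mx 1%:M 0.
    by rewrite mul_block_col !mulmx0 !mulmx1 !addr0 mul_col_mx mul0mx mul1mx.
  rewrite -mulmxA -(hmx_intertwine g E) mulmxA -hmx_scalar1; congr (_ *m _).
  by rewrite -{1}[v]hsubmxK mul_row_col mulmx1 mulmx0 addr0.
have pan k : (psi ^+ k).[a] != 0 by rewrite horner_exp expf_neq0.
apply/existsP/existsP => -[X /andP[]]; rewrite inE => /andP[fX /eqP XA] /kermx_subP Xf.
  move: XA; rewrite -[X]hsubmxK; set X0 := lsubmx X; set X1 := rsubmx X.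
  rewrite mul_row_block mulmx0 addr0 mul_mx_row => /eq_row_mx[X0A X1A].
  have X00 : X0 = 0.
    have := hmx_intertwine (psi ^+ dimT fs) X0A; rewrite T0 mul0mx hmx_scalar1.
    by rewrite mul_mx_scalar => /eqP; rewrite scaler_eq0 (negPf (pan _)) => /eqP.
  move: X1A; rewrite X00 mul0mx add0r => X1A.
  exists X1; apply/andP; split.
    rewrite inE X1A eqxx andbT; move: fX; rewrite -[X]hsubmxK -/X0 -/X1 X00.
    rewrite -!kermx_eq0 => /rowV0P h; apply/rowV0P => v /sub_kermxP vX; apply: h.
    by apply/sub_kermxP; rewrite mul_mx_row mulmx0 vX row_mx0.
  apply/kermx_subP => v vB.
  have /submxP[y yE] : (row_mx (0 : 'rV_1) v <= X)%MS.
    apply: Xf; rewrite bot exprSr hmxM mulmxA vB mul0mx.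
    by rewrite row_mx0.
  move: yE; rewrite -[X]hsubmxK -/X0 -/X1 mul_mx_row => /eq_row_mx[_ ->].
  exact: submxMl.
exists (row_mx 0 X); apply/andP; split.
  rewrite inE mul_row_block mulmx0 mul_mx_row !mul0mx !add0r mulmx0 XA eqxx andbT.
  move: fX; rewrite -!kermx_eq0 => /rowV0P h; apply/rowV0P => v /sub_kermxP vX; apply: h.
  by apply/sub_kermxP; move: vX; rewrite mul_mx_row -row_mx0 => /eq_row_mx[].
apply/kermx_subP => v vx.
have l0 : lsubmx v = 0.
  have := lft (psi ^+ n.+1) v; rewrite vx mul0mx mul_mx_scalar => /esym/eqP.
  by rewrite scaler_eq0 (negPf (pan _)) => /eqP.
move: vx; rewrite -[v]hsubmxK l0 bot -row_mx0 => /eq_row_mx[_ vB].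
have /submxP[y ->] : (rsubmx v <= X)%MS.
  (* The matrix x has size n + 1 and yields only a kernel vector of psi^(n+1)(B); kernels of powers
     are stationary from n on. *)
  by apply: Xf; rewrite hmx_exp; apply: (@ker_stab _ _ _ 1); rewrite addn1 -hmx_exp.
by apply/submxP; exists y; rewrite mul_mx_row mulmx0.
Qed.
End Block.

Lemma card_inAff (a : F) n (Q : pred 'M[F]_n.+1) : a != 0 ->
  #|[set x : 'M[F]_n.+1 | inAff a x && Q x]| =
  #|[set t : 'rV[F]_n * 'M[F]_n | (t.2 \in unitmx) &&
      Q (block_mx a%:M t.1 0 t.2 : 'M[F]_(1 + n))]|.
Proof.
move=> a0; pose f (t : 'rV[F]_n * 'M[F]_n) : 'M[F]_(1 + n) := block_mx a%:M t.1 0 t.2.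
have injf : injective f by move=> [? ?] [? ?] /eq_block_mx[_ /= -> _ ->].
have uf t : (f t \in unitmx) = (t.2 \in unitmx).
  by rewrite unitmxE det_ublock unitrM det_scalar1 unitfE a0 -unitmxE.
rewrite -[RHS](card_imset _ injf); apply: eq_card => x; rewrite !inE.
apply/andP/imsetP => [[/andP[/andP[ux /eqP xa] /forallP x0] Qx]|[t + ->]].
  have xE : x = f (@ursubmx _ 1 n 1 n x, @drsubmx _ 1 n 1 n x).
    have h1 : @ulsubmx _ 1 n 1 n x = a%:M.
      apply/matrixP => i j; rewrite !ord1 !mxE eqxx mulr1n -[RHS]xa.
      by congr (x _ _); apply/val_inj.
    have h2 : @dlsubmx _ 1 n 1 n x = 0.
      apply/matrixP => i j; rewrite !ord1 !mxE.
      have := x0 (rshift 1 i); rewrite implyTb => /eqP <-.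
      by congr (x _ _); apply/val_inj.
    by rewrite /f -h1 -h2 (@submxK _ 1 n 1 n x).
  exists (@ursubmx _ 1 n 1 n x, @drsubmx _ 1 n 1 n x) => //.
  by rewrite inE -uf -[block_mx _ _ _ _]/(f (_, _)) -xE ux Qx.
rewrite inE => /andP[ut Qt]; split=> //; rewrite /inAff uf ut /=.
have e0 : (ord0 : 'I_(1 + n)) = lshift n ord0 by apply/val_inj.
apply/andP; split.
  apply/eqP; transitivity (f t (lshift n ord0) (lshift n ord0)).
    by congr (f t _ _); apply/val_inj.
  by rewrite /f block_mxEul mxE eqxx.
apply/forallP => j; apply/implyP => j0.
case: (split_ordP (j : 'I_(1 + n))) j0 => k -> j0.
  by move: j0; rewrite ord1 -e0 eqxx.
apply/eqP; transitivity (f t (rshift 1 k) (lshift n ord0)).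
  by congr (f t _ _); apply/val_inj.
by rewrite /f block_mxEdl mxE.
Qed.

Lemma card_inAff_tot (a : F) n : a != 0 ->
  #|[set x : 'M[F]_n.+1 | inAff a x]| = (#|F| ^ n * GLcard F n)%N.
Proof.
move=> a0; have := @card_inAff a n xpredT a0; under eq_finset do rewrite andbT.
move=> ->; have -> : (#|F| ^ n)%N = #|[set: 'rV[F]_n]| by rewrite cardsT card_mx mul1n.
by rewrite -cardsX; apply: eq_card => t; rewrite !inE andbT.
Qed.

(** Bridges the row vectors counted by [kcard] and the column eigenvectors that define the affine
    group; both kernels have the same dimension because transposition preserves rank. *)
Lemma card_kermx_tr n (B : 'M[F]_n) :
  #|[set v : 'rV[F]_n | v *m B^T == 0]| = #|[set v : 'rV[F]_n | v *m B == 0]|.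
Proof.
have H (C : 'M[F]_n) : #|[set v : 'rV[F]_n | v *m C == 0]| =
    #|[set v : 'rV[F]_n | v *m (pid_mx (\rank C) : 'M[F]_n) == 0]|.
  have inj : injective (fun v : 'rV[F]_n => v *m col_ebase C).
    exact: (can_inj (mulmxK (col_ebase_unit C))).
  rewrite -(card_imset _ inj); apply: eq_card => y; rewrite inE.
  apply/imsetP/eqP => [[v + ->]|yp].
    rewrite inE -{1}(mulmx_ebase C) !mulmxA => /eqP h.
    by apply: (can_inj (mulmxK (row_ebase_unit C))); rewrite mul0mx.
  exists (y *m invmx (col_ebase C)); last by rewrite mulmxKV // col_ebase_unit.
  by rewrite inE -{2}(mulmx_ebase C) !mulmxA mulmxKV ?col_ebase_unit // yp mul0mx.
by rewrite (H B^T) (H B) mxrank_tr.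
Qed.

Lemma inAffE (a : F) n (x : 'M[F]_n.+1) :
  inAff a x = (x \in unitmx) && (x *m (row_mx 1%:M 0 : 'rV[F]_(1 + n))^T ==
     a *: (row_mx 1%:M 0 : 'rV[F]_(1 + n))^T).
Proof.
rewrite /inAff -andbA; congr (_ && _).
set e := (row_mx _ _)^T.
have eE : e = delta_mx ord0 0.
  apply/colP => j; rewrite !mxE; case: splitP => k jk; rewrite !mxE.
    have -> : j = ord0 by apply/val_inj; rewrite /= jk ord1.
    by rewrite [k]ord1.
  by case: eqVneq jk => // ->.
have -> : x *m e = col ord0 x by rewrite eE colE.
rewrite eE; apply/andP/eqP => [[/eqP xa /forallP x0]|h].
  apply/colP => j; rewrite !mxE andbT; case: (eqVneq j ord0) => [->|j0].
    by rewrite mulr1.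
  by have := x0 j; rewrite j0 /= mulr0 => /eqP.
have H j : x j ord0 = a * (j == ord0)%:R.
  by have := congr1 (fun c : 'cV_n.+1 => c j 0) h; rewrite !mxE andbT.
split; first by rewrite H eqxx mulr1.
by apply/forallP => j; apply/implyP => /negPf j0; rewrite H j0 mulr0.
Qed.

(* Double count of the pairs (A, w) with w a nonzero column eigenvector of A for a. *)
Lemma inAff_count (a : F) n (E : pred 'M[F]_n.+1) :
  (forall g A, g \in unitmx -> E (invmx g *m A *m g) = E A) ->
  (\sum_(A : 'M[F]_n.+1 | (A \in unitmx) && E A) (kcard A ('X - a%:P)).-1 =
   #|[set x : 'M[F]_n.+1 | inAff a x && E x]| * (#|F| ^ n.+1).-1)%N.
Proof.
move=> invE.
transitivity (\sum_(A : 'M[F]_n.+1 | (A \in unitmx) && E A)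
   \sum_(w : 'rV[F]_n.+1 | (w != 0%R) && (A *m w^T == a *: w^T)) 1)%N.
  apply: eq_bigr => A _; rewrite sum1dep_card /kcard.
  rewrite [hmx _ _](_ : _ = A - a%:M); last first.
    by rewrite -polyCN hmxD hmxX hmxC raddfN.
  rewrite -card_kermx_tr (cardsD1 0) inE mul0mx eqxx /=.
  apply: eq_card => w; rewrite !inE; congr (_ && _).
  rewrite -(inj_eq (@trmx_inj _ _ _)) trmx_mul trmxK trmx0 mulmxBl mul_scalar_mx.
  by rewrite subr_eq0.
rewrite (exchange_big_dep (fun w : 'rV[F]_n.+1 => w != 0)) /=; last by move=> ? ? _ /andP[].
transitivity (\sum_(w : 'rV[F]_n.+1 | w != 0%R) #|[set x : 'M[F]_n.+1 | inAff a x && E x]|)%N.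
  apply: eq_bigr => w w0; rewrite sum1dep_card.
  have fw : row_free (w : 'rV[F]_(1 + n)) by rewrite /row_free rank_rV w0.
  have [h uh wE] := row_free_pid fw.
  have uh' : h^T \in unitmx by rewrite unitmx_tr.
  have wT : w^T = h^T *m (row_mx 1%:M 0 : 'rV[F]_(1 + n))^T by rewrite -trmx_mul -wE.
  have inj : injective (fun A : 'M[F]_n.+1 => h^T *m A *m invmx h^T).
    have ui : invmx h^T \in unitmx by rewrite unitmx_inv.
    move=> A B /(can_inj (mulmxK ui)); exact: (can_inj (mulKmx uh')).
  rewrite -[RHS](card_imset _ inj); apply: eq_card => A; rewrite inE.
  apply/idP/imsetP => [/andP[/andP[uA EA] /andP[_ /eqP Aw]]|[x + ->]].
    exists (invmx h^T *m A *m h^T); last first.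
      by rewrite !mulmxA mulmxV // mul1mx mulmxK.
    rewrite inE invE // EA andbT inAffE !unitmx_mul unitmx_inv uh' uA /=.
    by rewrite -!mulmxA -wT Aw wT -scalemxAr mulKmx.
  rewrite inE inAffE => /andP[/andP[ux /eqP xe] Ex].
  have ui : invmx h^T \in unitmx by rewrite unitmx_inv.
  rewrite !unitmx_mul uh' ux ui w0 /= wT.
  have -> : E (h^T *m x *m invmx h^T) by have := invE _ x ui; rewrite invmxK => ->.
  by rewrite -!mulmxA mulKmx // xe -scalemxAr eqxx.
rewrite (eq_bigl (mem (predC1 (0 : 'rV[F]_n.+1)))) // sum_nat_const mulnC.
by rewrite cardC1 card_mx mul1n.
Qed.
End Affine.

(** * Laws for a fixed corner entry *)

Section AffineLaw.
Variables (R : realType) (F : finFieldType).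
Local Notation q := (#|F|%:R : R).
Local Notation Qp p := (q ^+ (size p).-1).

Lemma q_gt1 : 1 < q.
Proof. by rewrite ltr1n card_field_gt1. Qed.

Lemma eq_prob_unif (G : forall n, 'M[F]_n.+1 -> bool) n (E1 E2 : event F) :
  (forall x : 'M[F]_n.+1, E1 n x = E2 n x) -> prob_unif G n E1 = prob_unif G n E2 :> R.
Proof.
by move=> E; rewrite /prob_unif; congr (_%:R / _); apply: eq_card => x; rewrite !inE E.
Qed.

Lemma EGL_bool n (E : pred 'M[F]_n) :
  EGL (fun A => (E A)%:R) = #|[set A : 'M[F]_n | (A \in unitmx) && E A]|%:R / (GLcard F n)%:R :> R.
Proof.
rewrite /EGL -sum1dep_card natr_sum [in RHS]big_mkcondr; congr (_ / _).
by apply: eq_bigr => A _; case: (E A).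
Qed.

Section Fixed.
Variables (a : F) (S : seq {poly F}) (L : {poly F} -> seq nat).
Hypothesis a0 : a != 0.
Hypothesis gS : good_coll S.
Hypothesis pL : forall p, p \in S -> is_partition (L p).

Lemma prob_Aa_noneig n : 'X - a%:P \notin S ->
  prob_unif (@inAff F a) n (ev_joint S L) = EGL (fun A : 'M[F]_n => (type_event S L A)%:R) :> R.
Proof.
move=> aS; rewrite EGL_bool /prob_unif card_inAff_tot //.
have -> : #|[set x : 'M[F]_n.+1 | inAff a x && ev_joint S L x]| =
  (#|F| ^ n * #|[set A : 'M[F]_n | (A \in unitmx) && type_event S L A]|)%N.
  rewrite card_inAff //; have -> : (#|F| ^ n)%N = #|[set: 'rV[F]_n]|.
    by rewrite cardsT card_mx mul1n.
  rewrite -cardsX; apply: eq_card => t; rewrite !inE; congr (_ && _).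
  rewrite -has_type_rcf // /type_event has_type_utri ?blocks_root //.
  rewrite horner_prod prodf_seq_neq0; apply/allP => p pS /=.
  rewrite -/(root p a) -coprimep_XsubC.
  have [mp ip _] := gS.2 p pS.
  apply: coprime_monic_irred; rewrite ?monicXsubC //; first exact: irredp_XsubC.
  by apply: contraNneq aS => <-.
rewrite !natrM -mulf_div divff ?mul1r // pnatr_eq0 -lt0n expn_gt0.
by rewrite (ltn_trans _ (card_field_gt1 F)).
Qed.

Lemma card_emb_lin n (A : 'M[F]_n) : #|emb [:: 'X - a%:P] A| = (kcard A ('X - a%:P)).-1.
Proof.
have := @card_emb_exp F n [::] A ('X - a%:P) 1 (irredp_XsubC a) isT (fun f h => ltac:(by [])).
rewrite expr1 card_emb_nil !mul1n kcard0 kcard_Tmx big_nil => <-.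
by rewrite addn1.
Qed.

(** A nonzero eigenvector for a is an embedding of F['X]/('X - a), so a uniform invertible matrix
    has one on average. This evaluates the normalizing constant below. *)
Lemma sum_kcard_lin n :
  (\sum_(A : 'M[F]_n.+1 | A \in unitmx) (kcard A ('X - a%:P)).-1 = GLcard F n.+1)%N.
Proof.
under eq_bigr do rewrite -card_emb_lin.
have uT : Tmx [:: 'X - a%:P] \in unitmx.
  apply: Tmx_unit => f; rewrite inE => /eqP ->; split; first by rewrite size_XsubC.
  apply: coprimeX_irred; [exact: monicXsubC | exact: irredp_XsubC |].
  by rewrite -subr_eq0 addrAC subrr add0r oppr_eq0 polyC_eq0.
by rewrite (sum_emb _ uT) /= size_XsubC.
Qed.

(** The quotient of two instances of [inAff_count], for the event and for all matrices. The number
    of nonzero eigenvectors is constant on the event, which brings out the weight. *)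
Lemma prob_Aa_eig n : 'X - a%:P \in S ->
  prob_unif (@inAff F a) n (ev_joint S L) =
  (q ^+ pconj (L ('X - a%:P)) 1 - 1) * EGL (fun A : 'M[F]_n.+1 => (type_event S L A)%:R) :> R.
Proof.
move=> aS; rewrite EGL_bool /prob_unif.
have eE : #|[set x : 'M[F]_n.+1 | inAff a x && ev_joint S L x]| =
          #|[set x : 'M[F]_n.+1 | inAff a x && type_event S L x]|.
  by apply: eq_card => x; rewrite !inE has_type_rcf.
have c1 := @inAff_count F a n (@type_event F S L n.+1) (fun g A ug => has_type_conj _ _ A ug).
have c2 := @inAff_count F a n xpredT (fun g A ug => erefl).
have c3 := sum_kcard_lin n.
have E2 : (GLcard F n.+1 = #|[set x : 'M[F]_n.+1 | inAff a x]| * (#|F| ^ n.+1).-1)%N.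
  rewrite -c3; move: c2; under eq_bigl do rewrite andbT.
  by under [in RHS]eq_finset do rewrite andbT.
have kE (A : 'M[F]_n.+1) : type_event S L A ->
    (kcard A ('X - a%:P)).-1 = (#|F| ^ pconj (L ('X - a%:P)) 1).-1.
  move=> ty; congr _.-1; rewrite -[X in kcard _ X]expr1 (kcard_full ty) //; last first.
    by rewrite (big_rem _ aS) /= dvdp_mulr.
  rewrite (kcard_blocks gS pL) // size_XsubC mul1n pconjE; congr (_ ^ _)%N.
  by apply: eq_bigr => e _; case: e => [|e]; rewrite ?minn0 //= (minn_idPl _).
have E1 : (#|[set A : 'M[F]_n.+1 | (A \in unitmx) && type_event S L A]| *
    (#|F| ^ pconj (L ('X - a%:P)) 1).-1 =
    #|[set x : 'M[F]_n.+1 | inAff a x && type_event S L x]| * (#|F| ^ n.+1).-1)%N.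
  rewrite -c1 -sum1dep_card big_distrl /=; apply: eq_bigr => A /andP[_ ty].
  by rewrite kE // mul1n.
have q0 : (0 < #|F|)%N by rewrite (ltn_trans _ (card_field_gt1 F)).
have qn0 : (0 < (#|F| ^ n.+1).-1)%N.
  by rewrite -subn1 subn_gt0 -[ltnLHS](exp1n n.+1) ltn_exp2r // card_field_gt1.
have -> : q ^+ pconj (L ('X - a%:P)) 1 - 1 = ((#|F| ^ pconj (L ('X - a%:P)) 1).-1)%:R.
  by rewrite -natrX -subn1 natrB // expn_gt0 q0.
rewrite eE mulrA -natrM mulnC E1 E2 !natrM -mulf_div divff ?mulr1 //.
by rewrite pnatr_eq0 -lt0n.
Qed.

(** Inverse of [mean_delay1]: index n of the affine group corresponds to index n + 1 of the general
    linear group, and moving back divides by u. *)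
Lemma mean_advance u (f : nat -> R) l : mean u (delay 1 f) l -> mean u f (l / u).
Proof.
case=> -[uE hl]; [left|right]; split=> //.
  move: hl; rewrite uE divr1 -cvg_shiftS (_ : (fun n => _) = f) //.
  by apply/funext => n; rewrite /delay /= subn1.
case/andP: (uE) => u0 _.
move: hl; rewrite -cvg_shiftS => hl.
rewrite (_ : abel_sum u f = fun N => u^-1 * abel_sum u (delay 1 f) N.+1).
  by rewrite mulrC; apply: cvgMr.
apply/funext => N; rewrite /abel_sum big_ord_recl /= /delay /= mulr0 add0r mulr_sumr.
apply: eq_bigr => i _; rewrite /bump /= add1n subn1 /= exprS.
by field; rewrite gt_eqF.
Qed.

Lemma mean_Aa u : mean_param u ->
  mean u (fun n => prob_unif (@inAff F a) n (ev_joint S L))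
   (\prod_(p <- S) if p == 'X - a%:P then Ndist u q (L p)
                   else Mdist (u ^+ (size p).-1) (Qp p) (L p)).
Proof.
move=> up; have mG := mean_EGL up gS pL.
have [aS|aS] := boolP ('X - a%:P \in S); last first.
  rewrite (eq_big_seq (fun p : {poly F} => Mdist (u ^+ (size p).-1) (Qp p) (L p))).
    by apply: eq_mean mG => n; rewrite prob_Aa_noneig.
  by move=> p pS; case: eqVneq => // pE; rewrite pE (negPf aS) in pS.
set p0 := 'X - a%:P in aS *.
set c := q ^+ pconj (L p0) 1 - 1.
have uS : uniq S by case: gS.
have /andP[u0 u1] := mean_param01 up.
have psz0 : psize (L p0) = 0%N -> L p0 = [::].
  have := pL aS; rewrite /is_partition /psize => /andP[_].
  by case: (L p0) => //= e l /andP[e0 _]; lia.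
have m1 : mean u (fun n => c * EGL (fun A : 'M[F]_n.+1 => (type_event S L A)%:R))
   (c * (\prod_(p <- S) Mdist (u ^+ (size p).-1) (Qp p) (L p)) / u).
  apply: mean_advance; apply: eq_mean (meanZ c mG) => -[|n]; last first.
    by rewrite /delay /= subn1.
  (* At index 0 the delayed sequence is 0, and so must be the weighted probability for GL_0: an
     empty partition has weight 0, and a nonempty one does not fit in dimension 0. *)
  rewrite /delay /=; have [l0|ln0] := eqVneq (psize (L p0)) 0%N.
    by rewrite /c (psz0 l0) /pconj /= expr0 subrr mul0r.
  rewrite /EGL big1 ?mul0r ?mulr0 // => A _.
  suff -> : type_event S L A = false by [].
  rewrite /type_event; case: (boolP (has_type _ _ _)) => // /existsP[X /andP[/row_free_dim + _]].
  rewrite dimT_blocks (big_rem _ aS) /=.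
  by rewrite size_XsubC mul1n -/(psize _); lia.
suff -> : \prod_(p <- S) (if p == p0 then Ndist u q (L p)
                   else Mdist (u ^+ (size p).-1) (Qp p) (L p)) =
  c * (\prod_(p <- S) Mdist (u ^+ (size p).-1) (Qp p) (L p)) / u.
  by apply: eq_mean m1 => n; rewrite prob_Aa_eig.
rewrite (bigD1_seq p0) //= eqxx [in RHS](bigD1_seq p0) //=.
rewrite (eq_bigr (fun p : {poly F} => Mdist (u ^+ (size p).-1) (Qp p) (L p))); last first.
  by move=> p /negPf ->.
have key : Ndist u q (L p0) = c * Mdist u q (L p0) / u.
  rewrite /Ndist /Mdist; case: (eqVneq (psize (L p0)) 0%N) => [l0|ln0].
    by rewrite /c (psz0 l0) /pconj /= expr0 subrr !mul0r.
  have pd : pdenom q (L p0) != 0 by rewrite gt_eqF // pdenom_gt0 // q_gt1.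
  have -> : u ^+ psize (L p0) = u * u ^+ (psize (L p0)).-1.
    by rewrite -exprS prednK // lt0n.
  rewrite /c; field.
  by rewrite pd gt_eqF.
by rewrite key [size p0]size_XsubC /= !expr1 [in RHS]mulrA [in RHS]mulrAC.
Qed.

End Fixed.

Lemma prob_P n (E : event F) : prob_unif (@inP F) n E =
  \sum_(a : F | a != 0) (q - 1)^-1 * prob_unif (@inAff F a) n E :> R.
Proof.
have part (Q : pred 'M[F]_n.+1) : #|[set x : 'M[F]_n.+1 | inP x && Q x]| =
    (\sum_(a : F | a != 0%R) #|[set x : 'M[F]_n.+1 | inAff a x && Q x]|)%N.
  rewrite -sum1dep_card (partition_big (fun x : 'M[F]_n.+1 => x ord0 ord0) (fun a => a != 0)) /=.
    apply: eq_bigr => a a0; rewrite -sum1dep_card; apply: eq_bigl => x.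
    rewrite /inP /inAff; case: (eqVneq (x ord0 ord0) a) => [->|_]; rewrite ?a0 ?andbT //.
    by rewrite !andbF.
  by move=> x /andP[/andP[/andP[_ ->]]].
have tot : #|[set x : 'M[F]_n.+1 | inP x]| = (#|F|.-1 * (#|F| ^ n * GLcard F n))%N.
  have := part xpredT; under eq_finset do rewrite andbT; move=> ->.
  rewrite (eq_bigr (fun=> (#|F| ^ n * GLcard F n)%N)); last first.
    by move=> a a0; rewrite -(card_inAff_tot n a0); apply: eq_card => x; rewrite !inE andbT.
  by rewrite (eq_bigl (mem (predC1 (0 : F)))) // sum_nat_const cardC1.
have q1 : q - 1 = (#|F|.-1)%:R by rewrite -subn1 natrB // (ltn_trans _ (card_field_gt1 F)).
rewrite /prob_unif part tot natr_sum mulr_suml; apply: eq_bigr => a a0.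
by rewrite card_inAff_tot // q1 natrM invfM mulrCA.
Qed.

Lemma mean_P u S (L : {poly F} -> seq nat) : mean_param u -> good_coll S ->
  (forall p, p \in S -> is_partition (L p)) ->
  mean u (fun n => prob_unif (@inP F) n (ev_joint S L))
   (\sum_(a : F | a != 0) (q - 1)^-1 *
     \prod_(p <- S) if p == 'X - a%:P then Ndist u q (L p)
                   else Mdist (u ^+ (size p).-1) (Qp p) (L p)).
Proof.
move=> up gS pL; apply: eq_mean (mean_sum _ _ up (fun a a0 => mean_Aa a0 gS pL up)) => n.
by rewrite prob_P.
Qed.
End AffineLaw.

(** * Laws for the parabolic group *)

Section ProjectiveLaw.
Variables (R : realType) (F : finFieldType).
Local Notation q := (#|F|%:R : R).
Local Notation Qp p := (q ^+ (size p).-1).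

Lemma mean_prob_rand u (G : forall n, 'M[F]_n.+1 -> bool) (E : event F) (l : R) :
  0 < u < 1 -> mean u (fun n => prob_unif G n E) l -> prob_rand G u E = l.
Proof.
move=> /andP[_ u1] [[uE _]|[_ h]]; first by rewrite uE ltxx in u1.
by apply/cvg_lim => //; apply: h.
Qed.

Lemma mean_cvg (h : nat -> R) l : mean 1 h l -> (h @ \oo --> l)%classic.
Proof. by case=> -[//]; rewrite ltxx andbF. Qed.

Lemma good_coll2W (S : seq {poly F}) : good_coll2 S -> good_coll S.
Proof.
case=> uS h; split=> // p /h[mp ip sp]; split=> //.
by apply: contraTneq sp => ->; rewrite size_polyX.
Qed.

Lemma good_coll2_lin (S : seq {poly F}) a : good_coll2 S -> 'X - a%:P \notin S.
Proof.
by case=> _ h; apply/negP => /h[_ _]; rewrite size_XsubC.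
Qed.

Lemma eq_XsubC (a b : F) : ('X - b%:P == 'X - a%:P :> {poly F}) = (b == a).
Proof. by rewrite (inj_eq (addrI _)) (inj_eq oppr_inj) (inj_eq polyC_inj). Qed.

Lemma good_lin (a : F) : a != 0 ->
  [/\ 'X - a%:P \is monic, irreducible_poly ('X - a%:P) & 'X - a%:P != 'X].
Proof.
move=> a0; split; [exact: monicXsubC | exact: irredp_XsubC |].
by rewrite -subr_eq0 addrAC subrr add0r oppr_eq0 polyC_eq0.
Qed.

Lemma sum_nonzero (c : R) : \sum_(a : F | a != 0) c = (q - 1) * c.
Proof.
have -> : q - 1 = (#|F|.-1)%:R by rewrite -subn1 natrB // (ltn_trans _ (card_field_gt1 F)).
by rewrite (eq_bigl (mem (predC1 (0 : F)))) // sumr_const cardC1 mulr_natl.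
Qed.

Lemma q1_neq0 : q - 1 != 0.
Proof. by rewrite subr_eq0 gt_eqF // q_gt1. Qed.

Lemma mean_P_high u S L : mean_param u -> good_coll2 S ->
  (forall p, p \in S -> is_partition (L p)) ->
  mean u (fun n => prob_unif (@inP F) n (ev_joint S L))
    (\prod_(p <- S) Mdist (u ^+ deg p) (q ^+ deg p) (L p)).
Proof.
move=> up gS pL; set M := \prod_(p <- S) _.
suff -> : M = \sum_(a : F | a != 0) (q - 1)^-1 *
     \prod_(p <- S) if p == 'X - a%:P then Ndist u q (L p)
                   else Mdist (u ^+ (size p).-1) (Qp p) (L p).
  by apply: mean_P => //; apply: good_coll2W.
rewrite (eq_bigr (fun=> (q - 1)^-1 * M)) ?sum_nonzero ?mulVKf ?q1_neq0 // => a _.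
congr (_ * _); apply: eq_big_seq => p pS.
by case: eqVneq => // pE; move: pS; rewrite pE (negPf (good_coll2_lin a gS)).
Qed.

Lemma mean_P_lin u a l : mean_param u -> a != 0 -> is_partition l ->
  mean u (fun n => prob_unif (@inP F) n (ev_joint [:: 'X - a%:P] (fun=> l)))
    ((q - 1)^-1 * Ndist u q l + (q - 2) / (q - 1) * Mdist u q l).
Proof.
move=> up a0 pl.
have gS : good_coll [:: 'X - a%:P].
  by split=> // p; rewrite inE => /eqP ->; apply: good_lin.
suff -> : (q - 1)^-1 * Ndist u q l + (q - 2) / (q - 1) * Mdist u q l =
   \sum_(b : F | b != 0) (q - 1)^-1 *
     \prod_(p <- [:: 'X - a%:P]) if p == 'X - b%:P then Ndist u q l
                   else Mdist (u ^+ (size p).-1) (Qp p) l.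
  by apply: (mean_P (L := fun=> l)).
(* The corner entry b = a contributes N, each of the q - 2 others M. *)
rewrite (bigD1 a) //= big_seq1 eqxx; congr (_ + _).
transitivity (\sum_(b : F | (b != 0) && (b != a)) (q - 1)^-1 * Mdist u q l).
  have := sum_nonzero ((q - 1)^-1 * Mdist u q l); rewrite (bigD1 a) //=.
  move/(canRL (addKr _)) => ->; field; exact: q1_neq0.
apply: eq_bigr => b /andP[_ ba]; rewrite big_seq1 eq_XsubC eq_sym (negPf ba).
by rewrite size_XsubC /= !expr1.
Qed.

(** The corner entry a is uniform among the nonzero scalars, and given a the components are
    independent with only the one at a biased; the mixture over a creates the dependence. *)
Definition lin_law u (G : F -> seq nat) : R :=
  \sum_(a : F | a != 0) (q - 1)^-1 *
    \prod_(b : F | b != 0) if b == a then Ndist u q (G b) else Mdist u q (G b).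

Lemma mean_P_joint u S L G : mean_param u -> good_coll2 S ->
  (forall p, p \in S -> is_partition (L p)) -> (forall a, a != 0 -> is_partition (G a)) ->
  mean u (fun n => prob_unif (@inP F) n (ev_and (ev_joint S L) (ev_lin G)))
    ((\prod_(p <- S) Mdist (u ^+ deg p) (q ^+ deg p) (L p)) * lin_law u G).
Proof.
move=> up gS pL pG.
pose lins := [seq 'X - a%:P | a <- enum (predC1 (0 : F))].
(* The scalar of a linear factor 'X - a is read off from its constant coefficient -a. *)
pose L' p := if p \in S then L p else G (- p`_0).
have linS b : 'X - b%:P \notin S := good_coll2_lin b gS.
have L'lin b : L' ('X - b%:P) = G b.
  by rewrite /L' (negPf (linS b)) coefB coefX coefC sub0r opprK.
have memlin p : p \in lins -> exists2 b, b != 0 & p = 'X - b%:P.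
  by case/mapP => b; rewrite mem_enum => b0 ->; exists b.
have gS' : good_coll (S ++ lins).
  split=> [|p]; last first.
    rewrite mem_cat => /orP[|/memlin[b b0 ->]]; last exact: good_lin.
    exact: (good_coll2W gS).2.
  rewrite cat_uniq (good_coll2W gS).1 map_inj_uniq ?enum_uniq ?andbT /=.
    by apply/hasPn => p /memlin[b _ ->] /=.
  by move=> a b /eqP; rewrite eq_XsubC => /eqP.
have pL' p : p \in S ++ lins -> is_partition (L' p).
  rewrite mem_cat => /orP[pS|/memlin[b b0 ->]]; first by rewrite /L' pS pL.
  by rewrite L'lin pG.
have := mean_P up gS' pL'.
rewrite (_ : \sum_(a | _) _ = (\prod_(p <- S) Mdist (u ^+ deg p) (q ^+ deg p) (L p)) * lin_law u G).
  apply: eq_mean => n; apply: eq_prob_unif => x; rewrite /ev_joint /ev_and /ev_lin all_cat.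
  congr (_ && _); first by apply: eq_in_all => p pS; rewrite /L' pS.
  rewrite all_map; apply/allP/forallP => [h a|h a].
    by apply/implyP => a0; have := h a; rewrite mem_enum /= L'lin; apply.
  by rewrite mem_enum inE /= L'lin => a0; have := h a; rewrite a0.
rewrite /lin_law mulr_sumr; apply: eq_bigr => a a0; rewrite mulrCA; congr (_ * _).
rewrite big_cat; congr (_ * _).
  apply: eq_big_seq => p pS; rewrite /L' pS.
  by case: eqVneq => // pE; move: pS; rewrite pE (negPf (linS a)).
rewrite big_map big_enum; apply: eq_bigr => b _.
by rewrite eq_XsubC L'lin size_XsubC /= !expr1.
Qed.

Lemma mean_P_lins u G : mean_param u -> (forall a, a != 0 -> is_partition (G a)) ->
  mean u (fun n => prob_unif (@inP F) n (ev_lin G)) (lin_law u G).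
Proof.
move=> up pG; have gS : good_coll2 ([::] : seq {poly F}) by split.
have := @mean_P_joint u [::] (fun=> [::]) G up gS (fun p (h : p \in [::]) => isT) pG.
by rewrite big_nil mul1r.
Qed.

(** In every term the component at the corner entry follows N, which gives the empty partition no
    mass. Together with [prod_mix_nil] this exhibits the dependence. *)
Lemma lin_law_nil u : lin_law u (fun=> [::]) = 0.
Proof.
rewrite /lin_law big1 // => a a0; rewrite (bigD1 a) //= eqxx /Ndist /=.
by rewrite !mul0r mulr0.
Qed.

(** Each marginal keeps the summand with M, whose weight (q - 2)/(q - 1) is positive for q > 2. *)
Lemma prod_mix_nil u : mean_param u -> (2 < #|F|)%N ->
  \prod_(a : F | a != 0)
    ((q - 1)^-1 * Ndist u q [::] + (q - 2) / (q - 1) * Mdist u q [::]) != 0.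
Proof.
move=> up q3; apply/prodf_neq0 => a _.
have /andP[u0 u1] := mean_param01 up.
have q3R : 3 <= q by rewrite (ler_nat _ 3).
rewrite /Ndist /= mulr0 add0r gt_eqF // mulr_gt0 //; first by rewrite divr_gt0 //; lra.
rewrite /Mdist /= mulr1 divr_gt0 ?euler_prod_gt0 // ?(ltW u0) //.
by apply: pdenom_gt0; lra.
Qed.

End ProjectiveLaw.

Local Open Scope classical_set_scope.
Local Open Scope ring_scope.

Theorem theorem3p3 (R : realType) (F : finFieldType) :
  let q : R := (#|F|)%:R in
  let lin (a : F) : {poly F} := 'X - a%:P in
  let law (u : R) (phi : {poly F}) (l : seq nat) : R :=
    if phi == 'X - 1 then Ndist u q l
    else Mdist (u ^+ deg phi) (q ^+ deg phi) l in
  let mix (u : R) (l : seq nat) : R :=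
    (q - 1)^-1 * Ndist u q l + (q - 2) / (q - 1) * Mdist u q l in
  let parts (S : seq {poly F}) (Lam : {poly F} -> seq nat) : Prop :=
    forall phi, phi \in S -> is_partition (Lam phi) in
  let lparts (G : F -> seq nat) : Prop :=
    forall a, a != 0 -> is_partition (G a) in
  (* (1) *)
  (forall u : R, 0 < u < 1 ->
    forall (S : seq {poly F}) (Lam : {poly F} -> seq nat),
      good_coll S -> parts S Lam ->
      prob_rand (@inA F) u (ev_joint S Lam) = \prod_(phi <- S) law u phi (Lam phi))
  /\
  (* (2) *)
  (forall (S : seq {poly F}) (Lam : {poly F} -> seq nat),
      good_coll S -> parts S Lam ->
      (fun n : nat => prob_unif (@inA F) n (ev_joint S Lam) : R) @ \oo -->
        (\prod_(phi <- S) law 1 phi (Lam phi) : R))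
  /\
  (* (3) *)
  (forall u : R, 0 < u < 1 ->
    [/\ (forall (S : seq {poly F}) (Lam : {poly F} -> seq nat),
           good_coll2 S -> parts S Lam ->
           prob_rand (@inP F) u (ev_joint S Lam) =
             \prod_(phi <- S) Mdist (u ^+ deg phi) (q ^+ deg phi) (Lam phi)),
        (forall (S : seq {poly F}) (Lam : {poly F} -> seq nat) (G : F -> seq nat),
           good_coll2 S -> parts S Lam -> lparts G ->
           prob_rand (@inP F) u (ev_and (ev_joint S Lam) (ev_lin G)) =
             (\prod_(phi <- S) Mdist (u ^+ deg phi) (q ^+ deg phi) (Lam phi))
             * prob_rand (@inP F) u (ev_lin G)),
        (forall (a : F) (l : seq nat), a != 0 -> is_partition l ->
           prob_rand (@inP F) u (ev_joint [:: lin a] (fun _ => l)) = mix u l) &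
        ((2 < #|F|)%N -> exists G : F -> seq nat, lparts G /\
           prob_rand (@inP F) u (ev_lin G) !=
             \prod_(a : F | a != 0) prob_rand (@inP F) u (ev_joint [:: lin a] (fun _ => G a)))])
  /\
  (* (4) *)
  [/\ (forall (S : seq {poly F}) (Lam : {poly F} -> seq nat),
         good_coll2 S -> parts S Lam ->
         (fun n : nat => prob_unif (@inP F) n (ev_joint S Lam) : R) @ \oo -->
           (\prod_(phi <- S) Mdist 1 (q ^+ deg phi) (Lam phi) : R)),
      (forall (a : F) (l : seq nat), a != 0 -> is_partition l ->
         (fun n : nat => prob_unif (@inP F) n (ev_joint [:: lin a] (fun _ => l)) : R)
           @ \oo --> (mix 1 l : R)) &
      exists Lim : (F -> seq nat) -> R,
        (forall G : F -> seq nat, lparts G ->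
           ((fun n : nat => prob_unif (@inP F) n (ev_lin G) : R) @ \oo --> (Lim G : R)) /\
           (forall (S : seq {poly F}) (Lam : {poly F} -> seq nat),
              good_coll2 S -> parts S Lam ->
              (fun n : nat => prob_unif (@inP F) n (ev_and (ev_joint S Lam) (ev_lin G)) : R)
                @ \oo --> ((\prod_(phi <- S) Mdist 1 (q ^+ deg phi) (Lam phi)) * Lim G : R)))
        /\ ((2 < #|F|)%N -> exists G : F -> seq nat, lparts G /\
              Lim G != \prod_(a : F | a != 0) mix 1 (G a))].
Proof.
move=> q lin law mix parts lparts.
have up1 : mean_param (1 : R) by left.
have upu (u : R) : 0 < u < 1 -> mean_param u by right.
have mA u S Lam : mean_param u -> good_coll S -> parts S Lam ->
    mean u (fun n => prob_unif (@inA F) n (ev_joint S Lam))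
      (\prod_(phi <- S) law u phi (Lam phi)).
  (* By conversion [inA] is [inAff 1], and 'X - 1 is the linear factor of the corner entry 1. *)
  by move=> up gS pL; apply: (mean_Aa (oner_neq0 F) gS pL up).
have pnil : lparts (fun=> [::]) by [].
split; [|split; [|split]].
- by move=> u u01 S Lam gS pL; apply: mean_prob_rand => //; apply: mA => //; apply: upu.
- by move=> S Lam gS pL; apply: mean_cvg; apply: mA.
- move=> u u01; have up := upu u u01; split.
  + by move=> S Lam gS pL; apply: mean_prob_rand => //; apply: mean_P_high.
  + move=> S Lam G gS pL pG.
    rewrite (mean_prob_rand u01 (mean_P_lins up pG)).
    by apply: mean_prob_rand => //; apply: mean_P_joint.
  + by move=> a l a0 pl; apply: mean_prob_rand => //; apply: mean_P_lin.
  + move=> q2; exists (fun=> [::]); split=> //.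
    rewrite (mean_prob_rand u01 (mean_P_lins up pnil)) lin_law_nil eq_sym.
    rewrite (eq_bigr (fun=> mix u [::])); first exact: prod_mix_nil.
    by move=> a a0; apply: mean_prob_rand => //; apply: mean_P_lin.
- have high (S : seq {poly F}) Lam :
      \prod_(phi <- S) Mdist 1 (q ^+ deg phi) (Lam phi) =
      \prod_(phi <- S) Mdist (1 ^+ deg phi) (q ^+ deg phi) (Lam phi).
    by apply: eq_bigr => p _; rewrite expr1n.
  split.
  + by move=> S Lam gS pL; rewrite high; apply: mean_cvg; apply: mean_P_high.
  + by move=> a l a0 pl; apply: mean_cvg; apply: mean_P_lin.
  + exists (@lin_law R F 1); split.
      move=> G pG; split; first by apply: mean_cvg; apply: mean_P_lins.
      by move=> S Lam gS pL; rewrite high; apply: mean_cvg; apply: mean_P_joint.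
    move=> q2; exists (fun=> [::]); split=> //.
    by rewrite lin_law_nil eq_sym; apply: prod_mix_nil.
Qed.
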